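(* Let $1 < p < \infty$, $0 < q \leq \infty$, $\alpha > 0$, and $b > 1/q$ ($b \geq 0$ if $q=\infty$). Let the Fourier series of $f \in L_1(\mathbb{T})$ be given by $$f(x) \sim \sum_{n=1}^\infty (a_n \cos n x + b_n \sin nx)$$ where $\{a_n\}_{n \in \mathbb{N}}, \{b_n\}_{n \in \mathbb{N}}$ are non-negative general monotone sequences. Then $$\|f\|_{\mathrm{Lip}^{(\alpha,-b)}_{p,q}(\mathbb{T})} \asymp \left(\sum_{n=1}^\infty (1 + \log n)^{- b q} \left(\sum_{k=1}^n k^{\alpha p + p - 2} (a_k^p + b_k^p) \right)^{q/p} \frac{1}{n}\right)^{1/q}$$ (with the usual modification, supremum over $n$, if $q=\infty$).
   Context: A sequence $a=\{a_n\}_{n\in\mathbb{N}}$ is general monotone ($a\in GM$) if there is a constant $C>0$, independent of $n$, such that $\sum_{k=n}^{2n-1}|a_k-a_{k+1}|\le C|a_n|$ for all $n\in\mathbb{N}$. $A\asymp B$ means $c^{-1}A\le B\le cA$ with a constant $c>0$ independent of the essential variables; one side is finite if and only if the other is. Lipschitz space on the one-dimensional torus $\mathbb{T}$: for $\alpha>0$, $h\in\mathbb{R}$, $\Delta^\alpha_h f(x)=\sum_{j=0}^\infty(-1)^j\binom{\alpha}{j}f(x+(\alpha-j)h)$, where $\binom{\alpha}{j}=\frac{\alpha(\alpha-1)\cdots(\alpha-j+1)}{j!}$, $\binom{\alpha}{0}=1$, and $\omega_\alpha(f,t)_p=\sup_{|h|\le t}\|\Delta_h^\alpha f\|_{L_p(\mathbb{T})}$,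 $t>0$. $\mathrm{Lip}^{(\alpha,-b)}_{p,q}(\mathbb{T})$ is the set of $f\in L_p(\mathbb{T})$ with $$\|f\|_{\mathrm{Lip}^{(\alpha,-b)}_{p,q}}=\|f\|_{L_p}+\Big(\int_0^1\big(t^{-\alpha}(1-\log t)^{-b}\omega_\alpha(f,t)_p\big)^q\frac{dt}{t}\Big)^{1/q}<\infty$$ (supremum over $0<t<1$ if $q=\infty$). *)

(* Defs.v *)
From HB Require Import structures.
From mathcomp Require Import all_boot all_order all_algebra.
From mathcomp Require Import all_classical all_reals all_analysis.

Set Implicit Arguments.
Unset Strict Implicit.
Unset Printing Implicit Defensive.

Import Order.TTheory GRing.Theory Num.Theory.
Import numFieldNormedType.Exports.

Local Open Scope classical_set_scope.
Local Open Scope ring_scope.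

(* Functions on the torus are (2 * pi)-periodic functions R -> R; norms and
   integrals are taken over the period [-pi, pi] for the (unnormalized)
   Lebesgue measure. *)
Definition torus {R : realType} : set R := `[- pi, pi]%classic.

Definition in_L1_torus {R : realType} (f : R -> R) : Prop :=
  periodic f (pi *+ 2) /\ lebesgue_measure.-integrable torus (EFin \o f).

(* The value is +oo when f is not in L_p. *)
Definition Lp_norm_torus {R : realType} (p : R) (f : R -> R) : \bar R :=
  ('N[lebesgue_measure]_(p%:E)[EFin \o (f \_ torus)])%E.

Definition fourier_cos {R : realType} (f : R -> R) (n : nat) : R :=
  pi^-1 * \int[lebesgue_measure]_(x in torus) (f x * cos (n%:R * x)).

Definition fourier_sin {R : realType} (f : R -> R) (n : nat) : R :=
  pi^-1 * \int[lebesgue_measure]_(x in torus) (f x * sin (n%:R * x)).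

(* f ~ \sum_(n >= 1) (a_n cos (n x) + b_n sin (n x)); the constant term of the
   series is zero, and the values a 0 and b 0 play no role. *)
Definition has_fourier_series {R : realType} (f : R -> R) (a b : nat -> R) :
    Prop :=
  fourier_cos f 0 = 0 /\
  forall n, (0 < n)%N -> a n = fourier_cos f n /\ b n = fourier_sin f n.

(* a is general monotone when gm_with C a holds for some C > 0; sequences are
   indexed by the positive integers, a 0 is ignored. *)
Definition gm_with {R : realType} (C : R) (a : nat -> R) : Prop :=
  forall n, (0 < n)%N -> \sum_(n <= k < n.*2) `|a k - a k.+1| <= C * `|a n|.

Definition gbinom {R : realType} (alpha : R) (j : nat) : R :=
  (\prod_(i < j) (alpha - i%:R)) / (j`!)%:R.

(* For alpha > 0 and f in L_1 of the torus this series converges absolutely for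
   almost every x, because \sum_j `|gbinom alpha j| is finite; at the remaining
   points limn returns a fixed default value, which does not affect norms. *)
Definition frac_diff {R : realType} (alpha h : R) (f : R -> R) (x : R) : R :=
  limn (series (fun j : nat =>
    (-1) ^+ j * gbinom alpha j * f (x + (alpha - j%:R) * h))).

Definition modulus {R : realType} (alpha p : R) (f : R -> R) (t : R) : \bar R :=
  ereal_sup [set Lp_norm_torus p (frac_diff alpha h f)
            | h in [set h : R | `|h| <= t]].

(* The parameter q ranges over ]0, +oo]; the branch -oo is never used. *)
Definition Lip_seminorm {R : realType} (alpha b p : R) (q : \bar R)
    (f : R -> R) : \bar R :=
  let w t := ((t `^ (- alpha) * (1 - ln t) `^ (- b))%:E
              * modulus alpha p f t)%E in
  match q with
  | r%:E => ((\int[lebesgue_measure]_(t in `]0%R, 1%R[)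
                (w t `^ r * (t^-1)%:E)) `^ r^-1)%E
  | +oo%E => ereal_sup [set w t | t in `]0, 1[]
  | -oo%E => 0%E
  end.

Definition Lip_norm {R : realType} (alpha b p : R) (q : \bar R)
    (f : R -> R) : \bar R :=
  (Lp_norm_torus p f + Lip_seminorm alpha b p q f)%E.

Definition coef_sum {R : realType} (alpha p : R) (a b : nat -> R) (n : nat) :
    R :=
  \sum_(1 <= k < n.+1)
    k%:R `^ (alpha * p + p - 2) * (a k `^ p + b k `^ p).

Definition coef_norm {R : realType} (alpha s p : R) (q : \bar R)
    (a b : nat -> R) : \bar R :=
  match q with
  | r%:E => ((\sum_(1 <= n <oo)
                ((1 + ln n%:R) `^ (- (s * r))
                 * coef_sum alpha p a b n `^ (r / p) / n%:R)%:E) `^ r^-1)%E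
  | +oo%E => ereal_sup
      [set ((1 + ln n%:R) `^ (- s) * coef_sum alpha p a b n `^ p^-1)%:E
      | n in [set n : nat | (0 < n)%N]]
  | -oo%E => 0%E
  end.

(* In \bar R, so that one side is finite if and only if the other is. *)
Definition equiv_with {R : realType} (c : R) (A B : \bar R) : Prop :=
  ((c^-1)%:E * A <= B)%E /\ (B <= c%:E * A)%E.

(* Main.v *)
Require Import Defs.
From HB Require Import structures.
From mathcomp Require Import all_boot all_order all_algebra.
From mathcomp Require Import all_classical all_reals all_analysis.
From mathcomp Require Import measurable_realfun.
From mathcomp Require Import ring lra zify.

Set Implicit Arguments.
Unset Strict Implicit.
Unset Printing Implicit Defensive.

Import Order.TTheory GRing.Theory Num.Theory.
Import numFieldNormedType.Exports.

Local Open Scope classical_set_scope.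
Local Open Scope ring_scope.

(** The theorem compares two dyadic quantities.  Put [A i = a (2 ^ i) + b (2 ^ i)]
    and [X i = 2 ^ (i (1 - 1 / p)) * A i].  By general monotonicity the
    coefficients between [2 ^ i] and [2 ^ i.+1] are at most of the order of [A i]
    and at least of the order of [A i.+1], so the inner sum up to [2 ^ m] on the
    right-hand side is of the order of the sum of [(2 ^ (i alpha) * X i) ^ p] over
    [i <= m] ([coef_sum_dyadic]).  The logarithmic sum over [n] and the integral
    over [t] are both discretized at the powers of two, which turns the two sides
    into weighted [l_q] norms of sequences indexed by [m].

    Upper estimate.  On the shell where [`|x|] is of order [2 ^ (- j)], summation
    by parts bounds the block of frequencies [2 ^ i] of the Fourier series by a
    multiple of [A i * 2 ^ minn i j] ([trig_block], [fourier_block_le]).  In terms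
    of [X] the contributions of the blocks to the shells form a geometric
    convolution, hence the [L_p] norm of a sum of blocks is at most of the order of
    the [l_p] norm of the [X i] ([torus_dyadic_bound]).  A fractional difference
    of step [h] acts on a frequency [nu], up to a phase, as the boundary value of
    [(1 - z) ^ alpha] at [z = exp (- i nu h)] ([binomial_multiplier]); for
    frequencies up to [1 / `|h|] this multiplier is of the order of
    [(nu * `|h|) ^ alpha] and varies slowly, so that the difference of a block
    obeys the bound of the block with this additional factor ([diff_block_le]);
    for higher frequencies the difference is bounded by the function itself
    ([diff_majorant_Lp]).  That [f] is almost everywhere the sum of its blocks
    follows from the uniqueness of Fourier coefficients ([fourier_uniqueness]).
    Altogether the [L_p] norm of the difference of step at most [2 ^ (- m)] is
    bounded through [2 ^ (- alpha * (m - i)) * X i] for [i <= m] and through [X i]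
    for [i > m] ([frac_diff_upper]).

    Lower estimate.  The difference is tested against kernels of Fejer type whose
    frequencies lie between [2 ^ i / 2] and [2 ^ i] and whose phases make all terms
    nonnegative.  This bounds [A i] by integrals of the difference over the shells
    with geometric weights ([coef_le_shells]), and Hoelder's inequality on
    each shell followed by geometric convolution gives [frac_diff_lower].

    The two estimates agree except for the indices [i > m] in the first one.  They
    enter with a geometric weight in [i - m], which absorbs the logarithmic
    factors, and convolution with a geometric sequence is bounded on [l_q] for
    every [q > 0] ([geom_conv], [lqnorm_conv]). *)

(** * Geometric convolution on sequences *)

Lemma le_poweR (R : realType) (r : R) (x y : \bar R) :
  0 <= r -> (0 <= x)%E -> (x <= y)%E -> (x `^ r <= y `^ r)%E.
Proof.
move=> r0 x0 xy; apply: gt0_ler_poweR => //.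
  by rewrite in_itv/= x0 leey.
by rewrite in_itv/= (le_trans x0 xy) leey.
Qed.

Lemma poweR_inv_le (R : realType) (r : R) (x y : \bar R) :
  0 < r -> (0 <= x)%E -> (0 <= y)%E -> (x `^ r <= y)%E -> (x <= y `^ r^-1)%E.
Proof.
move=> r0 x0 y0 xy.
rewrite -[leLHS]poweRe1// -[X in (_ `^ X)%E](@divff _ r) ?gt_eqF// poweRrM.
by apply: le_poweR => //; [rewrite invr_ge0 ltW|exact: poweR_ge0].
Qed.

Lemma nneseries_le (R : realType) (u : nat -> \bar R) (x : \bar R) :
  (forall i, 0 <= u i)%E -> (forall n, \sum_(0 <= i < n) u i <= x)%E ->
  (\sum_(i <oo) u i <= x)%E.
Proof.
move=> u0 h; apply: lime_le; first by apply: is_cvg_nneseries => n _ _; exact: u0.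
by apply: nearW => n; exact: h.
Qed.

Lemma nneseries_term_le (R : realType) (u : nat -> \bar R) i :
  (forall i, 0 <= u i)%E -> (u i <= \sum_(k <oo) u k)%E.
Proof.
move=> u0; apply: (@le_trans _ _ (\sum_(0 <= k < i.+1) u k)%E).
  by rewrite big_nat_recr//= leeDr// sume_ge0.
by apply: nneseries_lim_ge => n _ _; exact: u0.
Qed.

Lemma nneseries_shift_le (R : realType) (u : nat -> \bar R) k :
  (forall i, 0 <= u i)%E -> (\sum_(i <oo) u (i + k)%N <= \sum_(i <oo) u i)%E.
Proof.
move=> u0; rewrite [leRHS](nneseries_split 0 k)// add0n nneseries_addn//.
by rewrite leeDr// sume_ge0.
Qed.

Definition dist (m i : nat) : nat := (m - i + (i - m))%N.

Lemma distC m i : dist m i = dist i m.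
Proof. by rewrite /dist addnC. Qed.

Lemma dist0n i : dist 0 i = i.
Proof. by rewrite /dist sub0n add0n subn0. Qed.

Lemma bernoulli_le (R : realType) (x : R) m :
  -1 <= x -> 1 + m%:R * x <= (1 + x) ^+ m.
Proof.
move=> x1; elim: m => [|m IH]; first by rewrite mul0r addr0 expr0.
rewrite exprS; apply: (@le_trans _ _ ((1 + x) * (1 + m%:R * x))).
  have : 0 <= m%:R * (x * x) by rewrite mulr_ge0// -expr2 sqr_ge0.
  by rewrite -natr1; lra.
by rewrite ler_wpM2l//; lra.
Qed.

Lemma sum_expr_le (R : realType) (lam : R) n :
  0 <= lam < 1 -> \sum_(0 <= k < n) lam ^+ k <= (1 - lam)^-1.
Proof.
move=> /andP[l0 l1]; rewrite -[leRHS]mul1r ler_pdivlMr ?subr_gt0//.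
have := subrX1 lam n; rewrite -(big_mkord xpredT (fun k => lam ^+ k)) => e.
rewrite -opprB mulrN mulrC -e opprB gerBl; exact: exprn_ge0.
Qed.

Lemma sum_expr_dist_le (R : realType) (lam : R) i n :
  0 <= lam < 1 -> \sum_(0 <= m < n) lam ^+ dist m i <= 2 / (1 - lam).
Proof.
move=> lam01; have /andP[l0 l1] := lam01.
suff h : \sum_(0 <= m < n) lam ^+ dist m i <=
    (1 - lam)^-1 + \sum_(0 <= k < i) lam ^+ k.
  by rewrite (le_trans h)// mulrDl !mul1r lerD2l sum_expr_le.
elim: i n => [n|i IHi [|n]].
- rewrite [X in _ + X]big_geq// addr0 (le_trans _ (sum_expr_le n lam01))//.
  by apply: ler_sum => k _; rewrite distC dist0n.
- rewrite big_geq// addr_ge0// ?invr_ge0 ?subr_ge0 1?[lam <= 1]ltW//.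
  by apply: sumr_ge0 => k _; exact: exprn_ge0.
rewrite big_nat_recl// dist0n [X in _ <= _ + X]big_nat_recr//= addrA.
rewrite addrC lerD// ?(le_trans (IHi n))//.
by rewrite exprS ler_piMl ?exprn_ge0// ltW.
Qed.

(** The weight is split as [lam = nu ^ 2]: one factor [nu] is summed, the other
    one turns the supremum of [nu ^ dist m i * u i] over [i] into a sum of
    [r]-th powers.  A supremum is bounded by an [r]-th power sum for every
    [r > 0], which a convexity argument would only give for [1 <= r]. *)
Lemma geom_conv_pointwise (R : realType) (nu r : R) (u : nat -> \bar R) m :
  0 <= nu < 1 -> 0 < r -> (forall i, 0 <= u i)%E ->
  (\sum_(i <oo) ((nu ^+ 2) ^+ dist m i)%:E * u i <=
   (2 / (1 - nu))%:E *
   (\sum_(i <oo) ((nu `^ r) ^+ dist m i)%:E * u i `^ r) `^ r^-1)%E.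
Proof.
move=> nu01 r0 u0; have /andP[n0 n1] := nu01.
set S := (\sum_(i <oo) _ * u i `^ r)%E.
have t0 i : (0 <= ((nu `^ r) ^+ dist m i)%:E * u i `^ r)%E.
  by rewrite mule_ge0 ?poweR_ge0// lee_fin exprn_ge0 ?powR_ge0.
have S0 : (0 <= S)%E by apply: nneseries_ge0 => i _ _; exact: t0.
have uS i : ((nu ^+ dist m i)%:E * u i <= S `^ r^-1)%E.
  apply: poweR_inv_le => //; first by rewrite mule_ge0// lee_fin exprn_ge0.
  rewrite poweRM//; last by rewrite lee_fin exprn_ge0.
  apply: le_trans (nneseries_term_le i t0).
  by rewrite poweR_EFin -(powR_mulrn _ n0) powRAC powR_mulrn// powR_ge0.
apply: (@le_trans _ _ (\sum_(i <oo) (nu ^+ dist m i)%:E * S `^ r^-1)%E).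
  apply: lee_nneseries => [i _ _|i _].
    by rewrite mule_ge0// lee_fin exprn_ge0// exprn_ge0.
  rewrite -exprM mulnC exprM expr2 EFinM -muleA.
  by rewrite lee_wpmul2l// lee_fin exprn_ge0.
apply: nneseries_le => [i|n].
  by rewrite mule_ge0 ?poweR_ge0// lee_fin exprn_ge0.
rewrite -ge0_sume_distrl; last by move=> i _; rewrite lee_fin exprn_ge0.
rewrite lee_wpmul2r ?poweR_ge0// sumEFin lee_fin.
under eq_bigr do rewrite distC.
exact: sum_expr_dist_le.
Qed.

(** Convolution with a geometric sequence is bounded on [l_r] for all [r > 0]:
    every interaction between dyadic scales below has this form. *)
Lemma geom_conv (R : realType) (lam r : R) : 0 <= lam < 1 -> 0 < r ->
  exists2 K : R, 0 < K & forall u : nat -> \bar R, (forall i, 0 <= u i)%E ->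
   (\sum_(m <oo) (\sum_(i <oo) (lam ^+ dist m i)%:E * u i) `^ r <=
    K%:E * \sum_(i <oo) u i `^ r)%E.
Proof.
move=> /andP[l0 l1] r0.
pose nu := Num.sqrt lam.
have n0 : 0 <= nu by exact: sqrtr_ge0.
have n1 : nu < 1 by rewrite -sqrtr1 ltr_sqrt.
have nu2 : nu ^+ 2 = lam by rewrite sqr_sqrtr.
have nr0 : 0 <= nu `^ r by exact: powR_ge0.
have nr1 : nu `^ r < 1
  by have := gt0_ltr_powR r0 n0 ler01 n1; rewrite powR1.
have c0 : 0 < 2 / (1 - nu) by rewrite divr_gt0// subr_gt0.
have d0 : 0 < 2 / (1 - nu `^ r) by rewrite divr_gt0// subr_gt0.
exists ((2 / (1 - nu)) `^ r * (2 / (1 - nu `^ r))).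
  by rewrite mulr_gt0// powR_gt0.
move=> u u0.
have t0 m i : (0 <= ((nu `^ r) ^+ dist m i)%:E * u i `^ r)%E.
  by rewrite mule_ge0 ?poweR_ge0// lee_fin exprn_ge0.
apply: (@le_trans _ _ (\sum_(m <oo) ((2 / (1 - nu)) `^ r)%:E *
    (\sum_(i <oo) ((nu `^ r) ^+ dist m i)%:E * u i `^ r))%E).
  apply: lee_nneseries => [m _ _|m _]; first exact: poweR_ge0.
  rewrite -nu2; apply: (@le_trans _ _ (((2 / (1 - nu))%:E *
   (\sum_(i <oo) ((nu `^ r) ^+ dist m i)%:E * u i `^ r) `^ r^-1) `^ r)%E).
    apply: le_poweR => //; first exact: ltW.
      apply: nneseries_ge0 => i _ _.
      by rewrite mule_ge0// lee_fin exprn_ge0// exprn_ge0.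
    by apply: geom_conv_pointwise => //; rewrite n0.
  rewrite poweRM ?poweR_ge0//; last by rewrite lee_fin ltW.
  rewrite -poweRrM mulVf ?gt_eqF// poweRe1//.
  by apply: nneseries_ge0 => i _ _; exact: t0.
rewrite nneseriesZl; last by move=> m _; apply: nneseries_ge0 => i _ _; exact: t0.
rewrite EFinM -muleA lee_wpmul2l ?lee_fin ?powR_ge0//.
rewrite nneseries_interchange//.
rewrite -nneseriesZl; last by move=> i _; exact: poweR_ge0.
apply: lee_nneseries => [i _ _|i _].
  by apply: nneseries_ge0 => m _ _; exact: t0.
apply: nneseries_le => // n.
rewrite -ge0_sume_distrl; last by move=> m _; rewrite lee_fin exprn_ge0.
rewrite lee_wpmul2r ?poweR_ge0// sumEFin lee_fin.
by apply: sum_expr_dist_le; rewrite nr0.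
Qed.

(** * Trigonometric sums on dyadic shells *)

Section TrigSums.
Context {R : realType}.
Implicit Types (x y d : R).

Lemma cos_lip x y : `|cos x - cos y| <= `|x - y|.
Proof.
wlog xy : x y / x < y.
  move=> h; have [xy|yx|->] := ltgtP x y; [exact: h| |by rewrite !subrr].
  by rewrite distrC [leRHS]distrC h.
have [|c _ e] := @MVT _ cos (fun z => - sin z) x y xy.
  by apply: continuous_subspaceT => z; exact: continuous_cos.
rewrite distrC [leRHS]distrC e normrM ler_piMl// normrN; exact: sin_max.
Qed.

Lemma sin_lip x y : `|sin x - sin y| <= `|x - y|.
Proof. by rewrite -!cosBpihalf (le_trans (cos_lip _ _))// opprB addrA subrK. Qed.

Lemma sin_ge_half x : 0 <= x <= 2^-1 -> x / 2 <= sin x.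
Proof.
move=> /andP[]; rewrite le_eqVlt => /predU1P[<- _|x0 x1]; first by rewrite mul0r sin0.
have [|c] := @MVT _ sin cos 0 x x0.
  by apply: continuous_subspaceT => z; exact: continuous_sin.
rewrite sin0 !subr0 in_itv/= => /andP[c0 cx] ->.
rewrite mulrC ler_wpM2r// ?ltW//.
have := cos_lip 0 c; rewrite cos0 sub0r normrN (gtr0_norm c0) => h.
have := ler_norm (1 - cos c); lra.
Qed.

Lemma sin_ge_eighth x : 0 <= x <= pi / 2 -> x / 8 <= sin x.
Proof.
move=> /andP[x0 x1].
have p2 : (pi / 2 : R) < 2 := pihalf_lt2 R.
have p1 : 1 <= (pi / 2 : R) := pihalf_ge1 R.
have [x2|x2] := leP x 2^-1.
  by apply: le_trans (sin_ge_half _); [lra|rewrite x0].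
have h : 2^-1 / 2 <= sin (2^-1 : R) by apply: sin_ge_half; lra.
apply: (@le_trans _ _ (sin (2^-1 : R))); first lra.
apply/ltW; rewrite ltr_sin// in_itv/=; apply/andP; split; lra.
Qed.

(** Multiplying by [2 * sin (x / 2)] makes the sum telescope. *)
Lemma sum_cos_telescope x d n m : (n <= m)%N ->
  2 * sin (x / 2) * \sum_(n <= k < m) cos (k%:R * x + d) =
  sin (m%:R * x + d - x / 2) - sin (n%:R * x + d - x / 2).
Proof.
move=> nm; rewrite -(telescope_sumr (fun k => sin (k%:R * x + d - x / 2)))//.
rewrite mulr_sumr; apply: eq_bigr => k _.
have -> : k.+1%:R * x + d - x / 2 = (k%:R * x + d) + x / 2.
  by rewrite -natr1; lra.
by rewrite sinD sinB; ring.
Qed.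

Definition shell (j : nat) : set R :=
  [set x | pi / 2 ^+ j.+1 < `|x| <= pi / 2 ^+ j].

(** On the shell of index [j] the Dirichlet kernel is of order [2 ^ j]. *)
Lemma sin_half_shell j x : shell j x -> (16 * 2 ^+ j)^-1 <= `|sin (x / 2)|.
Proof.
move=> /andP[x1 x2].
have p1 : 1 <= (pi / 2 : R) := pihalf_ge1 R.
have e2 : (0 : R) < 2 ^+ j by rewrite exprn_gt0.
have e2' : (1 : R) <= 2 ^+ j by rewrite exprn_ege1// ler1n.
have -> : `|sin (x / 2)| = `|sin (`|x| / 2)|.
  case: (ger0P x) => // _; by rewrite mulNr sinN normrN.
apply: le_trans (ler_norm _).
have xpi : `|x| <= pi.
  rewrite (le_trans x2)// ler_pdivrMr// ler_peMr//; exact: pi_ge0.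
apply: le_trans (sin_ge_eighth _); last by rewrite divr_ge0//= ler_pM2r.
have : pi / 2 ^+ j.+1 / 2 / 8 <= `|x| / 2 / 8 by rewrite !ler_pM2r// ltW.
apply: le_trans.
have -> : (pi : R) / 2 ^+ j.+1 / 2 / 8 = (pi / 2) * (16 * 2 ^+ j)^-1.
  by rewrite exprS; field; rewrite gt_eqF.
by rewrite ler_peMl// invr_ge0 mulr_ge0// ltW.
Qed.

Lemma sum_cos_shell j x d n m : shell j x -> (n <= m)%N ->
  `|\sum_(n <= k < m) cos (k%:R * x + d)| <= 16 * 2 ^+ j.
Proof.
move=> sx nm; have h := sin_half_shell sx.
have e2 : (0 : R) < 16 * 2 ^+ j by rewrite mulr_gt0// exprn_gt0.
have s0 : 0 < `|sin (x / 2)| by apply: lt_le_trans h; rewrite invr_gt0.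
have := congr1 Num.norm (sum_cos_telescope x d nm).
rewrite !normrM ger0_norm// => e.
set S := `|\sum_(_ <= _ < _) _| in e *.
have : 2 * `|sin (x / 2)| * S <= 2.
  rewrite e (le_trans (ler_normB _ _))//.
  by have := sin_max (m%:R * x + d - x / 2);
     have := sin_max (n%:R * x + d - x / 2); lra.
have S0 : 0 <= S by rewrite normr_ge0.
move=> h2; have {}h2 : `|sin (x / 2)| * S <= 1 by lra.
rewrite -(ler_pM2l s0) (le_trans h2)//.
by rewrite -ler_pdivrMr// mul1r.
Qed.

Definition dyadic_var (u : nat -> R) n := \sum_(n <= k < n.*2) `|u k - u k.+1|.

Lemma abel_sum (u v : nat -> R) (D : R) n m : (n <= m)%N ->
  (forall k, (n <= k <= m)%N -> `|\sum_(n <= l < k) v l| <= D) ->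
  `|\sum_(n <= k < m) u k * v k| <=
    D * (`|u m| + \sum_(n <= k < m) `|u k - u k.+1|).
Proof.
move=> nm h; pose V k := \sum_(n <= l < k) v l.
have -> : \sum_(n <= k < m) u k * v k =
    u m * V m + \sum_(n <= k < m) (u k - u k.+1) * V k.+1.
  elim: m nm h => [|m IH nm h].
    rewrite leqn0 => /eqP -> _; by rewrite /V !big_geq// mulr0 addr0.
  move: nm; rewrite leq_eqVlt => /predU1P[<-|nm].
    by rewrite /V !big_geq// mulr0 addr0.
  rewrite !big_nat_recr//= IH//; last first.
    by move=> k /andP[nk km]; apply: h; rewrite nk/= ltnW.
  by rewrite /V big_nat_recr//=; ring.
rewrite (le_trans (ler_normD _ _))// mulrDr lerD//.
  by rewrite normrM mulrC ler_wpM2r// h// nm leqnn.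
rewrite (le_trans (ler_norm_sum _ _ _))// mulr_sumr.
rewrite !big_nat; apply: ler_sum => k /andP[nk km].
by rewrite normrM mulrC ler_wpM2r// h// ltnW.
Qed.

(** A dyadic block of a trigonometric series with slowly varying coefficients
    of size [B] is bounded by [B] times the number of terms near the origin,
    and by [B] times the size of the Dirichlet kernel away from it. *)
Lemma trig_block (u : nat -> R) (B : R) i j x d : shell j x ->
  (forall k, (2 ^ i <= k <= (2 ^ i).*2)%N -> `|u k| <= B) ->
  dyadic_var u (2 ^ i) <= B ->
  `|\sum_(2 ^ i <= k < (2 ^ i).*2) u k * cos (k%:R * x + d)| <=
  32 * B * 2 ^+ minn i j.
Proof.
move=> sx uB vB; set n := (2 ^ i)%N.
have nn : (n <= n.*2)%N by rewrite -addnn leq_addr.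
have B0 : 0 <= B by rewrite (le_trans _ (uB n _))// leqnn nn.
have [ij|ji] := leqP i j.
  rewrite (le_trans (ler_norm_sum _ _ _))//.
  apply: (@le_trans _ _ (\sum_(n <= k < n.*2) B)).
    rewrite !big_nat; apply: ler_sum => k /andP[nk km].
    rewrite normrM (le_trans _ (uB k _))//; last by rewrite nk/= ltnW.
    by rewrite ler_piMr// cos_max.
  rewrite sumr_const_nat -addnn addnK -[leLHS]mulr_natr natrX.
  rewrite -mulrA mulrCA ler_wpM2l//.
  by rewrite ler_peMl ?exprn_ge0// ler1n.
apply: le_trans (abel_sum (D := 16 * 2 ^+ j) u nn _) _.
  by move=> k /andP[nk _]; exact: sum_cos_shell.
have : `|u n.*2| + \sum_(n <= k < n.*2) `|u k - u k.+1| <= B + B.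
  by rewrite lerD// uB// nn leqnn.
have c0 : 0 <= (16 * 2 ^+ j : R) by rewrite mulr_ge0// exprn_ge0.
move=> /(ler_wpM2l c0) /le_trans; apply.
by rewrite le_eqVlt; apply/orP; left; apply/eqP; ring.
Qed.

End TrigSums.

(** * The binomial series on the unit circle *)

Section Binomial.
Context {R : realType} (alpha : R).

Definition bcoef (j : nat) : R := (-1) ^+ j * gbinom alpha j.

Lemma bcoef0 : bcoef 0 = 1.
Proof. by rewrite /bcoef /gbinom big_ord0 expr0 fact0 divr1 mulr1. Qed.

Lemma bcoefS j : j.+1%:R * bcoef j.+1 = (j%:R - alpha) * bcoef j.
Proof.
rewrite /bcoef /gbinom big_ord_recr/= factS exprS natrM.
have h1 : (j.+1%:R : R) != 0 by rewrite pnatr_eq0.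
have h2 : (j`!%:R : R) != 0 by rewrite pnatr_eq0 -lt0n fact_gt0.
by field; rewrite h2 addrC natr1 h1.
Qed.

(** From some index on [j * `|bcoef j|] decreases, with increments
    [alpha * `|bcoef j|]; hence the sum of the [`|bcoef j|] telescopes. *)
Lemma bcoef_bounds : 0 < alpha -> exists2 A : R, 1 <= A &
  (forall n, \sum_(0 <= j < n) `|bcoef j| <= A) /\
  (forall j, j%:R * `|bcoef j| <= A).
Proof.
move=> a0.
have [j0 j0a] : exists j0 : nat, alpha <= j0%:R.
  by exists (Num.bound alpha); apply/ltW; rewrite archi_boundP// ltW.
have step j : (j0 <= j)%N ->
    alpha * `|bcoef j| = j%:R * `|bcoef j| - j.+1%:R * `|bcoef j.+1|.
  move=> jj; have := congr1 Num.norm (bcoefS j).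
  rewrite !normrM ger0_norm// [`|_ - alpha|]ger0_norm; last first.
    by rewrite subr_ge0 (le_trans j0a)// ler_nat.
  by move=> ->; ring.
have tele n : (j0 <= n)%N -> alpha * \sum_(j0 <= j < n) `|bcoef j| =
    j0%:R * `|bcoef j0| - n%:R * `|bcoef n|.
  elim: n => [|n IH]; first by rewrite leqn0 => /eqP ->; rewrite big_geq// mulr0 subrr.
  rewrite leq_eqVlt => /predU1P[<-|nm]; first by rewrite big_geq// mulr0 subrr.
  by rewrite big_nat_recr//= mulrDr IH// step//; ring.
pose B := \sum_(0 <= j < j0.+1) j.+1%:R * `|bcoef j|.
have B0 : 0 <= B by apply: sumr_ge0 => j _; rewrite mulr_ge0.
have jB j : (j <= j0)%N -> j.+1%:R * `|bcoef j| <= B.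
  move=> jj; rewrite /B (bigD1_seq j) ?mem_index_iota ?iota_uniq//=.
  by rewrite lerDl sumr_ge0// => k _; rewrite mulr_ge0.
have jjB : j0%:R * `|bcoef j0| <= B.
  by rewrite (le_trans _ (jB _ (leqnn _)))// ler_wpM2r// ler_nat.
have nB n : (n <= j0.+1)%N -> \sum_(0 <= j < n) `|bcoef j| <= B.
  move=> nj; apply: (@le_trans _ _ (\sum_(0 <= j < j0.+1) `|bcoef j|)).
    by rewrite (big_cat_nat (leq0n n) nj)//= lerDl sumr_ge0.
  by apply: ler_sum => k _; rewrite ler_peMl// ler1n.
exists (1 + B + B / alpha); first by rewrite -addrA lerDl addr_ge0// divr_ge0// ltW.
have D0 : 0 <= B / alpha by rewrite divr_ge0// ltW.
split=> [n|j].
  have [nj|jn] := leqP n j0.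
    by have := nB _ (leqW nj); lra.
  rewrite (big_cat_nat (leq0n j0) (ltnW jn))//= lerD//.
    by have := nB _ (leqW (leqnn _)); lra.
  rewrite ler_pdivlMr// mulrC tele 1?ltnW//.
  by rewrite (le_trans _ jjB)// gerBl mulr_ge0.
have [nj|jn] := leqP j j0.
  have := jB _ nj; have : j%:R * `|bcoef j| <= j.+1%:R * `|bcoef j|.
    by rewrite ler_wpM2r// ler_nat.
  by lra.
have := tele _ (ltnW jn); have : 0 <= alpha * \sum_(j0 <= i < j) `|bcoef i|.
  by rewrite mulr_ge0 ?sumr_ge0// ltW.
by lra.
Qed.

Lemma is_cvg_pseries_lin (u : nat -> R) (A K : R) : `|K| < 1 ->
  (forall j, `|u j| <= A * j.+1%:R) -> cvgn (pseries u K).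
Proof.
move=> K1 uA; apply: normed_cvg.
(* One factor [q ^ j] of [`|K| ^ j = q ^ j * q ^ j] absorbs [j.+1], because
   [j.+1 * q ^ j] is at most the sum of the [q ^ k], [k <= j]. *)
pose q := Num.sqrt `|K|.
have q0 : 0 <= q := sqrtr_ge0 _.
have q1 : q < 1 by rewrite -sqrtr1 ltr_sqrt.
have A0 : 0 <= A by have := le_trans (normr_ge0 _) (uA 0%N); rewrite mulr1.
apply: (@series_le_cvg _ _ (geometric (A / (1 - q)) q)) => [j|j|j|].
- exact: normr_ge0.
- by rewrite /= mulr_ge0 ?exprn_ge0// divr_ge0// subr_ge0 ltW.
- rewrite /= normrM normrX.
  have -> : `|K| = q * q by rewrite -expr2 sqr_sqrtr.
  rewrite exprMn (le_trans (ler_wpM2r _ (uA j))) ?mulr_ge0 ?exprn_ge0//.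
  rewrite -!mulrA ler_wpM2l// mulrA ler_wpM2r ?exprn_ge0//.
  apply: le_trans (sum_expr_le j.+1 (_ : 0 <= q < 1)); last by rewrite q0.
  rewrite mulrC mulr_natr -{1}(subn0 j.+1) -sumr_const_nat.
  rewrite !big_nat; apply: ler_sum => k /andP[_ kj].
  by rewrite ler_wiXn2l// ltW.
by apply: is_cvg_geometric_series; rewrite ger0_norm.
Qed.

Section Ray.
Variables (theta : R).
Hypothesis alpha0 : 0 < alpha.

(** On the ray [z = r * exp (- i theta)] the binomial series of
    [(1 - z) ^ alpha] is [E r - i F r]; [e] and [f] are the derivatives of [E]
    and [F] in [r]. *)
Let u (j : nat) : R := bcoef j * cos (j%:R * theta).
Let v (j : nat) : R := bcoef j * sin (j%:R * theta).
Let E (r : R) : R := limn (pseries u r).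
Let F (r : R) : R := limn (pseries v r).
Let e (r : R) : R := limn (pseries (pseries_diffs u) r).
Let f (r : R) : R := limn (pseries (pseries_diffs v) r).

Let cvg_tools (w : nat -> R) : (forall j, `|w j| <= `|bcoef j|) ->
  forall K, `|K| < 1 ->
  [/\ cvgn (pseries w K), cvgn (pseries (pseries_diffs w) K) &
      cvgn (pseries (pseries_diffs (pseries_diffs w)) K)].
Proof.
move=> wb K K1; have [A A1 [_ jA]] := bcoef_bounds alpha0.
have dA j : `|pseries_diffs w j| <= A.
  rewrite /pseries_diffs normrM ger0_norm// (le_trans _ (jA j.+1))//.
  by rewrite ler_wpM2l.
split.
- apply: (@is_cvg_pseries_lin _ (A + `|w 0%N|)) => // -[|j].
    by rewrite mulr1 lerDr (le_trans ler01).
  apply: (@le_trans _ _ (j.+1%:R * `|w j.+1|)).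
    by rewrite ler_peMl// ler1n.
  rewrite (le_trans (ler_wpM2l _ (wb _)))// (le_trans (jA _))//.
  rewrite (@le_trans _ _ (A + `|w 0%N|))// ?lerDl//.
  by rewrite ler_peMr ?addr_ge0 ?ler1n// (le_trans ler01).
- apply: (@is_cvg_pseries_lin _ A) => // j; rewrite (le_trans (dA _))//.
  by rewrite ler_peMr ?ler1n// (le_trans ler01).
- apply: (@is_cvg_pseries_lin _ A) => // j.
  by rewrite [in leLHS]/pseries_diffs normrM ger0_norm// mulrC ler_wpM2r// dA.
Qed.

Let ub j : `|u j| <= `|bcoef j|.
Proof. by rewrite normrM ler_piMr// cos_max. Qed.
Let vb j : `|v j| <= `|bcoef j|.
Proof. by rewrite normrM ler_piMr// sin_max. Qed.

Let is_derive_ray (w : nat -> R) : (forall j, `|w j| <= `|bcoef j|) ->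
  forall r : R, `|r| < 1 -> is_derive r (1 : R) (fun r : R => limn (pseries w r))
    (limn (pseries (pseries_diffs w) r)).
Proof.
move=> wb r r1; pose K := (1 + `|r|) / 2.
have K0 : 0 <= K by rewrite divr_ge0// addr_ge0.
have rK : `|r| < `|K| by rewrite (ger0_norm K0) /K; lra.
have K1 : `|K| < 1 by rewrite (ger0_norm K0) /K; lra.
by have [c1 c2 c3] := cvg_tools wb K1; apply: pseries_snd_diffs c1 c2 c3 rK.
Qed.

(** The real and imaginary parts of [(1 - z) * Phi' z = - alpha * Phi z] for
    [Phi z = (1 - z) ^ alpha], read off the recurrence of the coefficients. *)
Let ray_ode r : `|r| < 1 ->
  e r = cos theta * (r * e r - alpha * E r) - sin theta * (r * f r - alpha * F r) /\
  f r = sin theta * (r * e r - alpha * E r) + cos theta * (r * f r - alpha * F r).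
Proof.
move=> r1.
have [cu1 cu2 _] := cvg_tools ub r1; have [cv1 cv2 _] := cvg_tools vb r1.
have key (w w1 w2 : nat -> R) (c s : R) : cvgn (pseries (pseries_diffs w) r) ->
    (forall j, (`|w1 j| <= `|bcoef j|)) -> (forall j, (`|w2 j| <= `|bcoef j|)) ->
    (forall j, j.+1%:R * w j.+1 = (j%:R - alpha) * (c * w1 j + s * w2 j)) ->
    limn (pseries (pseries_diffs w) r) =
    c * (r * limn (pseries (pseries_diffs w1) r) - alpha * limn (pseries w1 r)) +
    s * (r * limn (pseries (pseries_diffs w2) r) - alpha * limn (pseries w2 r)).
  move=> cw wb1 wb2 h.
  have [c11 c12 _] := cvg_tools wb1 r1; have [c21 c22 _] := cvg_tools wb2 r1.
  apply/cvg_lim => //.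
  rewrite [X in X @ \oo --> _](_ : _ =
    c \*: (r \*: (series (fun i => i%:R * w1 i * r ^+ i.-1)) -
           alpha \*: pseries w1 r) +
    s \*: (r \*: (series (fun i => i%:R * w2 i * r ^+ i.-1)) -
           alpha \*: pseries w2 r)); last first.
    apply/funext => n; rewrite !fctE /pseries /series/=.
    rewrite /GRing.scale/= !mulr_sumr -!sumrB !mulr_sumr -big_split/=.
    apply: eq_bigr => j _; rewrite /pseries_diffs h.
    by case: j => [|j]; rewrite /= ?exprS; ring.
  by apply: cvgD; apply: cvgZr; apply: cvgB; apply: cvgZr => //;
    exact: pseries_diffs_equiv.
split.
  rewrite -[- (sin theta * _)]mulNr; apply: key => // j; rewrite mulrA bcoefS -mulrA; congr (_ * _).
  by rewrite -natr1 mulrDl mul1r cosD /u /v; ring.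
apply: key => // j; rewrite mulrA bcoefS -mulrA; congr (_ * _).
by rewrite -natr1 mulrDl mul1r sinD /u /v; ring.
Qed.

(** The squared modulus and the argument of [1 - z]. *)
Let D (r : R) : R := (1 - r * cos theta) ^+ 2 + (r * sin theta) ^+ 2.
Let psi (r : R) : R := atan (r * sin theta / (1 - r * cos theta)).

Let re_gt0 (r : R) : 0 <= r < 1 -> 0 < 1 - r * cos theta.
Proof.
move=> /andP[r0 r1]; rewrite subr_gt0 (le_lt_trans _ r1)//.
by rewrite ler_piMr// cos_le1.
Qed.

Let D_gt0 (r : R) : 0 <= r < 1 -> 0 < D r.
Proof. by move=> /re_gt0 h; rewrite ltr_pwDl ?exprn_gt0// sqr_ge0. Qed.

Let e_eq (r : R) : 0 <= r < 1 ->
  e r = alpha / D r * ((r - cos theta) * E r + sin theta * F r) /\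
  f r = alpha / D r * ((r - cos theta) * F r - sin theta * E r).
Proof.
move=> r01; have /andP[r0 r1] := r01.
have [h1 h2] := @ray_ode r (ltac:(by rewrite ger0_norm)).
have D0 : D r != 0 by rewrite gt_eqF// D_gt0.
have := cos2Dsin2 theta; set c := cos theta in h1 h2 *.
set s := sin theta in h1 h2 * => cs.
have De : D r = 1 - r * c + r * (r * (c ^+ 2 + s ^+ 2) - c) by rewrite /D -/c -/s; ring.
rewrite cs mulr1 in De.
have H1 : (1 - r * c) * e r + r * s * f r = - alpha * (c * E r - s * F r) by lra.
have H2 : (1 - r * c) * f r - r * s * e r = - alpha * (c * F r + s * E r) by lra.
have I1 : D r * e r = alpha * ((r - c) * E r + s * F r).
  transitivity ((1 - r * c) * ((1 - r * c) * e r + r * s * f r)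
              - r * s * ((1 - r * c) * f r - r * s * e r)).
    by rewrite /D -/c -/s; ring.
  rewrite H1 H2; transitivity (alpha * ((r * (c ^+ 2 + s ^+ 2) - c) * E r + s * F r)).
    by ring.
  by rewrite cs mulr1.
have I2 : D r * f r = alpha * ((r - c) * F r - s * E r).
  transitivity ((1 - r * c) * ((1 - r * c) * f r - r * s * e r)
              + r * s * ((1 - r * c) * e r + r * s * f r)).
    by rewrite /D -/c -/s; ring.
  rewrite H1 H2; transitivity (alpha * ((r * (c ^+ 2 + s ^+ 2) - c) * F r - s * E r)).
    by ring.
  by rewrite cs mulr1.
split.
  by rewrite -mulrA mulrCA -I1 mulrA mulVf// mul1r.
by rewrite -mulrA mulrCA -I2 mulrA mulVf// mul1r.
Qed.

Let is_derive_psi (r : R) : 0 <= r < 1 -> is_derive r (1 : R) psi (sin theta / D r).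
Proof.
move=> r01; have h := re_gt0 r01; have hD := D_gt0 r01.
have d1 : is_derive r (1 : R) (fun r => 1 - r * cos theta) (- cos theta).
  have -> : (fun r => 1 - r * cos theta) = cst 1 - (cos theta) \*: id.
    by apply/funext => x; rewrite !fctE /= /GRing.scale/= mulrC.
  by apply: is_derive_eq; rewrite /GRing.scale/= sub0r mulr1.
have d2 := @is_deriveV _ (fun r => 1 - r * cos theta) _ _ _ (lt0r_neq0 h) d1.
have d3 : is_derive r (1 : R) (fun r => r * sin theta) (sin theta).
  have -> : (fun r => r * sin theta) = (sin theta) \*: id.
    by apply/funext => x /=; rewrite mulrC.
  by apply: is_derive_eq; rewrite /GRing.scale/= mulr1.
have d4 := is_deriveM d3 d2.
have d5 := @is_derive1_comp _ atan _ r _ _ (is_derive1_atan _) d4.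
apply: (is_derive_eq d5); rewrite /= /GRing.scale/=.
rewrite !fctE.
have hn := lt0r_neq0 h; have hDn := lt0r_neq0 hD.
move: hDn; rewrite /D => hDn.
field.
by rewrite ?hn ?hDn.
Qed.

Let is_derive_D (r : R) : is_derive r (1 : R) D (2 * (r - cos theta)).
Proof.
have -> : D = (fun r => 1 - (2 * cos theta) * r + r ^+ 2).
  apply/funext => x; transitivity (1 - 2 * cos theta * x +
    x ^+ 2 * (cos theta ^+ 2 + sin theta ^+ 2)); first by rewrite /D; ring.
  by rewrite cos2Dsin2 mulr1.
have -> : (fun r : R => 1 - (2 * cos theta) * r + r ^+ 2) =
   cst 1 - (2 * cos theta) \*: id + (@GRing.exp R ^~ 2%N).
  by apply/funext => x; rewrite !fctE /= /GRing.scale/=.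
apply: is_derive_eq; rewrite /GRing.scale/=; ring.
Qed.

Let G : R -> R := expR \o ((- (alpha / 2)) \*: (@ln R \o D)).
Let C : R -> R := cos \o (alpha \*: psi).
Let S : R -> R := sin \o (alpha \*: psi).

Let is_derive_G (r : R) : 0 <= r < 1 ->
  is_derive r (1 : R) G (- alpha * (r - cos theta) / D r * G r).
Proof.
move=> r01; have hD := D_gt0 r01.
have d1 := @is_derive1_comp _ (@ln R) D r _ _ (is_derive1_ln hD) (is_derive_D r).
have d2 := is_deriveZ (- (alpha / 2)) d1.
have d3 := @is_derive1_comp _ expR _ r _ _ (is_derive_expR _) d2.
apply: (is_derive_eq d3); rewrite /G /= /GRing.scale/=.
by set g := expR _; field; rewrite gt_eqF.
Qed.

Let is_derive_C (r : R) : 0 <= r < 1 ->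
  is_derive r (1 : R) C (- S r * (alpha * (sin theta / D r))).
Proof.
move=> r01; have d2 := is_deriveZ alpha (is_derive_psi r01).
exact: (@is_derive1_comp _ cos _ r _ _ (is_derive_cos _) d2).
Qed.

Let is_derive_S (r : R) : 0 <= r < 1 ->
  is_derive r (1 : R) S (C r * (alpha * (sin theta / D r))).
Proof.
move=> r01; have d2 := is_deriveZ alpha (is_derive_psi r01).
exact: (@is_derive1_comp _ sin _ r _ _ (is_derive_sin _) d2).
Qed.

Let cst_ray (U : R -> R) : (forall r : R, 0 <= r < 1 -> is_derive r (1 : R) U 0) ->
  forall r, 0 <= r < 1 -> U r = U 0.
Proof.
move=> dU r /andP[r0 r1].
have [||c _ /eqP] := @MVT_segment _ U (cst 0) 0 r r0.
- by move=> x; rewrite in_itv/= => /andP[x0 xr]; apply: dU; rewrite ltW//= (lt_trans xr).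
- apply: derivable_within_continuous => x; rewrite in_itv/= => /andP[x0 xr].
  by apply: (@ex_derive _ _ _ _ _ _ 0); apply: dU; rewrite x0/= (le_lt_trans xr).
by rewrite mul0r subr_eq0 => /eqP.
Qed.

Let ray0 (w : nat -> R) : limn (pseries w 0) = w 0%N.
Proof.
apply/cvg_lim => //; apply: cvg_near_cst; exists 1%N => // -[|n] // _.
rewrite /pseries /series/= big_nat_recl// expr0 mulr1.
by rewrite big1 ?addr0// => i _; rewrite expr0n mulr0.
Qed.

(** The quotient of the sum of the series and of the expected closed form has
    derivative zero along the ray, by the differential equation. *)
Let ray_closed (r : R) : 0 <= r < 1 ->
  E r = D r `^ (alpha / 2) * C r /\ F r = - (D r `^ (alpha / 2) * S r).
Proof.
move=> r01.
have dE (x : R) : 0 <= x < 1 -> is_derive x (1 : R) E (e x).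
  by move=> /andP[x0 x1]; apply: is_derive_ray => //; rewrite ger0_norm.
have dF (x : R) : 0 <= x < 1 -> is_derive x (1 : R) F (f x).
  by move=> /andP[x0 x1]; apply: is_derive_ray => //; rewrite ger0_norm.
have G0 : G 0 = 1.
  by rewrite /G /= /D !mul0r subr0 expr1n expr0n addr0 ln1 scaler0 expR0.
have psi0 : psi 0 = 0 by rewrite /psi !mul0r atan0.
have C0 : C 0 = 1 by rewrite /C /= psi0 scaler0 cos0.
have S0 : S 0 = 0 by rewrite /S /= psi0 scaler0 sin0.
have dU (x : R) : 0 <= x < 1 -> is_derive x (1 : R) (G * (E * C - F * S)) 0.
  move=> x01; have hD := D_gt0 x01.
  have d := is_deriveM (is_derive_G x01) (is_deriveB
    (is_deriveM (dE x x01) (is_derive_C x01)) (is_deriveM (dF x x01) (is_derive_S x01))).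
  apply: (is_derive_eq d); rewrite !fctE /GRing.scale/=.
  by have [-> ->] := e_eq x01; field; rewrite gt_eqF.
have dV (x : R) : 0 <= x < 1 -> is_derive x (1 : R) (G * (E * S + F * C)) 0.
  move=> x01; have hD := D_gt0 x01.
  have d := is_deriveM (is_derive_G x01) (is_deriveD
    (is_deriveM (dE x x01) (is_derive_S x01)) (is_deriveM (dF x x01) (is_derive_C x01))).
  apply: (is_derive_eq d); rewrite !fctE /GRing.scale/=.
  by have [-> ->] := e_eq x01; field; rewrite gt_eqF.
have E0 : E 0 = 1 by rewrite /E ray0 /u bcoef0 mul0r cos0 mulr1.
have F0 : F 0 = 0 by rewrite /F ray0 /v mul0r sin0 mulr0.
have hU : G r * (E r * C r - F r * S r) = 1.
  by have := cst_ray dU r01; rewrite !fctE G0 C0 S0 E0 F0 !(mulr0, mulr1, subr0).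
have hV : G r * (E r * S r + F r * C r) = 0.
  by have := cst_ray dV r01; rewrite !fctE G0 C0 S0 E0 F0 !(mulr0, mul0r, addr0).
have hG : D r `^ (alpha / 2) * G r = 1.
  rewrite /powR gt_eqF ?D_gt0// /G /= /GRing.scale/= -expRD mulNr subrr.
  exact: expR0.
have cs : C r ^+ 2 + S r ^+ 2 = 1 := cos2Dsin2 _.
set P := D r `^ _ in hG *.
have U1 : E r * C r - F r * S r = P.
  by rewrite -[LHS]mul1r -hG -mulrA hU mulr1.
have V1 : E r * S r + F r * C r = 0.
  by rewrite -[LHS]mul1r -hG -mulrA hV mulr0.
split.
  transitivity (E r * (C r ^+ 2 + S r ^+ 2)); first by rewrite cs mulr1.
  transitivity ((E r * C r - F r * S r) * C r + (E r * S r + F r * C r) * S r).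
    by ring.
  by rewrite U1 V1 mul0r addr0.
transitivity (F r * (C r ^+ 2 + S r ^+ 2)); first by rewrite cs mulr1.
transitivity ((E r * S r + F r * C r) * C r - (E r * C r - F r * S r) * S r).
  by ring.
by rewrite U1 V1 mul0r sub0r.
Qed.

Let rad (n : nat) : R := 1 - n.+1%:R^-1.

Let rad01 n : 0 <= rad n < 1.
Proof.
by rewrite /rad subr_ge0 invf_le1// ler1n/= ltrBlDr ltrDl invr_gt0.
Qed.

Let cvg_rad : rad @ \oo --> (1 : R).
Proof.
rewrite -[X in _ --> X](subr0 (1 : R)); apply: cvgB; first exact: cvg_cst.
exact: cvg_harmonic.
Qed.

(** Abel's theorem under absolute convergence: the tails are small uniformly in
    the radius [r], and [1 - r ^ j <= j * (1 - r)] in the remaining sum. *)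
Let abel_limit (w : nat -> R) : (forall j, `|w j| <= `|bcoef j|) ->
  cvgn (series w) /\ (fun n => limn (pseries w (rad n))) @ \oo --> limn (series w).
Proof.
move=> wb; have [A A1 [sA _]] := bcoef_bounds alpha0.
have A0 : 0 < A by rewrite (lt_le_trans ltr01).
have swA n : \sum_(0 <= j < n) `|w j| <= A.
  by rewrite (le_trans _ (sA n))// ler_sum.
have nd : nondecreasing_seq (series (fun j => `|w j|)).
  by apply: nondecreasing_series => *; exact: normr_ge0.
have cw : cvgn (series (fun j => `|w j|)).
  by apply: nondecreasing_is_cvgn => //; exists A => _ [n _ <-]; exact: swA.
have cs : cvgn (series w) by exact: normed_cvg.
split => //; apply/cvgrPdist_le => eps eps0.
have e2 : 0 < eps / 2 by rewrite divr_gt0.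
have /cvgrPdist_le/(_ _ e2)[N _ /(_ N (leqnn _))/=] := cw.
rewrite ger0_norm ?subr_ge0; last exact: nondecreasing_cvgn_le.
move=> hN.
have tail n : (N <= n)%N -> \sum_(N <= j < n) `|w j| <= eps / 2.
  move=> Nn; apply: le_trans hN.
  have := nondecreasing_cvgn_le nd cw n.
  by rewrite /series/= (big_cat_nat (leq0n N) Nn)/=; lra.
have /cvgrPdist_le/(_ (eps / 2 / (A * N.+1%:R)) _)[|M _ hM] := cvg_rad.
  by rewrite divr_gt0// mulr_gt0.
exists M => // m Mm /=; have {hM} := hM _ Mm => /=.
have /andP[r0 r1] := rad01 m.
rewrite ger0_norm; last by rewrite subr_ge0 ltW.
move=> hM; set r := rad m in r0 r1 hM *.
have cp : cvgn (pseries w r).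
  by have [] := cvg_tools wb (_ : `|r| < 1); rewrite ?ger0_norm.
rewrite -limB// -lim_norm; last exact: is_cvgB.
apply: limr_le; first by apply: is_cvg_norm; exact: is_cvgB.
exists N => // n /= Nn; rewrite !fctE /pseries /series/= -sumrB.
rewrite (le_trans (ler_norm_sum _ _ _))// (big_cat_nat (leq0n N) Nn)/=.
have -> : eps = eps / 2 + eps / 2 by lra.
have tm j : `|w j - w j * r ^+ j| = `|w j| * (1 - r ^+ j).
  rewrite -{1}(mulr1 (w j)) -mulrBr normrM [`|1 - _|]ger0_norm// subr_ge0.
  by rewrite exprn_ile1// ltW.
apply: lerD; last first.
  apply: le_trans (tail _ Nn); apply: ler_sum => j _; rewrite tm ler_piMr//.
  by rewrite gerBl exprn_ge0.
apply: (@le_trans _ _ (\sum_(0 <= j < N) `|w j| * (N.+1%:R * (1 - r)))).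
  rewrite !big_nat; apply: ler_sum => j /andP[_ jN]; rewrite tm ler_wpM2l//.
  rewrite -opprB subrX1 -mulNr opprB mulrC ler_wpM2r//; first by rewrite subr_ge0 ltW.
  apply: (@le_trans _ _ (\sum_(i < j) 1)).
    by apply: ler_sum => i _; rewrite exprn_ile1// ltW.
  by rewrite sumr_const card_ord ler_nat ltnW// ltnW.
rewrite -mulr_suml; apply: (@le_trans _ _ (A * (N.+1%:R * (1 - r)))).
  by rewrite ler_wpM2r// mulr_ge0// subr_ge0 ltW.
by rewrite mulrA mulrC -ler_pdivlMr// mulr_gt0.
Qed.

Let D1 : D 1 = (2 * sin (theta / 2)) ^+ 2.
Proof.
have e2 : theta = theta / 2 + theta / 2 by rewrite -splitr.
have c : cos theta = 1 - 2 * sin (theta / 2) ^+ 2.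
  rewrite {1}e2 cosD -!expr2.
  have := cos2Dsin2 (theta / 2); lra.
transitivity (1 - 2 * cos theta + (cos theta ^+ 2 + sin theta ^+ 2)).
  by rewrite /D; ring.
by rewrite cos2Dsin2 c; ring.
Qed.

Hypothesis theta0pi : 0 <= theta <= pi.

Let sin_half_ge0 : 0 <= sin (theta / 2).
Proof.
have /andP[t0 tpi] := theta0pi; apply: sin_ge0_pi.
by have := pi_ge0 R; move=> pi0; apply/andP; split; lra.
Qed.

Let D1_powR : D 1 `^ (alpha / 2) = (2 * sin (theta / 2)) `^ alpha.
Proof.
have h : 0 <= 2 * sin (theta / 2) by rewrite mulr_ge0// sin_half_ge0.
by rewrite D1 -powR_mulrn// -powRrM mulrCA mulfV ?mulr1.
Qed.

Let D_rad : D (rad x) @[x --> \oo] --> D 1.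
Proof.
apply: (cvg_comp _ _ cvg_rad).
apply: differentiable_continuous; apply/derivable1_diffP.
by have [] := is_derive_D 1.
Qed.

Let boundary : limn (series u) = (2 * sin (theta / 2)) `^ alpha *
                 cos (alpha * (pi - theta) / 2) /\
  limn (series v) = - ((2 * sin (theta / 2)) `^ alpha *
                 sin (alpha * (pi - theta) / 2)).
Proof.
have [_ lu] := abel_limit ub; have [_ lv] := abel_limit vb.
have /andP[t0 tpi] := theta0pi.
have ru : (fun n => limn (pseries u (rad n))) = (fun n => D (rad n) `^ (alpha / 2) * C (rad n)).
  by apply/funext => n; have [<- _] := ray_closed (rad01 n).
have rv : (fun n => limn (pseries v (rad n))) =
    (fun n => - (D (rad n) `^ (alpha / 2) * S (rad n))).
  by apply/funext => n; have [_ <-] := ray_closed (rad01 n).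
have a20 : 0 < alpha / 2 by rewrite divr_gt0.
(* At [z = 1] the argument of [1 - z] has no limit, but the modulus tends
   to zero. *)
rewrite -D1_powR; move: t0; rewrite le_eqVlt => /predU1P[th0|t0].
  have D10 : D 1 = 0 by rewrite D1 -th0 mul0r sin0 mulr0 expr0n.
  have lD : (fun n => D (rad n) `^ (alpha / 2)) @ \oo --> (0 : R).
    have e1 : (fun n => D (rad n) `^ (alpha / 2)) = (fun n => n.+1%:R^-1 `^ alpha).
      apply/funext => n; rewrite /D -th0 cos0 sin0 mulr1 mulr0 expr0n addr0.
      rewrite -powR_mulrn ?subr_ge0 1?ltW//; last by have /andP[] := rad01 n.
      rewrite -powRrM mulrCA mulfV// mulr1; congr (_ `^ _).
      by rewrite /rad; ring.
    rewrite e1; have := powR_cvg0 alpha0 => /cvg_at_rightP; apply; split => //.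
    exact: cvg_harmonic.
  have lim0 (w : nat -> R) : (forall n, `|w n| <= D (rad n) `^ (alpha / 2)) ->
      w @ \oo --> (0 : R).
    move=> h; apply: norm_cvg0; apply: (squeeze_cvgr _ (cvg_cst 0) lD).
    by apply: nearW => n; rewrite normr_ge0 h.
  rewrite D10 powR0 ?gt_eqF// !mul0r oppr0; split.
    apply: (cvg_unique _ lu) => //; rewrite ru; apply: lim0 => n.
    by rewrite normrM ger0_norm ?powR_ge0// ler_piMr ?powR_ge0// cos_max.
  apply: (cvg_unique _ lv) => //; rewrite rv; apply: lim0 => n.
  by rewrite normrN normrM ger0_norm ?powR_ge0// ler_piMr ?powR_ge0// sin_max.
have s0 : 0 < sin (theta / 2).
  by apply: sin_gt0_pi; have := pi_gt0 R; move=> pi0; apply/andP; split; lra.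
have D10 : 0 < D 1 by rewrite D1 exprn_gt0// mulr_gt0.
have e2 : theta = theta / 2 + theta / 2 by rewrite -splitr.
have c : 1 - cos theta = 2 * sin (theta / 2) ^+ 2.
  rewrite {1}e2 cosD -!expr2.
  have := cos2Dsin2 (theta / 2); lra.
have c0 : 1 - cos theta != 0 by rewrite c mulf_neq0// gt_eqF// exprn_gt0.
have psi1 : psi 1 = (pi - theta) / 2.
  have -> : (pi - theta) / 2 = pi / 2 - theta / 2 by lra.
  rewrite -[RHS]tanK; last by rewrite in_itv/=; apply/andP; split; lra.
  rewrite /psi !mul1r; congr atan; rewrite /tan cosB sinB cos_pihalf sin_pihalf.
  rewrite c {1}e2 sinD !mul0r !mul1r add0r subr0; field.
  by rewrite gt_eqF.
have lpsi : psi (rad n) @[n --> \oo] --> psi 1.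
  have l1 : rad n * sin theta / (1 - rad n * cos theta) @[n --> \oo] -->
      1 * sin theta / (1 - 1 * cos theta).
    apply: cvgM; first by apply: cvgMl; exact: cvg_rad.
    apply: cvgV; first by rewrite mul1r.
    by apply: cvgB; [exact: cvg_cst|apply: cvgMl; exact: cvg_rad].
  by apply: (cvg_comp _ _ l1); exact: continuous_atan.
have lap : alpha *: psi (rad n) @[n --> \oo] --> alpha *: psi 1 by exact: cvgZr.
have lDp : D (rad n) `^ (alpha / 2) @[n --> \oo] --> D 1 `^ (alpha / 2).
  have cp : {for D 1, continuous (fun x : R => x `^ (alpha / 2))}.
    apply: differentiable_continuous; apply/derivable1_diffP.
    by have [] := is_derive1_powR (alpha / 2) D10.
  exact: (@cvg_comp _ _ _ (D \o rad) (fun x => x `^ (alpha / 2)) _ _ _ D_rad cp).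
have ps : alpha * (pi - theta) / 2 = alpha *: psi 1 by rewrite psi1 -mulrA.
split.
  apply: (cvg_unique _ lu) => //; rewrite ru ps; apply: cvgM => //.
  by apply: (cvg_comp _ _ lap); exact: continuous_cos.
apply: (cvg_unique _ lv) => //; rewrite rv ps; apply: cvgN; apply: cvgM => //.
by apply: (cvg_comp _ _ lap); exact: continuous_sin.
Qed.

(** The multiplier of the fractional difference: the boundary value on the unit
    circle of [(1 - z) ^ alpha], whose modulus and argument are explicit. *)
Lemma binomial_multiplier (phi : R) :
  series (fun j => bcoef j * cos ((alpha - j%:R) * theta - phi)) @ \oo -->
  (2 * sin (theta / 2)) `^ alpha * cos (alpha * (pi + theta) / 2 - phi).
Proof.
have [cu _] := abel_limit ub; have [cv _] := abel_limit vb.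
have [lu lv] := boundary.
rewrite [X in X @ \oo --> _](_ : _ = cos (alpha * theta - phi) \*: series u +
    sin (alpha * theta - phi) \*: series v); last first.
  apply/funext => n; rewrite !fctE /series/= /GRing.scale/= !mulr_sumr -big_split/=.
  apply: eq_bigr => j _; rewrite /u /v.
  have -> : (alpha - j%:R) * theta - phi = (alpha * theta - phi) - j%:R * theta.
    by ring.
  by rewrite cosB; ring.
set l := (X in _ --> X).
have -> : l = cos (alpha * theta - phi) *: limn (series u) +
    sin (alpha * theta - phi) *: limn (series v).
  rewrite lu lv /l /GRing.scale/=.
  have -> : alpha * (pi + theta) / 2 - phi =
            (alpha * theta - phi) + alpha * (pi - theta) / 2 by lra.
  by rewrite cosD; ring.
by apply: cvgD; apply: cvgZr.
Qed.

End Ray.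
End Binomial.

(** * Integration over a period *)

Section GeneralIntegral.
Context d (T : measurableType d) (R : realType).
Variable mu : {measure set T -> \bar R}.

(** Read off the definition of the integral as a supremum over simple functions,
    hence valid for arbitrary functions. *)
Lemma ge0_le_integral_any (D : set T) (f g : T -> \bar R) :
  (forall x, D x -> 0 <= f x)%E -> (forall x, D x -> f x <= g x)%E ->
  (\int[mu]_(x in D) f x <= \int[mu]_(x in D) g x)%E.
Proof.
move=> f0 fg; rewrite [leLHS]integral_mkcond [leRHS]integral_mkcond.
rewrite [leLHS]ge0_integralTE; last by apply: erestrict_ge0.
rewrite [leRHS]ge0_integralTE; last first.
  by apply: erestrict_ge0 => x Dx; rewrite (le_trans (f0 _ Dx))// fg.
apply: ge_ereal_sup => _ [h /= hf <-]; apply: ereal_sup_ubound.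
exists h => //= x; rewrite (le_trans (hf x))//.
by apply: lee_restrict.
Qed.

End GeneralIntegral.

Section Periodic.
Context {R : realType}.
Local Notation mu := (@lebesgue_measure R).
Local Notation T2 := (pi *+ 2 : R).

Lemma T2_gt0 : 0 < T2.
Proof. by rewrite pmulrn_lgt0// pi_gt0. Qed.

Lemma T2_ge0 : 0 <= T2.
Proof. exact: ltW T2_gt0. Qed.

Lemma measurable_torus : measurable (torus : set R).
Proof. exact: measurable_itv. Qed.

Lemma measurable_shift (s : R) (D : set R) : measurable_fun D (fun x : R => x + s).
Proof. by apply: measurable_funD. Qed.

Lemma measurable_preshift (s : R) (A : set R) : measurable A ->
  measurable [set x | A (x + s)].
Proof.
by move=> mA; have := measurable_shift s measurableT mA; rewrite setTI.
Qed.

Lemma lebesgue_shift (s : R) (A : set R) : measurable A ->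
  mu [set x | A (x + s)] = mu A.
Proof.
move=> mA; pose sh : measurableTypeR R -> measurableTypeR R := fun x => x + s.
have msh : measurable_fun setT sh by exact: measurable_shift.
pose nu := isMeasurableFun.Build _ _ _ _ _ msh.
pose shm : {mfun measurableTypeR R >-> measurableTypeR R} := HB.pack sh nu.
apply/esym; rewrite -[RHS]/(pushforward mu shm A).
apply: (@lebesgue_measure_unique R (pushforward mu shm)) => //.
move=> _ [[a b] _ <-]; change (mu `]a, b]%classic = mu [set x | `]a, b]%classic (x + s)]).
have -> : [set x | `]a, b]%classic (x + s)] = `]a - s, b - s]%classic.
  by apply/seteqP; split=> x /=; rewrite !in_itv/= ltrBlDr lerBrDr.
rewrite !lebesgue_measure_itv/= !lte_fin ltrD2r; case: ifP => // _.
by rewrite -!EFinB opprB addrA subrK.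
Qed.

Lemma ge0_integral_shift (s : R) (D : set R) (f : R -> \bar R) :
  measurable D -> measurable_fun D f -> (forall x, 0 <= f x)%E ->
  (\int[mu]_(x in [set x | D (x + s)%R]) f (x + s)%R = \int[mu]_(x in D) f x)%E.
Proof.
move=> mD mf f0.
pose sh : measurableTypeR R -> measurableTypeR R := fun x => x + s.
have msh : measurable_fun setT sh by exact: measurable_shift.
transitivity (\int[pushforward mu sh]_(x in D) f x)%E.
  by rewrite ge0_integral_pushforward.
apply: eq_measure_integral => A mA _; exact: lebesgue_shift.
Qed.

Section PeriodicFun.
Variables (V : Type) (f : R -> V).
Hypothesis per_f : forall x, f (x + T2) = f x.

Lemma per_nat n x : f (x + T2 *+ n) = f x.
Proof. by elim: n => [|n IH]; rewrite ?addr0// mulrSr addrA per_f IH. Qed.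

Lemma per_int (m : int) x : f (x + T2 *~ m) = f x.
Proof.
case: m => n; first by rewrite -pmulrn per_nat.
by rewrite -(per_nat n.+1) NegzE mulrNz -pmulrn subrK.
Qed.

End PeriodicFun.

Lemma mod_period (a x : R) : exists m : int, a <= x - T2 *~ m < a + T2.
Proof.
exists (Num.floor ((x - a) / T2)).
have t0 := T2_gt0; set m := Num.floor _.
have /andP[h1 h2] : m%:~R <= (x - a) / T2 < (m + 1)%:~R by exact: floor_itv.
rewrite -mulrzr.
move: h1 h2; rewrite ler_pdivlMr// ltr_pdivrMr// intrD mulrDl mul1r mulrC => h1 h2.
by apply/andP; split; lra.
Qed.

Lemma torus_mod (x : R) : exists m : int, torus (x + T2 *~ m).
Proof.
have [m /andP[h1 h2]] := mod_period (- pi) x.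
exists (- m); rewrite /torus /= in_itv/= mulrNz h1/=.
by move: h2; rewrite mulr2n addKr => /ltW.
Qed.

Lemma periodic_measurable d (V : measurableType d) (f : R -> V) :
  (forall x, f (x + T2) = f x) -> measurable_fun torus f ->
  measurable_fun setT f.
Proof.
move=> pf mf.
pose S (m : int) : set R := [set x | torus (x + T2 *~ m)].
have mS m : measurable (S m) by apply: measurable_preshift; exact: measurable_torus.
have mfS m : measurable_fun (S m) f.
  apply: (@eq_measurable_fun _ _ _ _ _ (f \o (fun x => x + T2 *~ m))).
    by move=> x _; rewrite /= per_int.
  apply: (measurable_comp measurable_torus) => //; last exact: measurable_shift.
  by move=> _ [x Sx <-].
have -> : [set: R] = \bigcup_n (S (Posz n) `|` S (Negz n)).
  apply/esym/seteqP; split => // x _; have [m Hm] := torus_mod x.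
  case: m Hm => n Hn; exists n => //; [by left|by right].
apply/measurable_fun_bigcup => i; first exact: measurableU.
by apply/measurable_funU.
Qed.

(** After reduction of the shift modulo the period, the part of the period that
    is moved out at one end is the translate of the part missing at the
    other end. *)
Lemma periodic_integral_shift (s : R) (f : R -> \bar R) :
  (forall x, f (x + T2) = f x) -> measurable_fun setT f ->
  (forall x, 0 <= f x)%E ->
  (\int[mu]_(x in torus) f (x + s)%R = \int[mu]_(x in torus) f x)%E.
Proof.
move=> pf mf f0.
have [m] := mod_period 0 s; set s' := s - _; rewrite add0r => /andP[s0 s1].
have -> : (fun x => f (x + s)) = (fun x => f (x + s')).
  apply/funext => x; rewrite -[RHS](per_int pf m) /s' -addrA subrK.
  by [].
have mfD (D : set R) : measurable_fun D f by exact: measurable_funTS.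
have mfs (D : set R) : measurable_fun D (fun x => f (x + s')).
  apply: (measurable_funTS (D := D)).
  by apply: (measurableT_comp mf); exact: measurable_shift.
have cl (a b : R) (g : R -> \bar R) : measurable_fun `]a, b] g ->
    (\int[mu]_(x in `[a, b]) g x = \int[mu]_(x in `]a, b]) g x)%E.
  by move=> mg; rewrite integral_itv_obnd_cbnd.
rewrite /torus !cl//.
have e1 : (\int[mu]_(x in `](- pi)%R, pi]) f (x + s')%R =
           \int[mu]_(x in `](- pi + s')%R, (pi + s')%R]) f x)%E.
  rewrite -(@ge0_integral_shift s' `](- pi + s')%R, (pi + s')%R]%classic)//.
  congr integral.
  by apply/seteqP; split=> x /=; rewrite !in_itv/= ltrD2r lerD2r.
have e2 : (\int[mu]_(x in `](- pi)%R, (- pi + s')%R]) f x =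
           \int[mu]_(x in `]pi, (pi + s')%R]) f x)%E.
  rewrite -(ge0_integral_shift (T2)%R (D := `]pi, (pi + s')%R]%classic))//.
  rewrite (_ : [set x | _] = `](- pi)%R, (- pi + s')%R]%classic).
    by apply: eq_integral => x _; rewrite pf.
  apply/seteqP; split=> x /=; rewrite !in_itv/= => /andP[h1 h2];
   by apply/andP; split; lra.
have p0 := pi_gt0 R.
have s2 : s' < pi + pi by rewrite -mulr2n.
rewrite e1.
have u1 : `](- pi)%R, pi]%classic =
    `](- pi)%R, (- pi + s')%R] `|` `](- pi + s')%R, pi] :> set R.
  by rewrite -itv_bndbnd_setU// bnd_simp; lra.
have u2 : `](- pi + s')%R, (pi + s')%R]%classic =
    `](- pi + s')%R, pi] `|` `]pi, (pi + s')%R] :> set R.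
  by rewrite -itv_bndbnd_setU// bnd_simp; lra.
have sU (a b c : R) : (\int[mu]_(x in `]a, b] `|` `]b, c]) f x =
    \int[mu]_(x in `]a, b]) f x + \int[mu]_(x in `]b, c]) f x)%E.
  rewrite ge0_integral_setU//; first exact: mfD.
  apply/disj_setPS => x [/=]; rewrite !in_itv/= => /andP[_ h1] /andP[h2 _].
  by have := le_lt_trans h1 h2; rewrite ltxx.
rewrite u1 u2 !sU.
by rewrite e2 addeC.
Qed.

End Periodic.

(** * Dyadic shells *)

Section Shells.
Context {R : realType}.
Local Notation mu := (@lebesgue_measure R).

Lemma measurable_shell (j : nat) : measurable (shell j : set R).
Proof.
have := @normr_measurable R setT measurableT `]pi / 2 ^+ j.+1, pi / 2 ^+ j]%classic.
rewrite setTI => h; apply: h; exact: measurable_itv.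
Qed.

Lemma shell_measure_le (j : nat) : (mu (shell j) <= (pi *+ 2 / 2 ^+ j)%:E)%E.
Proof.
apply: (@le_trans _ _ (mu `[- (pi / 2 ^+ j), pi / 2 ^+ j]%classic)).
  apply: le_measure; rewrite ?inE//; first exact: measurable_shell.
  by move=> x /andP[_]; rewrite /= in_itv/= ler_norml.
rewrite lebesgue_measure_itv/= lte_fin; case: ifP => _.
  have -> : pi *+ 2 / 2 ^+ j = pi / 2 ^+ j + pi / 2 ^+ j :> R.
    by rewrite mulrnAl [LHS]mulr2n.
  by rewrite -EFinD lee_fin opprK.
by rewrite lee_fin divr_ge0 ?exprn_ge0// ltW// T2_gt0.
Qed.

Lemma shell_cover (x : R) : x != 0 -> `|x| <= pi -> exists j, shell j x.
Proof.
move=> x0 xpi; have nx : 0 < `|x| by rewrite normr_gt0.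
have ex : exists n : nat, (pi / 2 ^+ n.+1 < `|x|)%R.
  exists (Num.bound (pi / `|x|)).
  have p2 m : (0 : R) < 2 ^+ m by rewrite exprn_gt0.
  rewrite ltr_pdivrMr// mulrC -ltr_pdivrMr//.
  apply: lt_le_trans (archi_boundP _) _; first by rewrite divr_ge0 ?pi_ge0.
  by rewrite -natrX ler_nat (leq_trans (ltnW (ltn_expl _ (leqnn 2))))// leq_exp2l.
case: (ex_minnP ex) => j hj jmin; exists j; rewrite /shell /= hj/=.
case: j hj jmin => [_ _|j _ jmin]; first by rewrite expr0 divr1.
by rewrite leNgt; apply/negP => /jmin; rewrite ltnn.
Qed.

Lemma shell_sub_torus (j : nat) : shell j `<=` (torus : set R).
Proof.
move=> x /andP[_ h]; rewrite /torus /= in_itv/= -ler_norml (le_trans h)//.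
by rewrite ler_pdivrMr ?exprn_gt0// ler_peMr ?pi_ge0// exprn_ege1// ler1n.
Qed.

Lemma trivIset_shell : trivIset setT (shell : nat -> set R).
Proof.
apply: ltn_trivIset => n m mn; apply/seteqP; split => // x [/andP[h2 _] /andP[_ h1]].
have := lt_le_trans h2 h1; rewrite ltNge => /negP; apply.
by rewrite ler_wpM2l ?pi_ge0// lef_pV2 ?posrE ?exprn_gt0// ler_eXn2l// ltr1n.
Qed.

Lemma torus_shells : (torus : set R) `\ 0 = \bigcup_j shell j.
Proof.
apply/seteqP; split=> x.
  move=> [+ /= /eqP x0]; rewrite /torus /= in_itv/= -ler_norml => xpi.
  by have [j hj] := shell_cover x0 xpi; exists j.
move=> [j _ hj]; split; first exact: shell_sub_torus hj.
move=> /= x0; move: hj => /andP[]; rewrite x0 normr0 => + _.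
by rewrite ltNge divr_ge0 ?pi_ge0// exprn_ge0.
Qed.

Lemma integral_torus_shells (G : R -> \bar R) : measurable_fun torus G ->
  (forall x, 0 <= G x)%E ->
  (\int[mu]_(x in torus) G x = \sum_(j <oo) \int[mu]_(x in shell j) G x)%E.
Proof.
move=> mG G0.
rewrite -(integral_setD1 (r := 0)); last 2 first.
- by apply: measurableD => //; exact: measurable_torus.
- by apply: measurable_funS mG; [exact: measurable_torus|exact: subDsetl].
rewrite torus_shells ge0_integral_bigcup//.
- exact: measurable_shell.
- rewrite -torus_shells.
  by apply: measurable_funS mG; [exact: measurable_torus|exact: subDsetl].
- exact: trivIset_shell.
Qed.

Lemma powRX (x r : R) n : 0 <= x -> (x ^+ n) `^ r = (x `^ r) ^+ n.
Proof. by move=> x0; rewrite -powR_mulrn// powRAC powR_mulrn// powR_ge0. Qed.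

Definition pow2 (s : R) : R := 2 `^ s.

Lemma pow2_gt1 s : 0 < s -> 1 < pow2 s.
Proof. by move=> s0; rewrite /pow2 /powR pnatr_eq0/= expR_gt1 mulr_gt0// ln_gt0// ltr1n. Qed.

Lemma pow2_mul (s t : R) : s + t = 1 -> pow2 s * pow2 t = 2.
Proof.
move=> st; rewrite /pow2 -powRD; last by rewrite st oner_eq0.
by rewrite st powRr1.
Qed.

(** In terms of [X i = 2 ^ (i (1 - 1 / p)) * A i] the contributions of the
    shells and of the blocks interact through a geometric kernel. *)
Lemma torus_dyadic_bound (p : R) : 1 < p -> exists2 K : R, 0 < K &
  forall (G : R -> \bar R) (A : nat -> R), measurable_fun torus G ->
  (forall x, 0 <= G x)%E -> (forall i, 0 <= A i) ->
  (forall j x, shell j x -> (G x <= \sum_(i <oo) (A i * 2 ^+ minn i j)%:E)%E) ->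
  (\int[mu]_(x in torus) (G x `^ p) <=
   K%:E * \sum_(i <oo) ((pow2 (1 - p^-1) ^+ i * A i) `^ p)%:E)%E.
Proof.
move=> p1; have p0 : 0 < p by rewrite (lt_trans ltr01).
have s0 : 0 < 1 - p^-1 by rewrite subr_gt0 invf_lt1.
have t0 : 0 < p^-1 by rewrite invr_gt0.
have a1 := pow2_gt1 s0; have b1 := pow2_gt1 t0.
have ab : pow2 (1 - p^-1) * pow2 p^-1 = 2 by apply: pow2_mul; rewrite subrK.
set a := pow2 (1 - p^-1) in a1 ab *; set b := pow2 p^-1 in b1 ab *.
have a0 : 0 < a by rewrite (lt_trans ltr01).
have b0 : 0 < b by rewrite (lt_trans ltr01).
have ai0 : 0 <= a^-1 by rewrite invr_ge0 ltW.
have bi0 : 0 <= b^-1 by rewrite invr_ge0 ltW.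
pose lam := Num.max a^-1 b^-1.
have l0 : 0 <= lam by rewrite le_max ai0.
have l1 : lam < 1 by rewrite gt_max !invf_lt1// a1 b1.
have [K K0 HK] := @geom_conv R lam p (ltac:(by rewrite l0 l1)) p0.
exists (pi *+ 2 * K); first by rewrite mulr_gt0// pmulrn_lgt0// pi_gt0.
move=> G A mG G0 A0 GA.
have X0 i : 0 <= a ^+ i * A i by rewrite mulr_ge0// exprn_ge0// ltW.
rewrite integral_torus_shells; last 2 first.
- exact: (measurableT_comp (measurable_poweR p)).
- by move=> x; exact: poweR_ge0.
rewrite EFinM -muleA.
apply: (@le_trans _ _ ((pi *+ 2)%:E * \sum_(m <oo)
   (\sum_(i <oo) (lam ^+ dist m i)%:E * (a ^+ i * A i)%:E) `^ p)%E); last first.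
  rewrite lee_wpmul2l ?lee_fin ?T2_ge0//.
  exact: HK.
rewrite -nneseriesZl; last by move=> i _; exact: poweR_ge0.
apply: lee_nneseries => [j _ _|j _].
  by apply: integral_ge0 => x _; exact: poweR_ge0.
set H := (\sum_(i <oo) (A i * 2 ^+ minn i j)%:E)%E.
have H0 : (0 <= H)%E.
  by apply: nneseries_ge0 => i _ _; rewrite lee_fin mulr_ge0// exprn_ge0.
apply: (@le_trans _ _ (\int[mu]_(x in shell j) (cst (H `^ p) x))%E).
  apply: ge0_le_integral_any => x Sx; first exact: poweR_ge0.
  by apply: le_poweR => //; [exact: ltW|exact: GA].
rewrite integral_cst; last exact: measurable_shell.
rewrite muleC (le_trans (lee_wpmul2r _ (shell_measure_le j))) ?poweR_ge0//.
rewrite EFinM -muleA lee_wpmul2l ?lee_fin ?T2_ge0//.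
have -> : ((2 ^+ j)^-1)%:E = ((b^-1 ^+ j)%:E `^ p)%E.
  rewrite poweR_EFin powRX ?invr_ge0 ?(ltW b0)// -exprVn; congr ((_ ^+ _)%:E).
  have bp : b `^ p = 2 by rewrite /b /pow2 -powRrM mulVf ?gt_eqF// powRr1.
  by rewrite -[b^-1]powR_inv1 ?(ltW b0)// powRAC bp powR_inv1.
rewrite -poweRM//; last by rewrite lee_fin exprn_ge0// invr_ge0 ltW.
have bj0 : 0 <= b^-1 ^+ j by rewrite exprn_ge0// invr_ge0 ltW.
apply: le_poweR; [exact: ltW|by rewrite mule_ge0|].
rewrite -nneseriesZl; last by move=> i _; rewrite lee_fin mulr_ge0// exprn_ge0.
apply: lee_nneseries => [i _ _|i _].
  by rewrite mule_ge0// lee_fin mulr_ge0// exprn_ge0.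
rewrite -!EFinM lee_fin.
have [ij|ji] := leqP i j.
  have -> : b^-1 ^+ j * (A i * 2 ^+ i) = b^-1 ^+ (j - i) * (a ^+ i * A i).
    rewrite -{1}(subnK ij) exprD -ab exprMn.
    have e1 : b^-1 ^+ i * b ^+ i = 1 by rewrite -exprMn mulVf ?expr1n// gt_eqF.
    set c := b^-1 ^+ (j - i); rewrite -[RHS]mulr1 -e1; ring.
  rewrite ler_wpM2r// /dist (eqP ij) addn0.
  by rewrite lerXn2r ?nnegrE// le_max lexx orbT.
have -> : b^-1 ^+ j * (A i * 2 ^+ j) = a^-1 ^+ (i - j) * (a ^+ i * A i).
  have -> : a ^+ i = a ^+ (i - j) * a ^+ j by rewrite -exprD subnK// ltnW.
  have e1 : a^-1 ^+ (i - j) * a ^+ (i - j) = 1.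
    by rewrite -exprMn mulVf ?expr1n// gt_eqF.
  have e2 : b^-1 ^+ j * b ^+ j = 1 by rewrite -exprMn mulVf ?expr1n// gt_eqF.
  rewrite -ab exprMn; transitivity (A i * a ^+ j * (b^-1 ^+ j * b ^+ j)); first ring.
  by rewrite e2 -e1; ring.
rewrite ler_wpM2r// /dist (eqP (ltnW ji)) add0n.
by rewrite lerXn2r ?nnegrE// le_max lexx.
Qed.

End Shells.

(** * Fractional differences *)

Section FracDiff.
Context {R : realType}.
Local Notation mu := (@lebesgue_measure R).
Local Notation T2 := (pi *+ 2 : R).

(** Jensen's inequality for weights of total mass at most [A].  The tangent line
    of the power function at the mean [sg] is Young's inequality for the product
    of [y j] and [sg ^ (p - 1)]. *)
Lemma jensen_sum (p A : R) (c y : nat -> R) n : 1 <= p -> 0 < A ->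
  (forall j, 0 <= c j) -> (forall j, 0 <= y j) ->
  \sum_(0 <= j < n) c j <= A ->
  (\sum_(0 <= j < n) c j * y j) `^ p <=
  A `^ (p - 1) * \sum_(0 <= j < n) c j * y j `^ p.
Proof.
move=> p1 A0 c0 y0 cA.
have cy0 : 0 <= \sum_(0 <= j < n) c j * y j.
  by apply: sumr_ge0 => j _; rewrite mulr_ge0.
move: p1; rewrite le_eqVlt => /predU1P[<-|p1].
  rewrite subrr powRr0 mul1r powRr1//; apply: ler_sum => j _.
  by rewrite powRr1.
have p0 : 0 < p by rewrite (lt_trans ltr01).
pose q := p / (p - 1).
have pm : 0 < p - 1 by rewrite subr_gt0.
have q0 : 0 < q by rewrite divr_gt0.
have pq : p^-1 + q^-1 = 1 by rewrite /q invf_div; field; rewrite gt_eqF.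
pose sg := (\sum_(0 <= j < n) c j * y j) / A.
have sg0 : 0 <= sg by rewrite divr_ge0// ltW.
have sgq : (sg `^ (p - 1)) `^ q = sg `^ p.
  by rewrite -powRrM /q mulrCA mulfV ?mulr1// gt_eqF.
have tangent j : c j * (y j * sg `^ (p - 1)) <= c j * (y j `^ p / p + sg `^ p / q).
  by rewrite ler_wpM2l// -sgq conjugate_powR// powR_ge0.
have : \sum_(0 <= j < n) c j * (y j * sg `^ (p - 1)) <=
       \sum_(0 <= j < n) c j * (y j `^ p / p + sg `^ p / q).
  exact: ler_sum.
under eq_bigr do rewrite mulrA.
rewrite -mulr_suml; under [leRHS]eq_bigr do rewrite mulrDr mulrA.
rewrite big_split/= -!mulr_suml.
have -> : \sum_(0 <= j < n) c j * y j = A * sg.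
  by rewrite /sg mulrCA mulfV ?mulr1// gt_eqF.
rewrite -mulrA mulr_powRB1//.
set S := \sum_(0 <= j < n) c j * y j `^ p => h.
have sp0 : 0 <= sg `^ p by exact: powR_ge0.
have h2 : (\sum_(0 <= i < n) c i) * (sg `^ p / q) <= A * (sg `^ p / q).
  by rewrite ler_wpM2r// divr_ge0// ltW.
have h3 : A * sg `^ p <= S.
  have e : A * sg `^ p = A * sg `^ p / p + A * (sg `^ p / q).
    by rewrite -[LHS]mulr1 -pq; ring.
  have h4 : A * sg `^ p / p <= S / p by lra.
  by rewrite -(ler_pM2r (_ : 0 < p^-1)) ?invr_gt0.
rewrite powRM ?(ltW A0)// -(@mulr_powRB1 _ A p) ?(ltW A0)// [A * _]mulrC -mulrA.
by rewrite ler_wpM2l// powR_ge0.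
Qed.

Variable (alpha : R).
Hypothesis alpha0 : 0 < alpha.

(** The series of absolute values bounds the fractional difference at every
    point, including those where the difference itself has no convergent
    series. *)
Definition diff_majorant (h : R) (g : R -> R) (x : R) : \bar R :=
  (\sum_(j <oo) (`|bcoef alpha j| * `|g (x + (alpha - j%:R) * h)|)%:E)%E.

Lemma diff_majorant_ge0 h g x : (0 <= diff_majorant h g x)%E.
Proof. by apply: nneseries_ge0 => j _ _; rewrite lee_fin mulr_ge0. Qed.

Lemma diff_majorant_cvg h g x : (diff_majorant h g x < +oo)%E ->
  cvgn (series (fun j => `|bcoef alpha j * g (x + (alpha - j%:R) * h)|)).
Proof.
move=> fin; apply: nnseries_is_cvg => [j|]; first exact: normr_ge0.
by under eq_eseriesr do rewrite normrM.
Qed.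

Lemma diff_majorantE h g x : (diff_majorant h g x < +oo)%E ->
  diff_majorant h g x = (limn (series
    (fun j => `|bcoef alpha j * g (x + (alpha - j%:R) * h)|)))%:E.
Proof.
move=> fin; have cn := diff_majorant_cvg fin.
rewrite -EFin_lim//; congr (limn _); apply/funext => n /=.
rewrite /series /= -sumEFin; apply: eq_bigr => j _.
by congr EFin; exact/esym/normrM.
Qed.

Lemma frac_diff_le_majorant h g x :
  (`|frac_diff alpha h g x|%:E <= diff_majorant h g x)%E.
Proof.
have [->|] := eqVneq (diff_majorant h g x) +oo%E; first by rewrite leey.
rewrite -ltey => fin; have cn := diff_majorant_cvg fin.
by rewrite diff_majorantE// lee_fin; exact: lim_series_norm.
Qed.

(** Pointwise comparison of [f] with a trigonometric polynomial [s], whose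
    differences converge everywhere. *)
Lemma frac_diff_split_le h (f s : R -> R) x :
  cvgn (series (fun j => bcoef alpha j * s (x + (alpha - j%:R) * h))) ->
  (`|frac_diff alpha h f x|%:E <= `|frac_diff alpha h s x|%:E +
     diff_majorant h (fun y => f y - s y)%R x)%E.
Proof.
move=> cs; have [->|] := eqVneq (diff_majorant h (fun y => f y - s y) x) +oo%E.
  by rewrite addey ?leey// -ltNye ltNyr.
rewrite -ltey => fin; have cg := normed_cvg (diff_majorant_cvg fin).
apply: le_trans (leeD2l _ (frac_diff_le_majorant h (fun y => f y - s y) x)).
rewrite -EFinD lee_fin.
suff -> : frac_diff alpha h f x = frac_diff alpha h s x + frac_diff alpha h (fun y => f y - s y) x.
  exact: ler_normD.
apply/cvg_lim => //; rewrite [X in X @ \oo --> _](_ : _ =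
  series (fun j => bcoef alpha j * s (x + (alpha - j%:R) * h)) +
  series (fun j => bcoef alpha j * (fun y => f y - s y) (x + (alpha - j%:R) * h))).
  exact: cvgD.
apply/funext => n; rewrite !fctE /series/= -big_split/=; apply: eq_bigr => j _.
by rewrite -mulrDr [s _ + _]addrC subrK.
Qed.

Lemma measurable_diff_term h (g : R -> R) j : measurable_fun setT g ->
  measurable_fun setT (fun x : R => (`|bcoef alpha j| * `|g (x + (alpha - j%:R) * h)|)%:E).
Proof.
move=> mg; apply/measurable_EFinP; apply: measurable_funM => //.
apply: measurableT_comp => //; apply: (measurableT_comp mg).
exact: measurable_shift.
Qed.

Lemma measurable_diff_majorant h (g : R -> R) : measurable_fun setT g ->
  measurable_fun setT (diff_majorant h g).
Proof.
move=> mg; apply: ge0_emeasurable_sum.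
- by move=> j x _ _; rewrite lee_fin mulr_ge0.
- by move=> j _; exact: measurable_diff_term.
Qed.

(** By Jensen's inequality with the summable weights [`|bcoef j|] and by the
    invariance of the integral under translations, uniformly in the step. *)
Lemma diff_majorant_Lp (p : R) : 1 <= p -> exists2 K : R, 0 < K &
  forall h (g : R -> R), (forall x, g (x + T2) = g x) -> measurable_fun setT g ->
  (\int[mu]_(x in torus) (diff_majorant h g x `^ p) <=
   K%:E * \int[mu]_(x in torus) (`|g x| `^ p)%:E)%E.
Proof.
move=> p1; have p0 : 0 < p by rewrite (lt_le_trans ltr01).
have [A A1 [sA _]] := bcoef_bounds alpha0.
have A0 : 0 < A by rewrite (lt_le_trans ltr01).
exists (A `^ (p - 1) * A); first by rewrite mulr_gt0// powR_gt0.
move=> h g pg mg.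
pose t j x := (`|bcoef alpha j| * `|g (x + (alpha - j%:R) * h)| `^ p)%:E.
have t0 j x : (0 <= t j x)%E by rewrite lee_fin mulr_ge0// powR_ge0.
have mp : measurable_fun setT (fun x => (`|g x| `^ p)%:E).
  apply/measurable_EFinP; apply: (measurableT_comp (measurable_powR p)).
  exact: measurableT_comp.
have mt j : measurable_fun setT (t j).
  apply/measurable_EFinP; apply: measurable_funM => //.
  apply: (measurableT_comp (measurable_powR p)); apply: measurableT_comp => //.
  by apply: (measurableT_comp mg); exact: measurable_shift.
have s0 x : (0 <= \sum_(j <oo) t j x)%E by apply: nneseries_ge0 => j _ _.
apply: (@le_trans _ _ (\int[mu]_(x in torus)
    ((A `^ (p - 1))%:E * \sum_(j <oo) t j x))%E).
  apply: ge0_le_integral_any => x _; first exact: poweR_ge0.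
  have Ap : (0 <= (A `^ (p - 1))%:E * \sum_(j <oo) t j x)%E.
    by rewrite mule_ge0// lee_fin powR_ge0.
  rewrite -[leRHS]poweRe1// -[X in (_ <= _ `^ X)%E](@mulVf _ p) ?gt_eqF// poweRrM.
  apply: le_poweR; [exact: ltW|exact: diff_majorant_ge0|].
  apply: nneseries_le => [j|n]; first by rewrite lee_fin mulr_ge0.
  apply: poweR_inv_le => //; first by rewrite sume_ge0// => j _; rewrite lee_fin mulr_ge0.
  rewrite sumEFin poweR_EFin.
  apply: (@le_trans _ _ ((A `^ (p - 1))%:E * \sum_(0 <= j < n) t j x)%E); last first.
    rewrite lee_wpmul2l ?lee_fin ?powR_ge0//.
    by apply: nneseries_lim_ge => j _ _.
  by rewrite sumEFin -EFinM lee_fin; apply: jensen_sum.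
rewrite ge0_integralZl//; last 3 first.
- exact: measurable_torus.
- apply: measurable_funTS; apply: ge0_emeasurable_sum => [j x _ _|j _].
    exact: t0.
  exact: mt.
- by rewrite lee_fin powR_ge0.
rewrite EFinM -muleA lee_wpmul2l ?lee_fin ?powR_ge0//.
rewrite integral_nneseries//; last 2 first.
- exact: measurable_torus.
- by move=> j; apply: measurable_funTS; exact: mt.
set I := (\int[mu]_(x in torus) (`|g x| `^ p)%:E)%E.
have I0 : (0 <= I)%E by apply: integral_ge0 => x _; rewrite lee_fin powR_ge0.
have tI j : (\int[mu]_(x in torus) t j x = `|bcoef alpha j|%:E * I)%E.
  rewrite /t; under eq_integral do rewrite EFinM.
  rewrite ge0_integralZl; last 4 first.
  - exact: measurable_torus.
  - apply: measurable_funTS; apply: (measurableT_comp mp); exact: measurable_shift.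
  - by move=> x _; rewrite lee_fin powR_ge0.
  - by rewrite lee_fin.
  congr (_ * _)%E.
  apply: (periodic_integral_shift _ (f := fun x => (`|g x| `^ p)%:E)) => //.
  by move=> x; rewrite pg.
apply: nneseries_le => [j|n]; first by rewrite tI mule_ge0// lee_fin.
under eq_bigr do rewrite tI.
rewrite -ge0_sume_distrl; last by move=> j _; rewrite lee_fin.
by rewrite sumEFin lee_wpmul2r// lee_fin.
Qed.

(** The modulus and the argument of [exp (i alpha t) * (1 - exp (- i t)) ^ alpha].
    A difference of step [h] multiplies the amplitude at frequency [nu] by
    [mult_abs (nu * `|h|)] and shifts the phase by [mult_arg (nu * `|h|)], with
    the sign of [h]. *)
Definition mult_abs (t : R) : R := (2 * sin (t / 2)) `^ alpha.
Definition mult_arg (t : R) : R := alpha * (pi + t) / 2.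

Lemma cvg_frac_diff_cos (h nu d x : R) : 0 <= nu -> nu * `|h| <= pi ->
  series (fun j => bcoef alpha j * cos (nu * (x + (alpha - j%:R) * h) + d)) @ \oo -->
  mult_abs (nu * `|h|) *
  cos (nu * x + d + (-1) ^+ (h < 0)%R * mult_arg (nu * `|h|)).
Proof.
move=> nu0 nuh; have t0pi : 0 <= nu * `|h| <= pi by rewrite nuh mulr_ge0.
have e := @binomial_multiplier _ alpha (nu * `|h|) alpha0 t0pi.
have [h0|h0] := leP 0 h.
  rewrite expr0 mul1r.
  have -> : nu * x + d + mult_arg (nu * `|h|) =
    mult_arg (nu * `|h|) - (- (nu * x + d)) by rewrite opprK addrC.
  have -> : (fun j => bcoef alpha j * cos (nu * (x + (alpha - j%:R) * h) + d)) =
    (fun j => bcoef alpha j * cos ((alpha - j%:R) * (nu * `|h|) - (- (nu * x + d)))).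
    by apply/funext => j; rewrite ger0_norm//; congr (_ * cos _); ring.
  exact: e.
rewrite expr1 mulN1r.
have -> : cos (nu * x + d - mult_arg (nu * `|h|)) =
          cos (mult_arg (nu * `|h|) - (nu * x + d)) by rewrite -cosN opprB.
have -> : (fun j => bcoef alpha j * cos (nu * (x + (alpha - j%:R) * h) + d)) =
    (fun j => bcoef alpha j * cos ((alpha - j%:R) * (nu * `|h|) - (nu * x + d))).
  apply/funext => j; rewrite ltr0_norm//; congr (_ * _); rewrite -cosN.
  by congr cos; ring.
exact: e.
Qed.

End FracDiff.

(** * Uniqueness of Fourier coefficients *)

Section Pairing.
Context {R : realType}.
Local Notation mu := (@lebesgue_measure R).

Definition pairing (f w : R -> R) : R := \int[mu]_(x in torus) (f x * w x).

Definition bmeas (w : R -> R) : Prop :=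
  measurable_fun setT w /\ exists M : R, forall x : R, `|w x| <= M.

Lemma bmeas_cst c : bmeas (fun=> c).
Proof. by split; [exact: measurable_cst|exists `|c|]. Qed.

Lemma bmeas_cos (k d : R) : bmeas (fun x => cos (k * x + d)).
Proof.
split; last by exists 1 => x; exact: cos_max.
apply: (measurableT_comp (continuous_measurable_fun (@continuous_cos R))).
by apply: measurable_funD => //; exact: measurable_funM.
Qed.

Lemma bmeasM v w : bmeas v -> bmeas w -> bmeas (fun x => v x * w x).
Proof.
move=> [mv [M hM]] [mw [N hN]]; split; first exact: measurable_funM.
by exists (M * N) => x; rewrite normrM ler_pM.
Qed.

Lemma bmeasD v w : bmeas v -> bmeas w -> bmeas (fun x => v x + w x).
Proof.
move=> [mv [M hM]] [mw [N hN]]; split; first exact: measurable_funD.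
by exists (M + N) => x; rewrite (le_trans (ler_normD _ _))// lerD.
Qed.

Lemma bmeasZ c w : bmeas w -> bmeas (fun x => c * w x).
Proof. by move=> bw; apply: bmeasM bw; exact: bmeas_cst. Qed.

Lemma bmeas_sum (I : Type) (s : seq I) (w : I -> R -> R) :
  (forall i, bmeas (w i)) -> bmeas (fun x => \sum_(i <- s) w i x).
Proof.
move=> bw; elim: s => [|i s IH].
  by under eq_fun do rewrite big_nil; exact: bmeas_cst.
by under eq_fun do rewrite big_cons; exact: bmeasD.
Qed.

Variable f : R -> R.
Hypothesis intf : mu.-integrable torus (EFin \o f).

Lemma integrable_pairing w : bmeas w ->
  mu.-integrable torus (EFin \o (fun x => f x * w x)).
Proof.
move=> [mw [M hM]].
have := @integrableMl _ _ _ mu torus measurable_torus (EFin \o f) w intf.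
move=> h; have {h} : mu.-integrable torus ((EFin \o f) \* (EFin \o w))%E.
  apply: h; first exact: measurable_funTS.
  exists M; split; first exact: num_real.
  by move=> N MN x _ /=; rewrite (le_trans (hM x))// ltW.
by [].
Qed.

Lemma pairingD v w : bmeas v -> bmeas w ->
  pairing f (fun x => v x + w x) = pairing f v + pairing f w.
Proof.
move=> bv bw; rewrite /pairing -RintegralD; [|exact: measurable_torus| |].
- by apply: eq_Rintegral => x _; rewrite mulrDr.
- exact: integrable_pairing.
- exact: integrable_pairing.
Qed.

Lemma pairingZ c w : bmeas w -> pairing f (fun x => c * w x) = c * pairing f w.
Proof.
move=> bw; rewrite /pairing -RintegralZl; [|exact: measurable_torus|].
- by apply: eq_Rintegral => x _; rewrite mulrCA.
- exact: integrable_pairing.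
Qed.

Lemma pairing_sum (I : Type) (s : seq I) (w : I -> R -> R) :
  (forall i, bmeas (w i)) ->
  pairing f (fun x => \sum_(i <- s) w i x) = \sum_(i <- s) pairing f (w i).
Proof.
move=> bw; elim: s => [|i s IH].
  rewrite big_nil -[RHS](mul0r (pairing f (fun=> 1))) -pairingZ; last exact: bmeas_cst.
  by congr pairing; apply/funext => x; rewrite big_nil mul0r.
rewrite big_cons -IH -pairingD//; last exact: bmeas_sum.
by congr pairing; apply/funext => x; rewrite big_cons.
Qed.

Lemma pairing_lim (w : nat -> R -> R) (v : R -> R) (M : R) :
  (forall n, measurable_fun setT (w n)) -> (forall n x, `|w n x| <= M) ->
  measurable_fun setT v ->
  {ae mu, forall x, torus x -> w ^~ x @ \oo --> v x} ->
  (forall n, pairing f (w n) = 0) -> pairing f v = 0.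
Proof.
move=> mw wM mv wv w0.
have M0 : 0 <= M by rewrite (le_trans _ (wM 0%N 0)).
have mf : measurable_fun torus f by have /integrableP[/measurable_EFinP] := intf.
have := @dominated_convergence _ _ R mu torus measurable_torus
  (fun n x => (f x * w n x)%:E) (fun x => (f x * v x)%:E)
  (fun x => (M * `|f x|)%:E).
case.
- by move=> n; apply/measurable_EFinP; apply: measurable_funM => //; apply: measurable_funTS; exact: mw.
- by apply/measurable_EFinP; apply: measurable_funM => //; apply: measurable_funTS; exact: mv.
- apply: filterS wv; first exact: (ae_filter_ringOfSetsType mu).
  move=> x wx Dx; apply: cvg_EFin; first by apply: nearW.
  by apply: cvgMr; exact: wx.
- have : mu.-integrable torus (fun x => M%:E * (`|f x|)%:E)%E.
    by apply: integrableZl; [exact: measurable_torus|exact: integrable_norm].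
  by [].
- apply: aeW => x n _; rewrite lee_fin normrM mulrC ler_wpM2r//.
move=> iv _.
rewrite (_ : [sequence _]_n = cst 0%E); last first.
  apply/funext => n /=; have := w0 n; rewrite /pairing /Rintegral => h.
  have bw : bmeas (w n) by split; [exact: mw|exists M => x; exact: wM].
  have fin : (\int[mu]_(x in torus) (f x * w n x)%:E)%E \is a fin_num.
    by apply: integrable_fin_num; [exact: measurable_torus|exact: integrable_pairing].
  by rewrite -(fineK fin) h.
by move=> /(cvg_unique _ (cvg_cst _)) h; rewrite /pairing /Rintegral -h.
Qed.

End Pairing.

Section Uniqueness.
Context {R : realType}.
Local Notation mu := (@lebesgue_measure R).
Variable u : R -> R.
Hypothesis intu : mu.-integrable torus (EFin \o u).
Hypothesis u_cos : forall n : nat, pairing u (fun x => cos (n%:R * x)) = 0.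
Hypothesis u_sin : forall n : nat, pairing u (fun x => sin (n%:R * x)) = 0.

(** Orthogonality to all cosines of integral frequency and arbitrary phase is
    stable under multiplication by such cosines, so that [u] is orthogonal to
    every polynomial in them. *)
Let annihilated (w : R -> R) : Prop := bmeas w /\
  forall (k : nat) (d : R), pairing u (fun x => w x * cos (k%:R * x + d)) = 0.

Let ann1 : annihilated (fun=> 1).
Proof.
split; first exact: bmeas_cst.
move=> k d; transitivity (pairing u (fun x => cos d * cos (k%:R * x + 0) +
    (- sin d) * cos (k%:R * x + - (pi / 2)))).
  congr pairing; apply/funext => x; rewrite mul1r cosD addr0 cosBpihalf; ring.
have b1 := bmeasZ (cos d) (bmeas_cos k%:R 0).
have b2 := bmeasZ (- sin d) (bmeas_cos k%:R (- (pi / 2))).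
rewrite (pairingD intu b1 b2) !(pairingZ intu); [|exact: bmeas_cos|exact: bmeas_cos].
under [X in pairing u X]eq_fun do rewrite addr0.
under [X in _ + _ * pairing u X]eq_fun do rewrite cosBpihalf.
by rewrite u_cos u_sin !mulr0 addr0.
Qed.

Let annD v w : annihilated v -> annihilated w -> annihilated (fun x => v x + w x).
Proof.
move=> [bv hv] [bw hw]; split; first exact: bmeasD.
move=> k d; transitivity (pairing u (fun x => v x * cos (k%:R * x + d) +
    w x * cos (k%:R * x + d))).
  by congr pairing; apply/funext => x; rewrite mulrDl.
rewrite pairingD//; last 2 first.
- by apply: bmeasM => //; exact: bmeas_cos.
- by apply: bmeasM => //; exact: bmeas_cos.
by rewrite hv hw addr0.
Qed.

Let annZ c w : annihilated w -> annihilated (fun x => c * w x).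
Proof.
move=> [bw hw]; split; first exact: bmeasZ.
move=> k d; transitivity (pairing u (fun x => c * (w x * cos (k%:R * x + d)))).
  by congr pairing; apply/funext => x; rewrite mulrA.
rewrite pairingZ ?hw ?mulr0//.
by apply: bmeasM => //; exact: bmeas_cos.
Qed.

Let ann_cos g w : annihilated w -> annihilated (fun x => w x * cos (x - g)).
Proof.
move=> [bw hw]; split.
  apply: bmeasM => //; have := bmeas_cos 1 (- g).
  by under eq_fun do rewrite mul1r.
have bc k d : bmeas (fun x => w x * cos (k * x + d)).
  by apply: bmeasM => //; exact: bmeas_cos.
move=> [|k] d.
  transitivity (pairing u (fun x => cos d * (w x * cos (1%:R * x + - g)))).
    by congr pairing; apply/funext => x; rewrite mul0r add0r mul1r; ring.
  by rewrite pairingZ// hw mulr0.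
transitivity (pairing u (fun x => 2^-1 * (w x * cos (k.+2%:R * x + (d - g))) +
    2^-1 * (w x * cos (k%:R * x + (d + g))))).
  congr pairing; apply/funext => x.
  have -> : k.+2%:R * x + (d - g) = (k.+1%:R * x + d) + (x - g).
    by rewrite -natr1; ring.
  have -> : k%:R * x + (d + g) = (k.+1%:R * x + d) - (x - g).
    by rewrite -natr1; ring.
  set a := _ + d; set b := x - g.
  by rewrite (cosD a b) (cosB a b); field.
rewrite pairingD ?pairingZ// ?hw ?mulr0 ?addr0//; exact: bmeasZ.
Qed.

Let annX (Y w : R -> R) n :
  (forall w, annihilated w -> annihilated (fun x => w x * Y x)) ->
  annihilated w -> annihilated (fun x => w x * Y x ^+ n).
Proof.
move=> hY aw; elim: n => [|n IH].
  by under [X in annihilated X]eq_fun do rewrite expr0 mulr1.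
under [X in annihilated X]eq_fun do rewrite exprSr mulrA.
exact: hY.
Qed.

Let annY A B g w : annihilated w -> annihilated (fun x => w x * (A + B * cos (x - g))).
Proof.
move=> aw; have := annD (annZ A aw) (annZ B (ann_cos g aw)).
by congr annihilated; apply/funext => x; ring.
Qed.

Let ann_steep A B g n m :
  annihilated (fun x => (1 - (A + B * cos (x - g)) ^+ n) ^+ m).
Proof.
pose Y x := A + B * cos (x - g).
have hY w : annihilated w -> annihilated (fun x => w x * Y x) by exact: annY.
have hZ w : annihilated w -> annihilated (fun x => w x * (1 - Y x ^+ n)).
  move=> aw; have := annD aw (annZ (- 1) (annX n hY aw)).
  by congr annihilated; apply/funext => x; ring.
have := annX m hZ ann1.
by under [X in annihilated X -> _]eq_fun do rewrite mul1r.
Qed.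

(** For [0 <= y <= 1] these polynomials tend to one below [1 / 2] and to zero
    above, since [(1 - y ^ n) ^ (2 ^ n)] is of order [exp (- (2 y) ^ n)]. *)
Let steep (n : nat) (y : R) : R := (1 - y ^+ n) ^+ (2 ^ n).

Let steep01 n y : 0 <= y <= 1 -> 0 <= steep n y <= 1.
Proof.
move=> /andP[y0 y1]; have yn0 : 0 <= y ^+ n by rewrite exprn_ge0.
have yn1 : y ^+ n <= 1 by rewrite exprn_ile1.
by rewrite /steep exprn_ge0 ?subr_ge0//= exprn_ile1 ?subr_ge0// gerBl.
Qed.

Let cvg_steep1 (y : R) : 0 <= y < 2^-1 -> steep ^~ y @ \oo --> (1 : R).
Proof.
move=> /andP[y0 y1]; have y11 : y <= 1 by rewrite (le_trans (ltW y1))// invf_le1// ler1n.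
have l : (fun n => 1 - (2 * y) ^+ n) @ \oo --> (1 : R).
  rewrite -[X in _ --> X](subr0 (1 : R)); apply: cvgB; first exact: cvg_cst.
  by apply: cvg_expr; rewrite ger0_norm; lra.
have y01 : 0 <= y <= 1 by rewrite y0.
apply: (squeeze_cvgr _ l (cvg_cst (1 : R))).
apply: nearW => n; have /andP[_ ->] := steep01 n y01.
rewrite andbT /steep exprMn -natrX -mulrN.
by apply: bernoulli_le; rewrite lerN2 exprn_ile1.
Qed.

Let cvg_steep0 (y : R) : 2^-1 < y <= 1 -> steep ^~ y @ \oo --> (0 : R).
Proof.
move=> /andP[y1 y11]; have y0 : 0 < y by rewrite (lt_trans _ y1)// invr_gt0.
have y01 : 0 <= y <= 1 by rewrite (ltW y0).
have l : (fun n => ((2 * y)^-1) ^+ n) @ \oo --> (0 : R).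
  apply: cvg_expr; rewrite ger0_norm ?invr_ge0 ?mulr_ge0 ?(ltW y0)//.
  by rewrite invf_lt1 ?mulr_gt0//; lra.
apply: (squeeze_cvgr _ (cvg_cst 0) l).
apply: nearW => n; have /andP[-> _] := steep01 n y01.
rewrite /steep exprVn /=.
have yn0 : 0 < y ^+ n by rewrite exprn_gt0.
have yn1 : y ^+ n <= 1 by rewrite exprn_ile1// ltW.
rewrite -[leRHS]mul1r ler_pdivlMr ?exprn_gt0 ?mulr_gt0//.
apply: (@le_trans _ _ ((1 - y ^+ n) ^+ (2 ^ n) * (1 + y ^+ n) ^+ (2 ^ n))).
  rewrite ler_wpM2l ?exprn_ge0 ?subr_ge0// exprMn -natrX.
  have : 1 + (2 ^ n)%:R * y ^+ n <= (1 + y ^+ n) ^+ (2 ^ n).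
    by apply: bernoulli_le; rewrite (le_trans _ (ltW yn0))// lerNl oppr0.
  by lra.
rewrite -exprMn exprn_ile1//; last first.
  have : 0 <= y ^+ n * y ^+ n by rewrite mulr_ge0 ?(ltW yn0).
  by lra.
by rewrite mulr_ge0 ?subr_ge0// addr_ge0// ltW.
Qed.

(** The indicator of [(- pi, y)] is a bounded limit of trigonometric polynomials:
    the trigonometric polynomial [sg] is positive on this interval, negative on
    [(y, pi)], and [steep n] is applied to [(1 - sg) / 2]. *)
Let initial_integral y : - pi < y < pi ->
  \int[mu]_(x in `[- pi, y]) u x = 0.
Proof.
move=> /andP[y0 y1].
pose g := (y - pi) / 2; pose d := (y + pi) / 2.
pose sg x := sin ((x + pi) / 2) * sin ((y - x) / 2).
pose Y x := (1 + 2^-1 * cos d) / 2 + (- (4^-1)) * cos (x - g).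
have Ysg x : Y x = (1 - sg x) / 2.
  have -> : sg x = (cos (x - g) - cos d) / 2.
    have -> : x - g = (x + pi) / 2 - (y - x) / 2 by rewrite /g; field.
    have -> : d = (x + pi) / 2 + (y - x) / 2 by rewrite /d; field.
    set a := (x + pi) / 2; set b := (y - x) / 2.
    by rewrite (cosB a b) (cosD a b) /sg -/a -/b; field.
  by rewrite /Y; field.
have sg1 x : `|sg x| <= 1 by rewrite normrM mulr_ile1// sin_max.
have Y01 x : 0 <= Y x <= 1.
  by have := sg1 x; rewrite ler_norml Ysg => /andP[h1 h2]; apply/andP; split; lra.
have ann n : annihilated (fun x => steep n (Y x)) by exact: ann_steep.
pose v : R -> R := \1_(`]- pi, y[%classic).
have mv : measurable_fun setT v by apply: measurable_indic; exact: measurable_itv.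
have vlim x : torus x -> x != - pi -> x != y -> x != pi ->
    (fun n => steep n (Y x)) @ \oo --> v x.
  rewrite /torus /= in_itv/= => /andP[x0 x1] xn0 xny xn1.
  have {x0 xn0} x0 : - pi < x by rewrite lt_neqAle eq_sym xn0.
  have {x1 xn1} x1 : x < pi by rewrite lt_neqAle xn1.
  have s1 : 0 < sin ((x + pi) / 2).
    by apply: sin_gt0_pi; apply/andP; split; lra.
  have [xy|yx] := ltP x y.
    rewrite /v indicE mem_set; last by rewrite /= in_itv/= x0.
    apply: cvg_steep1; have /andP[-> _] := Y01 x; rewrite /= Ysg.
    have : 0 < sg x.
      by rewrite mulr_gt0//; apply: sin_gt0_pi; apply/andP; split; lra.
    by lra.
  have {yx xny} yx : y < x by rewrite lt_neqAle eq_sym xny.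
  rewrite /v indicE memNset; last first.
    by rewrite /= in_itv/= x0/= => h; have := lt_trans yx h; rewrite ltxx.
  apply: cvg_steep0; have /andP[_ ->] := Y01 x; rewrite andbT Ysg.
  have : 0 < sin ((x - y) / 2).
    by apply: sin_gt0_pi; apply/andP; split; lra.
  have -> : (x - y) / 2 = - ((y - x) / 2) by lra.
  rewrite sinN oppr_gt0 => s2; have : sg x < 0 by rewrite /sg pmulr_rlt0.
  by lra.
have h0 : pairing u v = 0.
  apply: (@pairing_lim _ u intu (fun n x => steep n (Y x)) v 1) => //.
  - by move=> n; have [[]] := ann n.
  - move=> n x; have /andP[h1 h2] := steep01 n (Y01 x).
    by rewrite ger0_norm.
  - exists ([set - pi] `|` [set y] `|` [set pi]); split.
    + by apply: measurableU; [apply: measurableU|]; exact: measurable_set1.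
    + apply: countable_lebesgue_measure0; apply: finite_set_countable.
      by rewrite !finite_setU; do !split; exact: finite_set1.
    + move=> x /= h; apply: contrapT => hn; apply: h => tx; apply: vlim => //.
      * by apply/eqP => e; apply: hn; left; left.
      * by apply/eqP => e; apply: hn; left; right.
      * by apply/eqP => e; apply: hn; right.
  - move=> n; have [_ /(_ 0%N 0)] := ann n.
    by under [X in pairing u X]eq_fun do rewrite mul0r add0r cos0 mulr1.
rewrite -h0 /pairing.
have sub : `]- pi, y[ `<=` (torus : set R).
  move=> x /=; rewrite /torus !in_itv/= => /andP[h1 h2].
  by rewrite in_itv/= (ltW h1) ltW// (lt_trans h2).
transitivity (\int[mu]_(x in `]- pi, y[) u x).
  have iu : mu.-integrable `[- pi, y] (EFin \o u).
    apply: (integrableS _ _ _ intu); [exact: measurable_torus|exact: measurable_itv|].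
    move=> x /=; rewrite /torus !in_itv/= => /andP[h1 h2].
    by rewrite in_itv/= h1 (le_trans h2)// ltW.
  have iu2 : mu.-integrable `]- pi, y] (EFin \o u).
    apply: (integrableS _ _ _ iu); [exact: measurable_itv|exact: measurable_itv|].
    by move=> x /=; rewrite !in_itv/= => /andP[h1 ->]; rewrite ltW.
  have iu3 : mu.-integrable `]- pi, y[ (EFin \o u).
    apply: (integrableS _ _ _ iu2); [exact: measurable_itv|exact: measurable_itv|].
    by move=> x /=; rewrite !in_itv/= => /andP[-> h1]; rewrite ltW.
  by rewrite -Rintegral_itv_obnd_cbnd// -Rintegral_itv_bndo_bndc.
rewrite -[in LHS](setIidl sub) Rintegral_mkcondl.
apply: eq_Rintegral => x _; rewrite /v patchE indicE.
by case: (x \in _); rewrite ?mulr1 ?mulr0.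
Qed.

(** The indefinite integral of [u] vanishes, hence so does its derivative, which
    is [u] almost everywhere. *)
Lemma fourier_uniqueness : {ae mu, forall x, torus x -> u x = 0}.
Proof.
pose g := u \_ torus.
have ig : mu.-integrable setT (EFin \o g).
  have mT : measurable (torus : set (measurableTypeR R)) by exact: measurable_torus.
  rewrite /g -restrict_EFin; have [h _] := integrable_mkcond (mu := mu) (EFin \o u) mT.
  exact: h.
have lg : locally_integrable setT g.
  by apply: open_integrable_locally => //; exact: openT.
have igy y : mu.-integrable [set` Interval (BLeft (- pi)) (BRight y)] (EFin \o g).
  by apply: (integrableS _ _ _ ig) => //; exact: measurable_itv.
have := @FTC1 _ g (BLeft (- pi)) igy lg.
have e0 : {ae mu, forall x, x != - pi /\ x != pi}.
  exists ([set - pi] `|` [set pi]); split.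
  - by apply: measurableU; exact: measurable_set1.
  - apply: countable_lebesgue_measure0; apply: finite_set_countable.
    by rewrite !finite_setU; do !split; exact: finite_set1.
  - move=> x /= h; apply: contrapT => hn; apply: h.
    by split; apply/eqP => e; apply: hn; [left|right].
apply: filterS2 e0; first exact: (ae_filter_ringOfSetsType mu).
move=> x [xn0 xn1] hF; rewrite /torus /= in_itv/= => /andP[x0 x1].
have {x0 xn0} x0 : - pi < x by rewrite lt_neqAle eq_sym xn0.
have {x1 xn1} x1 : x < pi by rewrite lt_neqAle xn1.
have [|_] := hF _; first exact: x0.
have gx : g x = u x.
  by rewrite /g patchE mem_set// /torus /= in_itv/= (ltW x0) (ltW x1).
rewrite gx => <-; rewrite derive1E -(derive_cst (0 : R) x 1).
apply: near_eq_derive => //.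
have hin : x \in `]- pi, pi[ by rewrite in_itv/= x0.
apply: filterS (near_in_itvoo hin) => z; rewrite in_itv/= => z01.
rewrite -(initial_integral z01).
apply: eq_Rintegral => t; rewrite inE/= in_itv/= => /andP[t0 t1].
rewrite /g patchE mem_set// /torus /= in_itv/= t0/= (le_trans t1)//.
by have /andP[_ /ltW] := z01.
Qed.

End Uniqueness.

(** * Dyadic blocks of general monotone series *)

Section Blocks.
Context {R : realType}.
Local Notation mu := (@lebesgue_measure R).

Section GM.
Variables (C : R) (a : nat -> R).
Hypothesis C0 : 0 < C.
Hypothesis a0 : forall n, (0 < n)%N -> 0 <= a n.
Hypothesis gma : gm_with C a.

Lemma gm_variation n : (0 < n)%N -> dyadic_var a n <= C * a n.
Proof. by move=> n0; rewrite (le_trans (gma n0))// ger0_norm// a0. Qed.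

Lemma gm_le n k : (0 < n)%N -> (n <= k <= n.*2)%N -> a k <= (1 + C) * a n.
Proof.
move=> n0 /andP[nk kn]; have := gm_variation n0.
suff : `|a n - a k| <= dyadic_var a n.
  by rewrite distrC => h1; have := ler_norm (a k - a n); lra.
rewrite -opprB normrN -(telescope_sumr a nk).
rewrite (le_trans (ler_norm_sum _ _ _))// /dyadic_var (big_cat_nat nk kn)/=.
under eq_bigr do rewrite distrC.
by rewrite lerDl sumr_ge0.
Qed.

(** A weight of size [M] and of variation [V] over the block preserves the slow
    variation of a general monotone sequence. *)
Lemma gm_block (w : nat -> R) (M V : R) i j x d : shell j x -> 0 <= M -> 0 <= V ->
  (forall k, (2 ^ i <= k <= (2 ^ i).*2)%N -> `|w k| <= M) ->
  dyadic_var w (2 ^ i) <= V ->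
  `|\sum_(2 ^ i <= k < (2 ^ i).*2) a k * w k * cos (k%:R * x + d)| <=
  32 * (1 + C) * (M + V) * a (2 ^ i)%N * 2 ^+ minn i j.
Proof.
move=> sx M0 V0 wM wV; set n := (2 ^ i)%N.
have n0 : (0 < n)%N by rewrite expn_gt0.
have an0 : 0 <= a n := a0 n0.
have c10 : 0 <= 1 + C by rewrite addr_ge0// ltW.
have ak k : (n <= k <= n.*2)%N -> `|a k| <= (1 + C) * a n.
  move=> h; have /andP[nk _] := h.
  by rewrite ger0_norm ?a0 ?(leq_trans n0 nk)//; exact: gm_le.
have -> : 32 * (1 + C) * (M + V) * a n * 2 ^+ minn i j =
          32 * ((1 + C) * a n * (M + V)) * 2 ^+ minn i j by ring.
apply: trig_block => // [k hk|].
  rewrite normrM; apply: ler_pM => //; first exact: ak.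
  by rewrite (le_trans (wM _ hk))// lerDl.
rewrite /dyadic_var -/n.
apply: (@le_trans _ _ (\sum_(n <= k < n.*2) (M * `|a k - a k.+1| +
    (1 + C) * a n * `|w k - w k.+1|))).
  rewrite !big_nat; apply: ler_sum => k /andP[nk kn].
  have -> : a k * w k - a k.+1 * w k.+1 =
    w k * (a k - a k.+1) + a k.+1 * (w k - w k.+1) by ring.
  rewrite (le_trans (ler_normD _ _))// !normrM; apply: lerD.
    by rewrite ler_wpM2r// wM// nk ltnW.
  by rewrite ler_wpM2r// ak// leqW.
rewrite big_split/= -!mulr_sumr.
have h1 : M * \sum_(n <= k < n.*2) `|a k - a k.+1| <= M * (C * a n).
  by rewrite ler_wpM2l//; exact: gm_variation.
have h2 : (1 + C) * a n * \sum_(n <= k < n.*2) `|w k - w k.+1| <= (1 + C) * a n * V.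
  by rewrite ler_wpM2l// mulr_ge0.
have h3 : 0 <= M * a n by rewrite mulr_ge0.
by lra.
Qed.

End GM.

Section Multiplier.
Variable alpha : R.
Hypothesis alpha0 : 0 < alpha.

Lemma sin_le (x : R) : 0 <= x -> sin x <= x.
Proof.
move=> x0; have := sin_lip x 0; rewrite sin0 !subr0 (ger0_norm x0).
by apply: le_trans; exact: ler_norm.
Qed.

Lemma sin_half01_ge0 (t : R) : 0 <= t <= 1 -> 0 <= sin (t / 2).
Proof.
move=> /andP[t0 t1]; apply: sin_ge0_pi; have := pi_ge2 R => p2.
by apply/andP; split; lra.
Qed.

Lemma mult_abs_ge0 (t : R) : 0 <= mult_abs alpha t.
Proof. exact: powR_ge0. Qed.

Lemma mult_abs_le (t : R) : 0 <= t <= 1 -> mult_abs alpha t <= t `^ alpha.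
Proof.
move=> t01; have /andP[t0 t1] := t01; have s0 := sin_half01_ge0 t01.
apply: ge0_ler_powR; rewrite ?nnegrE ?mulr_ge0 ?(ltW alpha0)//.
by have := @sin_le (t / 2) (ltac:(lra)); lra.
Qed.

Lemma mult_abs_ge (t : R) : 0 <= t <= 1 -> (t / 2) `^ alpha <= mult_abs alpha t.
Proof.
move=> t01; have /andP[t0 t1] := t01.
have h : t / 2 / 2 <= sin (t / 2) by apply: sin_ge_half; apply/andP; split; lra.
apply: ge0_ler_powR; rewrite ?nnegrE ?mulr_ge0 ?sin_half01_ge0 ?(ltW alpha0)//.
by lra.
Qed.

Lemma mult_abs_mono (s t : R) : 0 <= s <= t -> t <= 1 ->
  mult_abs alpha s <= mult_abs alpha t.
Proof.
move=> /andP[s0 st] t1.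
have p1 := pihalf_ge1 R.
apply: ge0_ler_powR; rewrite ?nnegrE ?mulr_ge0 ?sin_half01_ge0 ?(ltW alpha0)//.
- by rewrite s0 (le_trans st).
- by rewrite (le_trans s0 st).
rewrite ler_wpM2l//; move: st; rewrite le_eqVlt => /predU1P[->//|st].
by apply/ltW; rewrite ltr_sin ?in_itv/=; [lra| |]; apply/andP; split; lra.
Qed.

Definition mult_weight (e eta d : R) (k : nat) : R :=
  mult_abs alpha (k%:R * eta) * cos (d + e * mult_arg alpha (k%:R * eta)).

(** For frequencies up to [1 / eta] the modulus of the multiplier increases and
    its phase is Lipschitz, so that both the size and the variation over a
    dyadic block are of order [(n * eta) ^ alpha]. *)
Lemma mult_weight_bounds (e eta d : R) (n : nat) : `|e| <= 1 -> 0 <= eta ->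
  (0 < n)%N -> n.*2%:R * eta <= 1 ->
  (forall k, (n <= k <= n.*2)%N ->
     `|mult_weight e eta d k| <= (n.*2%:R * eta) `^ alpha) /\
  dyadic_var (mult_weight e eta d) n <= (n.*2%:R * eta) `^ alpha * (1 + alpha).
Proof.
move=> e1 eta0 n0 neta.
have ke k : (k <= n.*2)%N -> 0 <= k%:R * eta <= 1.
  move=> kn; rewrite mulr_ge0//=; apply: le_trans neta.
  by rewrite ler_wpM2r// ler_nat.
have mle k : (k <= n.*2)%N ->
    mult_abs alpha (k%:R * eta) <= mult_abs alpha (n.*2%:R * eta).
  move=> kn; apply: mult_abs_mono => //.
  by rewrite mulr_ge0//= ler_wpM2r// ler_nat.
have mle2 := mult_abs_le (ke _ (leqnn _)).
set P := (n.*2%:R * eta) `^ alpha in mle2 *.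
have P0 : 0 <= P by exact: powR_ge0.
split=> [k /andP[_ kn]|].
  rewrite normrM (ger0_norm (mult_abs_ge0 _)) (le_trans _ mle2)//.
  rewrite (le_trans _ (mle _ kn))// ler_piMr ?mult_abs_ge0//; exact: cos_max.
apply: (@le_trans _ _ (\sum_(n <= k < n.*2)
  ((mult_abs alpha (k.+1%:R * eta) - mult_abs alpha (k%:R * eta)) +
   P * (alpha * eta)))).
  rewrite /dyadic_var !big_nat; apply: ler_sum => k /andP[nk kn].
  rewrite /mult_weight; set c1 := cos _; set c2 := cos _.
  set m1 := mult_abs _ (k%:R * eta); set m2 := mult_abs _ (k.+1%:R * eta).
  have m12 : m1 <= m2.
    apply: mult_abs_mono; last by have /andP[] := ke _ kn.
    by rewrite mulr_ge0//= ler_wpM2r// ler_nat.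
  have -> : m1 * c1 - m2 * c2 = - (c1 * (m2 - m1)) + m2 * (c1 - c2) by ring.
  rewrite (le_trans (ler_normD _ _))// normrN !normrM; apply: lerD.
    by rewrite (@ger0_norm _ (m2 - m1)) ?subr_ge0// ler_piMl ?subr_ge0//; exact: cos_max.
  apply: ler_pM => //; first by rewrite ger0_norm ?mult_abs_ge0// (le_trans (mle _ kn)).
  rewrite (le_trans (cos_lip _ _))//.
  have -> : d + e * mult_arg alpha (k%:R * eta) - (d + e * mult_arg alpha (k.+1%:R * eta)) =
      e * (- (alpha * eta / 2)).
    by rewrite /mult_arg -natr1; field.
  have ae : 0 <= alpha * eta by rewrite mulr_ge0 ?(ltW alpha0).
  rewrite normrM normrN (@ger0_norm _ (_ / 2)) ?divr_ge0//.
  by rewrite (@le_trans _ _ (alpha * eta / 2))// ?ler_piMl ?divr_ge0//; lra.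
rewrite big_split/= telescope_sumr; last by rewrite -addnn leq_addr.
rewrite sumr_const_nat -addnn addnK mulrDr mulr1 lerD//.
  by rewrite (le_trans _ mle2)// addnn gerBl mult_abs_ge0.
rewrite -[leLHS]mulr_natr -mulrA ler_wpM2l// -mulrA ler_piMr ?(ltW alpha0)//.
by rewrite mulrC; apply: le_trans neta; rewrite ler_wpM2r// ler_nat -addnn leq_addr.
Qed.

End Multiplier.
Lemma cvg_series_bigsum (I : eqType) (s : seq I) (F : I -> nat -> R) (l : I -> R) :
  (forall i, i \in s -> series (F i) @ \oo --> l i) ->
  series (fun j => \sum_(i <- s) F i j) @ \oo --> \sum_(i <- s) l i.
Proof.
elim: s => [_|i s IH h].
  rewrite big_nil (_ : series _ = cst 0); first exact: cvg_cst.
  by apply/funext => n; rewrite /series/= big1// => j _; rewrite big_nil.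
rewrite big_cons (_ : series _ = series (F i) + series (fun j => \sum_(i <- s) F i j)).
  apply: cvgD; first by apply: h; rewrite mem_head.
  by apply: IH => k ks; apply: h; rewrite inE ks orbT.
apply/funext => n; rewrite !fctE /series/= -big_split/=.
by apply: eq_bigr => j _; rewrite big_cons.
Qed.

Section PartialSums.
Variables (a b : nat -> R).

Definition fourier_term (k : nat) (x : R) : R :=
  a k * cos (k%:R * x) + b k * sin (k%:R * x).

Definition fourier_block (i : nat) (x : R) : R :=
  \sum_(2 ^ i <= k < (2 ^ i).*2) fourier_term k x.

Definition fourier_psum (m : nat) (x : R) : R :=
  \sum_(0 <= i < m) fourier_block i x.

Lemma dyadic_blocks (F : nat -> R) m :
  \sum_(0 <= i < m) \sum_(2 ^ i <= k < (2 ^ i).*2) F k = \sum_(1 <= k < 2 ^ m) F k.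
Proof.
elim: m => [|m IH]; first by rewrite !big_geq.
rewrite big_nat_recr//= IH expnS mul2n.
have h1 : (1 <= 2 ^ m)%N by rewrite expn_gt0.
have h2 : (2 ^ m <= (2 ^ m).*2)%N by rewrite -addnn leq_addr.
by rewrite (big_cat_nat h1 h2).
Qed.

Lemma fourier_psumE m x : fourier_psum m x = \sum_(1 <= k < 2 ^ m) fourier_term k x.
Proof. exact: dyadic_blocks. Qed.

Lemma fourier_term_per k x : fourier_term k (x + pi *+ 2) = fourier_term k x.
Proof.
rewrite /fourier_term.
have -> : k%:R * (x + pi *+ 2) = k%:R * x + pi *+ 2 *+ k by rewrite mulrDr [k%:R * (pi *+ 2)]mulr_natl.
by rewrite (periodicn (@cosD2pi R)) (periodicn (@sinD2pi R)).
Qed.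

Lemma fourier_psum_per m x : fourier_psum m (x + pi *+ 2) = fourier_psum m x.
Proof. by rewrite !fourier_psumE; apply: eq_bigr => k _; exact: fourier_term_per. Qed.

Lemma fourier_termE k x : fourier_term k x =
  a k * cos (k%:R * x + 0) + b k * cos (k%:R * x + - (pi / 2)).
Proof. by rewrite addr0 cosBpihalf. Qed.

Lemma bmeas_fourier_block i : bmeas (fourier_block i).
Proof.
apply: bmeas_sum => k; rewrite (_ : fourier_term k = fun x =>
  a k * cos (k%:R * x + 0) + b k * cos (k%:R * x + - (pi / 2))); last first.
  by apply/funext => x; exact: fourier_termE.
by apply: bmeasD; apply: bmeasZ; exact: bmeas_cos.
Qed.

Lemma bmeas_fourier_psum m : bmeas (fourier_psum m).
Proof. by apply: bmeas_sum => i; exact: bmeas_fourier_block. Qed.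

Variables (C : R).
Hypothesis C0 : 0 < C.
Hypothesis a0 : forall n, (0 < n)%N -> 0 <= a n.
Hypothesis b0 : forall n, (0 < n)%N -> 0 <= b n.
Hypothesis gma : gm_with C a.
Hypothesis gmb : gm_with C b.

Definition coef (i : nat) : R := a (2 ^ i)%N + b (2 ^ i)%N.

Lemma coef_ge0 i : 0 <= coef i.
Proof. by rewrite addr_ge0 ?a0 ?b0 ?expn_gt0. Qed.

Lemma fourier_block_le i j x : shell j x ->
  `|fourier_block i x| <= 32 * (1 + C) * coef i * 2 ^+ minn i j.
Proof.
move=> sx; rewrite /fourier_block.
under eq_bigr do rewrite fourier_termE.
rewrite big_split/= (le_trans (ler_normD _ _))//.
have one (k : nat) : (2 ^ i <= k <= (2 ^ i).*2)%N -> `|1 : R| <= 1 by rewrite normr1.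
have v0 : dyadic_var (fun=> 1 : R) (2 ^ i) <= 0.
  by rewrite /dyadic_var big1// => k _; rewrite subrr normr0.
have ha := @gm_block C a C0 a0 gma (fun=> 1) 1 0 i j x 0 sx ler01 (lexx _) _ v0.
have hb := @gm_block C b C0 b0 gmb (fun=> 1) 1 0 i j x (- (pi / 2)) sx ler01 (lexx _) _ v0.
have {}ha := ha one; have {}hb := hb one.
rewrite [leRHS](_ : _ = 32 * (1 + C) * (1 + 0) * a (2 ^ i)%N * 2 ^+ minn i j +
   32 * (1 + C) * (1 + 0) * b (2 ^ i)%N * 2 ^+ minn i j); last by rewrite /coef; ring.
have e (c : nat -> R) d : \sum_(2 ^ i <= k < (2 ^ i).*2) c k * cos (k%:R * x + d) =
    \sum_(2 ^ i <= k < (2 ^ i).*2) c k * 1 * cos (k%:R * x + d).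
  by apply: eq_bigr => k _; rewrite mulr1.
by rewrite (e a) (e b); apply: lerD.
Qed.

Variable alpha : R.
Hypothesis alpha0 : 0 < alpha.

Definition diff_term (h : R) (k : nat) (x : R) : R :=
  a k * (mult_abs alpha (k%:R * `|h|) *
    cos (k%:R * x + 0 + (-1) ^+ (h < 0)%R * mult_arg alpha (k%:R * `|h|))) +
  b k * (mult_abs alpha (k%:R * `|h|) *
    cos (k%:R * x + - (pi / 2) + (-1) ^+ (h < 0)%R * mult_arg alpha (k%:R * `|h|))).

Lemma cvg_frac_diff_psum h m x : (2 ^ m)%:R * `|h| <= 1 ->
  series (fun j => bcoef alpha j * fourier_psum m (x + (alpha - j%:R) * h)) @ \oo -->
  \sum_(0 <= i < m) \sum_(2 ^ i <= k < (2 ^ i).*2) diff_term h k x.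
Proof.
move=> mh; rewrite dyadic_blocks.
under [X in series X]eq_fun do rewrite fourier_psumE mulr_sumr.
apply: cvg_series_bigsum => k; rewrite mem_index_iota => /andP[k0 km].
have kh : k%:R * `|h| <= pi.
  apply: le_trans (_ : (2 ^ m)%:R * `|h| <= _).
    by rewrite ler_wpM2r// ler_nat ltnW.
  by have := pi_ge2 R; lra.
have ca := @cvg_frac_diff_cos _ alpha alpha0 h k%:R 0 x (ler0n _ _) kh.
have cb := @cvg_frac_diff_cos _ alpha alpha0 h k%:R (- (pi / 2)) x (ler0n _ _) kh.
rewrite (_ : series _ =
  a k \*: series (fun j => bcoef alpha j * cos (k%:R * (x + (alpha - j%:R) * h) + 0)) +
  b k \*: series (fun j => bcoef alpha j *
     cos (k%:R * (x + (alpha - j%:R) * h) + - (pi / 2)))).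
  by apply: cvgD; apply: cvgZr.
apply/funext => n; rewrite !fctE /series/= /GRing.scale/= !mulr_sumr -big_split/=.
by apply: eq_bigr => j _; rewrite fourier_termE; ring.
Qed.

(** The difference of a block is again a sum of blocks: expanding the cosine of
    the shifted phase separates a weight depending on the frequency only from a
    pure cosine, and [gm_block] applies to each product. *)
Lemma diff_block_le h i j x : shell j x -> (2 ^ i.+1)%:R * `|h| <= 1 ->
  `|\sum_(2 ^ i <= k < (2 ^ i).*2) diff_term h k x| <=
  64 * (1 + C) * (2 + alpha) * 2 `^ alpha *
  ((2 ^ i)%:R * `|h|) `^ alpha * coef i * 2 ^+ minn i j.
Proof.
move=> sx ih; set e := (-1) ^+ (h < 0)%R : R; set eta := `|h|.
have e1 : `|e| <= 1 by rewrite normrX normrN1 expr1n.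
have n0 : (0 < 2 ^ i)%N by rewrite expn_gt0.
have ih' : ((2 ^ i).*2)%:R * eta <= 1 by rewrite -mul2n -expnS.
pose w d := mult_weight alpha e eta d.
have tE k : diff_term h k x =
  (a k * w 0 k * cos (k%:R * x + 0) + a k * w (- (pi / 2)) k * cos (k%:R * x + pi / 2)) +
  (b k * w 0 k * cos (k%:R * x + - (pi / 2)) + b k * w (- (pi / 2)) k * cos (k%:R * x + 0)).
  rewrite /diff_term /w /mult_weight -/e -/eta.
  set P := e * _; rewrite !add0r !addr0.
  have -> : - (pi / 2) + P = P - pi / 2 by rewrite addrC.
  rewrite !cosBpihalf cosDpihalf.
  have -> : k%:R * x - pi / 2 + P = (k%:R * x + P) - pi / 2 by rewrite addrAC.
  by rewrite cosBpihalf cosD sinD; ring.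
under eq_bigr do rewrite tE.
rewrite !big_split/=.
set P := (((2 ^ i).*2)%:R * eta) `^ alpha.
have P0 : 0 <= P by exact: powR_ge0.
have PV0 : 0 <= P * (1 + alpha) by rewrite mulr_ge0// addr_ge0// ltW.
have wb d := @mult_weight_bounds alpha alpha0 e eta d _ e1 (normr_ge0 _) n0 ih'.
have ha d d' := @gm_block C a C0 a0 gma (w d) P (P * (1 + alpha)) i j x d' sx P0 PV0
  (wb d).1 (wb d).2.
have hb d d' := @gm_block C b C0 b0 gmb (w d) P (P * (1 + alpha)) i j x d' sx P0 PV0
  (wb d).1 (wb d).2.
have -> : 64 * (1 + C) * (2 + alpha) * 2 `^ alpha * ((2 ^ i)%:R * `|h|) `^ alpha *
    coef i * 2 ^+ minn i j =
  (32 * (1 + C) * (P + P * (1 + alpha)) * a (2 ^ i)%N * 2 ^+ minn i j +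
   32 * (1 + C) * (P + P * (1 + alpha)) * a (2 ^ i)%N * 2 ^+ minn i j) +
  (32 * (1 + C) * (P + P * (1 + alpha)) * b (2 ^ i)%N * 2 ^+ minn i j +
   32 * (1 + C) * (P + P * (1 + alpha)) * b (2 ^ i)%N * 2 ^+ minn i j).
  have -> : P = 2 `^ alpha * ((2 ^ i)%:R * `|h|) `^ alpha.
    by rewrite /P -powRM// ?mulr_ge0// mulrA -mul2n natrM.
  by rewrite /coef; ring.
rewrite (le_trans (ler_normD _ _))//; apply: lerD.
  by rewrite (le_trans (ler_normD _ _))//; apply: lerD; exact: ha.
by rewrite (le_trans (ler_normD _ _))//; apply: lerD; exact: hb.
Qed.

End PartialSums.
End Blocks.

(** * Reconstruction of the function from its dyadic blocks *)

Section Orthogonality.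
Context {R : realType}.
Local Notation mu := (@lebesgue_measure R).
Local Notation T2 := (pi *+ 2 : R).

Lemma lebesgue_torus : mu (torus : set R) = T2%:E.
Proof.
have p0 := pi_gt0 R.
have := @lebesgue_measure_itv R `[- pi, pi]; rewrite /= lte_fin ifT ?gtrN//.
by rewrite -EFinD opprK -mulr2n.
Qed.

Lemma bmeas_integrable (w : R -> R) : bmeas w -> mu.-integrable torus (EFin \o w).
Proof.
move=> [mw [M wM]].
have mT : measurable (torus : set (measurableTypeR R)) by exact: measurable_torus.
apply: measurable_bounded_integrable => //.
- by rewrite [X in (X < _)%E]lebesgue_torus ltry.
- exact: measurable_funTS.
by exists `|M|; split=> // N MN x _ /=; rewrite (le_trans (wM x))// (le_trans (ler_norm _))// ltW.
Qed.

Lemma cos_per_nat k (d x : R) : cos (k%:R * (x + T2) + d) = cos (k%:R * x + d).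
Proof.
rewrite mulrDr [k%:R * (pi *+ 2)]mulr_natl addrAC.
by rewrite (periodicn (@cosD2pi R)).
Qed.

(** Translation by half a wave length turns the cosine into its opposite. *)
Lemma pairing1_cos k (d : R) : (0 < k)%N ->
  pairing (fun=> 1) (fun x => cos (k%:R * x + d)) = 0.
Proof.
move=> k0; have kn : k%:R != 0 :> R by rewrite pnatr_eq0 -lt0n.
pose s := pi / k%:R : R.
pose F (e : R) x := 1 + e * cos (k%:R * x + d).
have bF e : bmeas (F e).
  by apply: bmeasD; [exact: bmeas_cst|apply: bmeasZ; exact: bmeas_cos].
have F0 e x : `|e| <= 1 -> 0 <= F e x.
  move=> e1; have : `|e * cos (k%:R * x + d)| <= 1.
    by rewrite normrM mulr_ile1// cos_max.
  by rewrite ler_norml /F => /andP[? _]; lra.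
have sh x : F 1 (x + s) = F (- 1) x.
  rewrite /F mulrDr (_ : k%:R * s = pi); last by rewrite /s mulrCA mulfV ?mulr1.
  by rewrite addrAC cosDpi; ring.
have i1 : mu.-integrable torus (EFin \o (fun=> 1 : R)) by apply/bmeas_integrable/bmeas_cst.
have eF : pairing (fun=> 1) (F (- 1)) = pairing (fun=> 1) (F 1).
  rewrite /pairing /Rintegral; congr fine.
  under eq_integral do rewrite mul1r.
  under [RHS]eq_integral do rewrite mul1r.
  rewrite -(@periodic_integral_shift R s (fun x => (F 1 x)%:E)).
  - by apply: eq_integral => x _; rewrite sh.
  - by move=> x; rewrite /F cos_per_nat.
  - by apply/measurable_EFinP; have [] := bF 1.
  - by move=> x; rewrite lee_fin F0// normr1.
have bc e : bmeas (fun x => e * cos (k%:R * x + d)) by apply: bmeasZ; exact: bmeas_cos.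
move: eF; rewrite /F !pairingD//; [|exact: bmeas_cst..].
rewrite !pairingZ//; [|exact: bmeas_cos..].
by move/addrI; lra.
Qed.

Lemma pairing1_cst (c : R) : pairing (fun=> 1) (fun=> c) = c * T2.
Proof.
have mT : measurable (torus : set (measurableTypeR R)) by exact: measurable_torus.
rewrite /pairing (_ : (fun=> 1 * c) = fun=> c); last by apply/funext => x; rewrite mul1r.
by rewrite (Rintegral_cst _ mT) [X in fine X]lebesgue_torus.
Qed.

Lemma cos_cosE (u v : R) : cos u * cos v = 2^-1 * cos (u - v) + 2^-1 * cos (u + v).
Proof. by rewrite cosB cosD; field. Qed.

Lemma trig_ortho (k l : nat) (d e : R) : (0 < k)%N ->
  pairing (fun x => cos (k%:R * x + d)) (fun x => cos (l%:R * x + e)) =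
  if k == l then pi * cos (d - e) else 0.
Proof.
move=> k0.
have i1 : mu.-integrable torus (EFin \o (fun=> 1 : R)) by apply/bmeas_integrable/bmeas_cst.
pose v x := cos ((k%:R - l%:R) * x + (d - e)).
pose w x := cos ((k + l)%:R * x + (d + e)).
have -> : pairing (fun x => cos (k%:R * x + d)) (fun x => cos (l%:R * x + e)) =
   pairing (fun=> 1) (fun x => 2^-1 * v x + 2^-1 * w x).
  apply: eq_Rintegral => x _; rewrite mul1r cos_cosE /v /w natrD.
  by congr (_ * cos _ + _ * cos _); ring.
rewrite pairingD ?pairingZ//; do ?[exact: bmeas_cos|by apply: bmeasZ; exact: bmeas_cos].
rewrite [pairing _ w]pairing1_cos ?addn_gt0 ?k0// mulr0 addr0.
case: (ltngtP k l) => [kl|lk|kl].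
- rewrite (_ : v = fun x => cos ((l - k)%:R * x + (e - d))).
    by rewrite pairing1_cos ?subn_gt0// mulr0.
  by apply/funext => x; rewrite /v -cosN natrB ?(ltnW kl)//; congr cos; ring.
- rewrite (_ : v = fun x => cos ((k - l)%:R * x + (d - e))).
    by rewrite pairing1_cos ?subn_gt0// mulr0.
  by apply/funext => x; rewrite /v natrB ?(ltnW lk).
rewrite (_ : v = fun=> cos (d - e)); last by apply/funext => x; rewrite /v kl subrr mul0r add0r.
by rewrite pairing1_cst; field.
Qed.

Lemma pairingC (u v : R -> R) : pairing u v = pairing v u.
Proof. by apply: eq_Rintegral => x _; rewrite mulrC. Qed.

Lemma pairing_psum (a b : nat -> R) m l (e : R) : (l < 2 ^ m)%N ->
  pairing (fourier_psum a b m) (fun x => cos (l%:R * x + e)) =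
  if (0 < l)%N then pi * (a l * cos e - b l * sin e) else 0.
Proof.
move=> lm; have ic : mu.-integrable torus (EFin \o (fun x => cos (l%:R * x + e))).
  by apply/bmeas_integrable/bmeas_cos.
have bt k : bmeas (fourier_term a b k).
  rewrite (_ : fourier_term a b k = fun x =>
    a k * cos (k%:R * x + 0) + b k * cos (k%:R * x + - (pi / 2))); last first.
    by apply/funext => x; exact: fourier_termE.
  by apply: bmeasD; apply: bmeasZ; exact: bmeas_cos.
rewrite pairingC (_ : fourier_psum a b m =
  fun x => \sum_(1 <= k < 2 ^ m) fourier_term a b k x); last first.
  by apply/funext => x; exact: fourier_psumE.
rewrite (pairing_sum ic)//.
have term k : (0 < k)%N ->
    pairing (fun x => cos (l%:R * x + e)) (fourier_term a b k) =
    if k == l then pi * (a l * cos e - b l * sin e) else 0.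
  move=> k0.
  rewrite (_ : fourier_term a b k = fun x =>
    a k * cos (k%:R * x + 0) + b k * cos (k%:R * x + - (pi / 2))); last first.
    by apply/funext => x; exact: fourier_termE.
  rewrite (pairingD ic); do ?[by apply: bmeasZ; exact: bmeas_cos].
  rewrite !(pairingZ ic); do ?[exact: bmeas_cos].
  rewrite ![pairing (fun x => cos (l%:R * x + e)) _]pairingC !trig_ortho//.
  case: eqP => [->|_]; last by rewrite !mulr0 addr0.
  rewrite sub0r cosN (_ : - (pi / 2) - e = - (e + pi / 2)); last by ring.
  by rewrite cosN cosDpihalf; ring.
rewrite big_nat (eq_bigr (fun k => if k == l then pi * (a l * cos e - b l * sin e) else 0)); last first.
  by move=> k /andP[k0 _]; exact: term.
rewrite -big_mkcondr/=; case: ifP => l0; last first.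
  rewrite big1// => k /andP[/andP[k0 _]] /eqP kl.
  by rewrite kl l0 in k0.
under eq_bigl do rewrite andbC.
rewrite big_mkcond/= (bigD1_seq l) ?mem_index_iota ?iota_uniq ?l0//=.
  rewrite eqxx lm/= big1 ?addr0// => k kl.
  by rewrite (negbTE kl).
Qed.

Lemma pairing_fourier (f : R -> R) (a b : nat -> R) l (e : R) :
  mu.-integrable torus (EFin \o f) -> has_fourier_series f a b ->
  pairing f (fun x => cos (l%:R * x + e)) =
  if (0 < l)%N then pi * (a l * cos e - b l * sin e) else 0.
Proof.
move=> intf [f0 fS].
have bC n : bmeas (fun x : R => cos (n%:R * x)).
  by have := bmeas_cos n%:R (0 : R); under eq_fun do rewrite addr0.
have bS n : bmeas (fun x : R => sin (n%:R * x)).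
  by have := bmeas_cos n%:R (- (pi / 2) : R); under eq_fun do rewrite cosBpihalf.
have -> : (fun x => cos (l%:R * x + e)) =
    fun x => cos e * cos (l%:R * x) + (- sin e) * sin (l%:R * x).
  by apply/funext => x; rewrite cosD; ring.
have pn : pi != 0 :> R by rewrite gt_eqF// pi_gt0.
have eC n : pairing f (fun x => cos (n%:R * x)) = pi * fourier_cos f n.
  by rewrite /fourier_cos mulrA mulfV// mul1r.
have eS n : pairing f (fun x => sin (n%:R * x)) = pi * fourier_sin f n.
  by rewrite /fourier_sin mulrA mulfV// mul1r.
rewrite (pairingD intf); do ?[by apply: bmeasZ].
rewrite !(pairingZ intf)// eC eS; case: ifP => [l0|/negbT].
  by have [-> ->] := fS l l0; ring.
rewrite -eqn0Ngt => /eqP->; rewrite f0.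
rewrite (_ : fourier_sin f 0 = 0) ?mulr0 ?addr0//.
rewrite /fourier_sin (_ : (fun x => f x * sin (0%:R * x)) = fun=> 0).
  by rewrite /Rintegral integral0 mulr0.
by apply/funext => x; rewrite mul0r sin0 mulr0.
Qed.

End Orthogonality.

Section Domination.
Context {R : realType}.
Local Notation mu := (@lebesgue_measure R).

Lemma poweRD_le (p : R) (x y : \bar R) : 0 <= p -> (0 <= x)%E -> (0 <= y)%E ->
  ((x + y) `^ p <= (2 `^ p)%:E * (x `^ p + y `^ p))%E.
Proof.
move=> p0.
have h (u v : \bar R) : (0 <= u)%E -> (0 <= v)%E -> (u <= v)%E ->
    ((u + v) `^ p <= (2 `^ p)%:E * (u `^ p + v `^ p))%E.
  move=> u0 v0 uv; apply: (@le_trans _ _ ((2%:E * v) `^ p)%E).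
    apply: le_poweR => //; first by rewrite adde_ge0.
    by rewrite mule_natl mule2n leeD2r.
  rewrite poweRM ?lee_fin// poweR_EFin lee_wpmul2l ?lee_fin ?powR_ge0//.
  by rewrite leeDr// poweR_ge0.
move=> x0 y0; have [xy|/ltW yx] := leP x y; first exact: h.
by rewrite addeC [X in (_ * X)%E]addeC; exact: h.
Qed.

Lemma le_1poweR (p : R) (x : \bar R) : 1 <= p -> (0 <= x)%E -> (x <= 1 + x `^ p)%E.
Proof.
move=> p1 x0; have [x1|/ltW x1] := leP x 1%E.
  by rewrite (le_trans x1)// leeDl// poweR_ge0.
case: x x0 x1 => [x x0 x1| |//]; last first.
  by move=> _ _; rewrite poweRyr ?gt_eqF ?(lt_le_trans ltr01)// addey.
rewrite poweR_EFin -EFinD lee_fin; rewrite lee_fin in x0 x1.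
by rewrite (@le_trans _ _ (x `^ p)) ?lerDr//; apply: le1r_powR.
Qed.

(** On a set of finite measure [G <= 1 + G ^ p] suffices. *)
Lemma integrable_of_Lp (p : R) (G : R -> \bar R) : 1 <= p ->
  measurable_fun torus G -> (forall x, 0 <= G x)%E ->
  (\int[mu]_(x in torus) (G x `^ p) < +oo)%E -> mu.-integrable torus G.
Proof.
move=> p1 mG G0 Goo; apply/integrableP; split => //.
under eq_integral do rewrite gee0_abs//.
apply: (@le_lt_trans _ _ (\int[mu]_(x in torus) (cst 1 x + G x `^ p))%E).
  by apply: ge0_le_integral_any => // x _; exact: le_1poweR.
rewrite ge0_integralD; last 5 first.
- exact: measurable_torus.
- by [].
- by [].
- by move=> x _; exact: poweR_ge0.
- exact: (measurableT_comp (measurable_poweR p)).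
rewrite integral_cst; last exact: measurable_torus.
by rewrite mul1e [X in (X + _ < _)%E]lebesgue_torus lte_add_pinfty// ltry.
Qed.

(** The upper limit is measurable, whereas the limit operator has an arbitrary
    value at the points of divergence. *)
Lemma measurable_limit (s : nat -> R -> R) : (forall n, measurable_fun setT (s n)) ->
  exists2 g : R -> R, measurable_fun setT g &
    forall x, cvgn (s ^~ x) -> s ^~ x @ \oo --> g x.
Proof.
move=> ms; pose G x := limn_esup (fun n => (s n x)%:E).
exists (fine \o G).
  apply: (measurableT_comp (@fine_measurable R setT measurableT)).
  by apply: measurable_fun_limn_esup => n; apply/measurable_EFinP.
move=> x /cvg_ex[l xl]; rewrite /= (_ : G x = l%:E)//.
have xl' : (fun n => (s n x)%:E) @ \oo --> l%:E by apply: cvg_EFin => //; exact: nearW.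
by rewrite /G is_cvg_limn_esupE; [exact: cvg_lim|apply/cvg_ex; exists l%:E].
Qed.

Lemma pairing_cvg_dominated (s : nat -> R -> R) (g : R -> R) (G : R -> \bar R) :
  (forall n, measurable_fun setT (s n)) -> measurable_fun setT g ->
  {ae mu, forall x, torus x -> s ^~ x @ \oo --> g x} ->
  mu.-integrable torus G -> (forall n x, (`|s n x|%:E <= G x)%E) ->
  mu.-integrable torus (EFin \o g) /\
  forall w, bmeas w -> pairing (s n) w @[n --> \oo] --> pairing g w.
Proof.
move=> ms mg sg iG sG.
have dom w : bmeas w -> mu.-integrable torus (EFin \o (fun x => g x * w x)) /\
    pairing (s n) w @[n --> \oo] --> pairing g w.
  move=> bw; have [mw [M wM]] := bw.
  have M0 : 0 <= M by rewrite (le_trans _ (wM 0)).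
  have := @dominated_convergence _ _ R mu torus measurable_torus
    (fun n x => (s n x * w x)%:E) (fun x => (g x * w x)%:E)
    (fun x => (M%:E * G x)%E).
  case.
  - by move=> n; apply/measurable_EFinP; apply: measurable_funM; apply: measurable_funTS; [exact: ms|exact: mw].
  - by apply/measurable_EFinP; apply: measurable_funM; apply: measurable_funTS; [exact: mg|exact: mw].
  - apply: filterS sg; first exact: (ae_filter_ringOfSetsType mu).
    move=> x sx Dx; apply: cvg_EFin; first by apply: nearW.
    by apply: cvgMl; exact: sx.
  - by apply: integrableZl; [exact: measurable_torus|].
  - apply: aeW => x n _ /=; rewrite normrM EFinM muleC.
    by apply: lee_pmul => //; rewrite lee_fin.
  move=> ig _ cv; split => //.
  apply: fine_cvg; rewrite fineK; last first.
    by apply: integrable_fin_num => //; exact: measurable_torus.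
  exact: cv.
split=> [|w bw]; last by have [] := dom _ bw.
have [h _] := dom _ (bmeas_cst 1); apply: eq_integrable h; first exact: measurable_torus.
by move=> x _ /=; rewrite mulr1.
Qed.

Lemma torus_weighted_bound (p c : R) : 1 < p -> 0 < c -> exists2 K : R, 0 < K &
  forall (G : R -> \bar R) (u : nat -> R), measurable_fun torus G ->
  (forall x, 0 <= G x)%E -> (forall i, 0 <= u i) ->
  (forall j x, shell j x -> (G x <= \sum_(i <oo) (c * u i * 2 ^+ minn i j)%:E)%E) ->
  (\int[mu]_(x in torus) (G x `^ p) <=
   K%:E * \sum_(i <oo) ((pow2 (1 - p^-1) ^+ i * u i) `^ p)%:E)%E.
Proof.
move=> p1 c0; have [K K0 HK] := @torus_dyadic_bound R p p1.
exists (K * c `^ p); first by rewrite mulr_gt0// powR_gt0.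
move=> G u mG G0 u0 Gu.
have d0 i : 0 <= pow2 (1 - p^-1) ^+ i :> R by rewrite exprn_ge0// powR_ge0.
apply: le_trans (HK G (fun i => c * u i) mG G0 _ Gu) _.
  by move=> i; rewrite mulr_ge0// ltW.
rewrite EFinM -muleA lee_wpmul2l ?lee_fin ?(ltW K0)//.
rewrite -nneseriesZl; last by move=> i _; rewrite lee_fin powR_ge0.
apply: lee_nneseries => [i _ _|i _]; first by rewrite lee_fin powR_ge0.
by rewrite -EFinM lee_fin mulrCA [leLHS]powRM ?(ltW c0)// mulr_ge0.
Qed.

End Domination.

Section Reconstruction.
Context {R : realType}.
Local Notation mu := (@lebesgue_measure R).
Variables (p C : R).
Hypothesis p1 : 1 < p.
Hypothesis C0 : 0 < C.

(** Up to a constant this bounds the [L_p] norm of the block of index [i], and it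
    is the quantity [X i] of [torus_dyadic_bound]. *)
Definition block_size (a b : nat -> R) (i : nat) : R :=
  pow2 (1 - p^-1) ^+ i * coef a b i.

Definition block_tail (a b : nat -> R) (m : nat) (x : R) : \bar R :=
  (\sum_(i <oo) ((m <= i)%:R * `|fourier_block a b i x|)%:E)%E.

Lemma block_tail_ge0 a b m x : (0 <= block_tail a b m x)%E.
Proof. by apply: nneseries_ge0 => i _ _; rewrite lee_fin mulr_ge0. Qed.

Lemma measurable_block_tail a b m : measurable_fun setT (block_tail a b m).
Proof.
apply: ge0_emeasurable_sum => [i x _ _|i _]; first by rewrite lee_fin mulr_ge0.
have [mb _] := bmeas_fourier_block a b i.
by apply/measurable_EFinP; apply: measurable_funM => //; exact: measurableT_comp.
Qed.

Lemma block_tail_Lp : exists2 K : R, 0 < K & forall a b : nat -> R,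
  (forall n, (0 < n)%N -> 0 <= a n) -> (forall n, (0 < n)%N -> 0 <= b n) ->
  gm_with C a -> gm_with C b -> forall m,
  (\int[mu]_(x in torus) (block_tail a b m x `^ p) <=
   K%:E * \sum_(i <oo) (((m <= i)%:R * block_size a b i) `^ p)%:E)%E.
Proof.
have c0 : 0 < 32 * (1 + C) by rewrite mulr_gt0// addr_gt0.
have [K K0 HK] := @torus_weighted_bound R p _ p1 c0; exists K => //.
move=> a b a0 b0 ga gb m.
have := HK (block_tail a b m) (fun i => (m <= i)%:R * coef a b i).
under eq_eseriesr do rewrite mulrCA.
apply.
- by apply: measurable_funTS; exact: measurable_block_tail.
- exact: block_tail_ge0.
- by move=> i; rewrite mulr_ge0// coef_ge0.
move=> j x sx; apply: lee_nneseries => [i _ _|i _]; first by rewrite lee_fin mulr_ge0.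
rewrite lee_fin mulrCA -mulrA ler_wpM2l//.
exact: fourier_block_le.
Qed.

Section Function.
Variables (f : R -> R) (a b : nat -> R).
Hypothesis intf : mu.-integrable torus (EFin \o f).
Hypothesis fS : has_fourier_series f a b.
Hypothesis a0 : forall n, (0 < n)%N -> 0 <= a n.
Hypothesis b0 : forall n, (0 < n)%N -> 0 <= b n.
Hypothesis gma : gm_with C a.
Hypothesis gmb : gm_with C b.
Hypothesis fin : (\sum_(i <oo) (block_size a b i `^ p)%:E < +oo)%E.

Lemma integrable_block_tail : mu.-integrable torus (block_tail a b 0).
Proof.
have [K K0 HK] := block_tail_Lp.
apply: (@integrable_of_Lp _ p); [exact: ltW| | |].
- by apply: measurable_funTS; exact: measurable_block_tail.
- exact: block_tail_ge0.
apply: le_lt_trans (HK a b a0 b0 gma gmb 0%N) _.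
by under eq_eseriesr do rewrite leq0n mul1r; rewrite lte_mul_pinfty ?lee_fin ?(ltW K0).
Qed.

Lemma block_tail_fin x : (block_tail a b 0 x < +oo)%E ->
  cvgn (series (fun i => `|fourier_block a b i x|)).
Proof.
move=> fx; apply/nnseries_is_cvg => //.
by move: fx; rewrite /block_tail; under eq_eseriesr do rewrite mul1r.
Qed.

Lemma psum_le_tail n m x : (m <= n)%N ->
  (`|fourier_psum a b n x - fourier_psum a b m x|%:E <= block_tail a b m x)%E.
Proof.
move=> mn; rewrite /fourier_psum (big_cat_nat (leq0n m) mn)/= [X in `|X|]addrC addKr.
apply: (@le_trans _ _ (\sum_(0 <= i < n) ((m <= i)%:R * `|fourier_block a b i x|)%:E)%E).
  rewrite sumEFin lee_fin (le_trans (ler_norm_sum _ _ _))//.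
  rewrite [leRHS](big_cat_nat (leq0n m) mn)/= -[leLHS]add0r lerD//.
    by apply: sumr_ge0 => i _; rewrite mulr_ge0.
  by rewrite !big_nat; apply: ler_sum => i /andP[-> _]; rewrite mul1r.
by apply: nneseries_lim_ge => i _ _; rewrite lee_fin mulr_ge0.
Qed.

(** The partial sums are dominated by the integrable tail of index zero, so their
    sum has the same Fourier coefficients as [f] and equals it almost everywhere
    by uniqueness. *)
Lemma fourier_psum_cvg_ae :
  {ae mu, forall x, torus x -> fourier_psum a b n x @[n --> \oo] --> f x}.
Proof.
have iD := integrable_block_tail.
have mT : measurable (torus : set (measurableTypeR R)) by exact: measurable_torus.
have ms n : measurable_fun setT (fourier_psum a b n).
  by have [] := bmeas_fourier_psum a b n.
have [g mg sg] := measurable_limit ms.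
have fe : {ae mu, forall x, torus x -> fourier_psum a b n x @[n --> \oo] --> g x}.
  have := integrable_ae mT iD.
  apply: filterS => x hx Dx; apply: sg.
  apply: (@normed_cvg R R (fun i => fourier_block a b i x)); apply: block_tail_fin.
  by rewrite ltey_eq hx.
have le0 n x : (`|fourier_psum a b n x|%:E <= block_tail a b 0 x)%E.
  have := @psum_le_tail n 0 x (leq0n _).
  by rewrite [fourier_psum a b 0 x]big_geq// subr0.
have [ig pg] := pairing_cvg_dominated ms mg fe iD le0.
have iu : mu.-integrable torus (EFin \o (fun x => f x - g x)).
  by have := integrableB mT intf ig.
have eqp l e : pairing (fun x => f x - g x) (fun x => cos (l%:R * x + e)) = 0.
  have bc := bmeas_cos l%:R (e : R).
  have -> : pairing (fun x => f x - g x) (fun x => cos (l%:R * x + e)) =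
    pairing f (fun x => cos (l%:R * x + e)) - pairing g (fun x => cos (l%:R * x + e)).
    rewrite -[RHS]RintegralB.
    - by apply: eq_Rintegral => x _; rewrite mulrBl.
    - exact: measurable_torus.
    - exact: integrable_pairing.
    - exact: integrable_pairing.
  apply/eqP; rewrite subr_eq0; apply/eqP.
  apply: (cvg_unique _ _ (pg _ bc)) => //.
  apply: cvg_near_cst; exists l => // n /= ln.
  rewrite pairing_psum; first by rewrite (pairing_fourier _ _ intf fS).
  by rewrite (leq_ltn_trans ln)// ltn_expl.
have u0 : {ae mu, forall x, torus x -> f x - g x = 0}.
  apply: fourier_uniqueness => // n.
    by rewrite -[RHS](eqp n 0); congr pairing; apply/funext => x; rewrite addr0.
  by rewrite -[RHS](eqp n (- (pi / 2))); congr pairing; apply/funext => x; rewrite cosBpihalf.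
apply: filterS2 u0 fe; first exact: (ae_filter_ringOfSetsType mu).
by move=> x hu hg Dx; have /eqP := hu Dx; rewrite subr_eq0 => /eqP->; exact: hg.
Qed.

Lemma fourier_tail_ae m : {ae mu, forall x, torus x ->
  (`|f x - fourier_psum a b m x|%:E <= block_tail a b m x)%E}.
Proof.
have := fourier_psum_cvg_ae; apply: filterS; first exact: (ae_filter_ringOfSetsType mu).
move=> x hx Dx; have {}hx := hx Dx.
have cv : `|fourier_psum a b n x - fourier_psum a b m x|%:E @[n --> \oo] -->
    `|f x - fourier_psum a b m x|%:E.
  apply: cvg_EFin; first exact: nearW.
  by apply: cvg_norm; apply: cvgB => //; exact: cvg_cst.
rewrite -(cvg_lim _ cv)//; apply: lime_le; first by apply/cvg_ex; eexists; exact: cv.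
by exists m => // n /= mn; exact: psum_le_tail.
Qed.

End Function.

Lemma fourier_tail_Lp : exists2 K : R, 0 < K &
  forall (f : R -> R) (a b : nat -> R), in_L1_torus f -> has_fourier_series f a b ->
  (forall n, (0 < n)%N -> 0 <= a n) -> (forall n, (0 < n)%N -> 0 <= b n) ->
  gm_with C a -> gm_with C b ->
  (\sum_(i <oo) (block_size a b i `^ p)%:E < +oo)%E -> forall m,
  (\int[mu]_(x in torus) (`|f x - fourier_psum a b m x|%:E `^ p) <=
   K%:E * \sum_(i <oo) (((m <= i)%:R * block_size a b i) `^ p)%:E)%E.
Proof.
have [K K0 HK] := block_tail_Lp; exists K => // f a b [_ intf] fS a0 b0 ga gb fin m.
apply: le_trans (HK a b a0 b0 ga gb m).
have mT : measurable (torus : set (measurableTypeR R)) by exact: measurable_torus.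
have mf : measurable_fun torus f by have /integrableP[/measurable_EFinP] := intf.
apply: ae_ge0_le_integral.
- exact: mT.
- by move=> x _; exact: poweR_ge0.
- apply: (measurableT_comp (measurable_poweR p)); apply/measurable_EFinP.
  apply: measurableT_comp => //; apply: measurable_funB => //.
  by apply: measurable_funTS; have [] := bmeas_fourier_psum a b m.
- by move=> x _; exact: poweR_ge0.
- apply: measurable_funTS; apply: (measurableT_comp (measurable_poweR p)).
  exact: measurable_block_tail.
have := fourier_tail_ae intf fS a0 b0 ga gb fin m.
apply: filterS; first exact: (ae_filter_ringOfSetsType mu).
move=> x hx Dx; apply: le_poweR; rewrite ?lee_fin ?(ltW (lt_trans ltr01 p1))//.
exact: hx.
Qed.

End Reconstruction.

(** * Upper estimate of the fractional differences *)

Section UpperEstimate.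
Context {R : realType}.
Local Notation mu := (@lebesgue_measure R).
Local Notation T2 := (pi *+ 2 : R).
Variables (p C alpha : R).
Hypothesis p1 : 1 < p.
Hypothesis C0 : 0 < C.
Hypothesis alpha0 : 0 < alpha.

Lemma bmeas_diff_term (a b : nat -> R) h k : bmeas (diff_term a b alpha h k).
Proof.
rewrite /diff_term; set M := mult_abs _ _; set A := mult_arg _ _.
have e d : bmeas (fun x : R => cos (k%:R * x + d + (-1) ^+ (h < 0)%R * A)).
  have := bmeas_cos k%:R (d + (-1) ^+ (h < 0)%R * A).
  by congr bmeas; apply/funext => x; rewrite addrA.
by apply: bmeasD; do 2 apply: bmeasZ; exact: e.
Qed.

Lemma frac_diff_psum (a b : nat -> R) h m : (2 ^ m)%:R * `|h| <= 1 ->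
  frac_diff alpha h (fourier_psum a b m) = fun x =>
  \sum_(0 <= i < m) \sum_(2 ^ i <= k < (2 ^ i).*2) diff_term a b alpha h k x.
Proof.
by move=> mh; apply/funext => x; apply/cvg_lim => //; exact: cvg_frac_diff_psum.
Qed.

Lemma bmeas_frac_diff_psum (a b : nat -> R) h m : (2 ^ m)%:R * `|h| <= 1 ->
  bmeas (frac_diff alpha h (fourier_psum a b m)).
Proof.
move=> mh; rewrite frac_diff_psum//.
by apply: bmeas_sum => i; apply: bmeas_sum => k; exact: bmeas_diff_term.
Qed.

Lemma measurable_abs_poweR (g : R -> R) (D : set R) : measurable_fun setT g ->
  measurable_fun D (fun x => `|g x|%:E `^ p)%E.
Proof.
move=> mg; apply: measurable_funTS; apply: (measurableT_comp (measurable_poweR p)).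
by apply/measurable_EFinP; exact: measurableT_comp.
Qed.

Lemma frac_diff_psum_Lp : exists2 K : R, 0 < K & forall a b : nat -> R,
  (forall n, (0 < n)%N -> 0 <= a n) -> (forall n, (0 < n)%N -> 0 <= b n) ->
  gm_with C a -> gm_with C b -> forall m h, (2 ^ m)%:R * `|h| <= 1 ->
  (\int[mu]_(x in torus) (`|frac_diff alpha h (fourier_psum a b m) x|%:E `^ p) <=
   K%:E * \sum_(i <oo) (((i < m)%:R * ((2 ^ i)%:R * `|h|) `^ alpha *
     block_size p a b i) `^ p)%:E)%E.
Proof.
have c0 : 0 < 64 * (1 + C) * (2 + alpha) * 2 `^ alpha.
  by rewrite !mulr_gt0 ?addr_gt0 ?powR_gt0.
have [K K0 HK] := @torus_weighted_bound R p _ p1 c0; exists K => //.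
move=> a b a0 b0 ga gb m h mh.
have co i := coef_ge0 a0 b0 i.
have := HK (fun x => `|frac_diff alpha h (fourier_psum a b m) x|%:E)
  (fun i => (i < m)%:R * ((2 ^ i)%:R * `|h|) `^ alpha * coef a b i).
under eq_eseriesr do rewrite mulrCA.
apply.
- apply: measurable_funTS; apply/measurable_EFinP; apply: measurableT_comp => //.
  by have [] := bmeas_frac_diff_psum a b mh.
- by move=> x; rewrite lee_fin.
- by move=> i; rewrite !mulr_ge0 ?powR_ge0.
move=> j x sx; rewrite frac_diff_psum//.
set c := _ * 2 `^ alpha.
pose t i := c * ((i < m)%:R * ((2 ^ i)%:R * `|h|) `^ alpha * coef a b i) * 2 ^+ minn i j.
have t0 i : 0 <= t i.
  rewrite /t; apply: mulr_ge0; last exact: exprn_ge0.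
  by apply: mulr_ge0; [exact: ltW|rewrite !mulr_ge0 ?powR_ge0].
apply: (@le_trans _ _ (\sum_(0 <= i < m) (t i)%:E)%E); last first.
  by apply: nneseries_lim_ge => i _ _; rewrite lee_fin t0.
rewrite sumEFin lee_fin (le_trans (ler_norm_sum _ _ _))// !big_nat.
apply: ler_sum => i /andP[_ im].
have ih : (2 ^ i.+1)%:R * `|h| <= 1.
  apply: le_trans mh; rewrite ler_wpM2r// ler_nat leq_exp2l//.
apply: le_trans (diff_block_le C0 a0 b0 ga gb alpha0 sx ih) _.
by rewrite /t im mul1r !mulrA.
Qed.

Lemma lower_freq_weight (h : R) m i : (2 ^ m)%:R * `|h| <= 1 -> (i < m)%N ->
  ((2 ^ i)%:R * `|h|) `^ alpha <= (pow2 alpha)^-1 ^+ (m - i).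
Proof.
move=> mh im.
have -> : (pow2 alpha)^-1 ^+ (m - i) = ((2 ^- (m - i)) : R) `^ alpha.
  rewrite /pow2 -exprVn powRX ?invr_ge0//; congr (_ ^+ _).
  by rewrite -[2^-1 in RHS]powR_inv1// -powRrM mulN1r powRN.
apply: ge0_ler_powR; rewrite ?nnegrE ?mulr_ge0 ?(ltW alpha0) ?invr_ge0 ?exprn_ge0//.
rewrite -[leRHS]mul1r ler_pdivlMr ?exprn_gt0// mulrAC -natrX -natrM -expnD.
by rewrite subnKC// ltnW.
Qed.

(** The series is cut at the frequency [2 ^ m], of order [1 / `|h|] in the
    applications: below it the multiplier gives the factor [(2 ^ i * `|h|) ^ alpha],
    above it the difference is bounded in [L_p] by the function itself. *)
Lemma frac_diff_upper : exists2 K : R, 0 < K &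
  forall (f : R -> R) (a b : nat -> R), in_L1_torus f -> has_fourier_series f a b ->
  (forall n, (0 < n)%N -> 0 <= a n) -> (forall n, (0 < n)%N -> 0 <= b n) ->
  gm_with C a -> gm_with C b -> forall m h, (2 ^ m)%:R * `|h| <= 1 ->
  (\int[mu]_(x in torus) (`|frac_diff alpha h f x|%:E `^ p) <=
   K%:E * \sum_(i <oo) (((pow2 alpha)^-1 ^+ (m - i) * block_size p a b i) `^ p)%:E)%E.
Proof.
have p0 : 0 <= p by rewrite ltW// (lt_trans ltr01).
have [K1 K10 HK1] := frac_diff_psum_Lp.
have [K2 K20 HK2] := @diff_majorant_Lp R alpha alpha0 p (ltW p1).
have [K3 K30 HK3] := @fourier_tail_Lp R p C p1 C0.
exists (2 `^ p * (K1 + K2 * K3)).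
  by rewrite mulr_gt0 ?powR_gt0 ?addr_gt0 ?mulr_gt0.
move=> f a b [perf intf] fS a0 b0 ga gb m h mh.
have mT : measurable (torus : set (measurableTypeR R)) by exact: measurable_torus.
set S := (\sum_(i <oo) _)%E.
have d1 : 1 < pow2 alpha by exact: pow2_gt1.
have di0 : 0 <= (pow2 alpha)^-1 by rewrite invr_ge0 ltW// (lt_trans ltr01).
have X0 i : 0 <= block_size p a b i.
  by rewrite mulr_ge0 ?exprn_ge0 ?powR_ge0 ?coef_ge0.
have le_weight (u v : R) i : 0 <= u -> u <= v ->
    (((u * block_size p a b i) `^ p)%:E <= ((v * block_size p a b i) `^ p)%:E)%E.
  move=> u0 uv; rewrite lee_fin; apply: ge0_ler_powR => //.
  - by rewrite nnegrE; exact: mulr_ge0.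
  - by rewrite nnegrE; apply: mulr_ge0 => //; exact: le_trans uv.
  - exact: ler_wpM2r.
have [Soo|] := eqVneq S +oo%E.
  rewrite Soo gt0_muley ?leey// lte_fin.
  by rewrite mulr_gt0 ?powR_gt0 ?addr_gt0 ?mulr_gt0.
rewrite -ltey => Sfin.
have fin : (\sum_(i <oo) (block_size p a b i `^ p)%:E < +oo)%E.
  apply: (@le_lt_trans _ _ (((pow2 alpha ^+ m) `^ p)%:E * S)%E); last first.
    by rewrite lte_mul_pinfty ?lee_fin ?powR_ge0.
  rewrite -nneseriesZl; last by move=> i _; rewrite lee_fin powR_ge0.
  apply: lee_nneseries => [i _ _|i _]; first by rewrite lee_fin powR_ge0.
  have dm0 : 0 <= pow2 alpha ^+ m by rewrite exprn_ge0// powR_ge0.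
  have t0 : 0 <= (pow2 alpha)^-1 ^+ (m - i) * block_size p a b i.
    by apply: mulr_ge0 => //; exact: exprn_ge0.
  rewrite -EFinM lee_fin -(powRM _ dm0 t0).
  apply: ge0_ler_powR; rewrite ?nnegrE//; first exact: mulr_ge0.
  rewrite mulrA ler_peMl// exprVn ler_pdivlMr ?exprn_gt0 ?(lt_trans ltr01)// mul1r.
  by rewrite ler_weXn2l ?(ltW d1)// leq_subr.
pose s := fourier_psum a b m.
have [ms [Ms sMs]] := bmeas_fourier_psum a b m.
have mf : measurable_fun setT f.
  apply: (@periodic_measurable R) => //.
  by have /integrableP[/measurable_EFinP] := intf.
have mfs : measurable_fun setT (fun y => f y - s y) by exact: measurable_funB.
pose M := diff_majorant alpha h (fun y => f y - s y).
have mM : measurable_fun setT M by exact: measurable_diff_majorant.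
have mD : measurable_fun setT (frac_diff alpha h s) by have [] := bmeas_frac_diff_psum a b mh.
have mMp : measurable_fun torus (fun x => M x `^ p)%E.
  by apply: measurable_funTS; exact: (measurableT_comp (measurable_poweR p)).
have mDp : measurable_fun torus (fun x => `|frac_diff alpha h s x|%:E `^ p)%E.
  exact: measurable_abs_poweR.
have ptw x : (`|frac_diff alpha h f x|%:E `^ p <=
   (2 `^ p)%:E * (`|frac_diff alpha h s x|%:E `^ p + M x `^ p))%E.
  apply: le_trans (poweRD_le p0 _ _); rewrite ?lee_fin ?diff_majorant_ge0//.
  apply: le_poweR; rewrite ?lee_fin//.
  apply: frac_diff_split_le; apply/cvg_ex; eexists; exact: cvg_frac_diff_psum.
apply: (@le_trans _ _ (\int[mu]_(x in torus)
   ((2 `^ p)%:E * (`|frac_diff alpha h s x|%:E `^ p + M x `^ p)))%E).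
  by apply: ge0_le_integral_any => x _; first exact: poweR_ge0.
rewrite ge0_integralZl; last 4 first.
- exact: mT.
- exact: emeasurable_funD.
- by move=> x _; rewrite adde_ge0 ?poweR_ge0.
- by rewrite lee_fin powR_ge0.
rewrite EFinM -muleA lee_wpmul2l ?lee_fin ?powR_ge0//.
rewrite ge0_integralD; last 5 first.
- exact: mT.
- by move=> x _; exact: poweR_ge0.
- exact: mDp.
- by move=> x _; exact: poweR_ge0.
- exact: mMp.
have S0 : (0 <= S)%E by apply: nneseries_ge0 => i _ _; rewrite lee_fin powR_ge0.
rewrite EFinD ge0_muleDl ?lee_fin ?(ltW K10) ?mulr_ge0 ?(ltW K20) ?(ltW K30)//.
apply: leeD.
  apply: le_trans (HK1 a b a0 b0 ga gb m h mh) _.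
  rewrite lee_wpmul2l ?lee_fin ?(ltW K10)//.
  apply: lee_nneseries => [i _ _|i _]; first by rewrite lee_fin powR_ge0.
  apply: le_weight; first by rewrite mulr_ge0// powR_ge0.
  case: ltnP => im; last by rewrite mul0r exprn_ge0.
  by rewrite mul1r lower_freq_weight.
have perfs x : f (x + T2) - s (x + T2) = f x - s x by rewrite perf /s fourier_psum_per.
apply: le_trans (HK2 h _ perfs mfs) _.
rewrite EFinM -muleA lee_wpmul2l ?lee_fin ?(ltW K20)//.
apply: le_trans (HK3 f a b (conj perf intf) fS a0 b0 ga gb fin m) _.
rewrite lee_wpmul2l ?lee_fin ?(ltW K30)//.
apply: lee_nneseries => [i _ _|i _]; first by rewrite lee_fin powR_ge0.
apply: le_weight => //; case: (leqP m i) => im; last by rewrite exprn_ge0.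
by rewrite (eqP im) expr0.
Qed.

Lemma function_upper : exists2 K : R, 0 < K &
  forall (f : R -> R) (a b : nat -> R), in_L1_torus f -> has_fourier_series f a b ->
  (forall n, (0 < n)%N -> 0 <= a n) -> (forall n, (0 < n)%N -> 0 <= b n) ->
  gm_with C a -> gm_with C b ->
  (\int[mu]_(x in torus) (`|f x|%:E `^ p) <=
   K%:E * \sum_(i <oo) (block_size p a b i `^ p)%:E)%E.
Proof.
have p0 : 0 <= p by rewrite ltW// (lt_trans ltr01).
have [K K0 HK] := @fourier_tail_Lp R p C p1 C0.
exists K => // f a b L1f fS a0 b0 ga gb; set S := (\sum_(i <oo) _)%E.
have [Soo|] := eqVneq S +oo%E; first by rewrite Soo gt0_muley ?leey// lte_fin.
rewrite -ltey => fin; have := HK f a b L1f fS a0 b0 ga gb fin 0%N.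
rewrite (eq_eseriesr (g := fun i => (block_size p a b i `^ p)%:E)); last first.
  by move=> i _; rewrite leq0n mul1r.
by under eq_integral do rewrite [fourier_psum a b 0 _]big_geq// subr0.
Qed.

End UpperEstimate.

(** * Lower estimate of the fractional differences *)

Section LebesgueNorms.
Context {R : realType}.
Local Notation mu := (@lebesgue_measure R).

Lemma Lnorm_restrict (p : R) (D : set R) (f : R -> R) : measurable D -> p != 0 ->
  ('N[mu]_(p%:E)[EFin \o (f \_ D)])%E =
  ((\int[mu]_(x in D) (`|f x|%:E `^ p)) `^ p^-1)%E.
Proof.
move=> mD p0; rewrite unlock /Lnorm; congr (_ `^ _)%E.
rewrite [RHS]integral_mkcond; apply: eq_integral => x _.
have [xD|xD] := boolP (x \in D); first by rewrite /= /patch xD.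
have -> : (EFin \o f \_ D) x = 0%E by rewrite /= /patch (negbTE xD).
by rewrite abse0 poweR0r// /patch (negbTE xD).
Qed.

(** Hoelder's inequality against the constant one. *)
Lemma hoelder_set (p c : R) (S : set R) (g : R -> R) : 1 < p -> 0 <= c ->
  measurable S -> (mu S <= c%:E)%E -> measurable_fun setT g ->
  (\int[mu]_(x in S) (`|g x|)%:E <=
   (c `^ (1 - p^-1))%:E * (\int[mu]_(x in S) (`|g x|%:E `^ p)) `^ p^-1)%E.
Proof.
move=> p1 c0 mS Sc mg; have p0 : 0 < p by rewrite (lt_trans ltr01).
have q0 : 0 < 1 - p^-1 by rewrite subr_gt0 invf_lt1.
have m1 : measurable_fun setT ((fun=> 1 : R) \_ S).
  by apply/(measurable_restrictT _ _).1 => //; exact: measurable_cst.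
have mgS : measurable_fun setT (g \_ S).
  by apply/(measurable_restrictT _ _).1 => //; exact: measurable_funTS.
have := @hoelder _ _ R mu (g \_ S) ((fun=> 1 : R) \_ S) p ((1 - p^-1)^-1) mgS m1 p0
  (ltac:(by rewrite invr_gt0)) (ltac:(by rewrite invrK addrC subrK)).
rewrite (@Lnorm_restrict (1 - p^-1)^-1) ?gt_eqF ?invr_gt0// Lnorm_restrict ?gt_eqF//.
rewrite Lnorm1 => h; rewrite muleC; apply: le_trans (le_trans h _).
  rewrite [X in (X <= _)%E]integral_mkcond le_eqVlt; apply/orP; left; apply/eqP.
  apply: eq_integral => x _; rewrite /patch /=.
  by case: ifP => _ //; rewrite ?mulr1 ?mul0r ?normr0.
apply: lee_wpmul2l; first exact: poweR_ge0.
under eq_integral do rewrite normr1 poweR_EFin powR1.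
rewrite integral_cst// mul1e invrK -poweR_EFin.
by apply: le_poweR => //; exact: ltW.
Qed.

End LebesgueNorms.

Section DiffPairing.
Context {R : realType}.
Local Notation mu := (@lebesgue_measure R).
Local Notation T2 := (pi *+ 2 : R).
Variable alpha : R.
Hypothesis alpha0 : 0 < alpha.

Lemma periodic_Rintegral_shift (s : R) (F : R -> R) :
  (forall x, F (x + T2) = F x) -> measurable_fun setT F ->
  \int[mu]_(x in torus) F (x + s) = \int[mu]_(x in torus) F x.
Proof.
move=> pF mF; congr fine; rewrite integralE [RHS]integralE.
have mE : measurable_fun setT (EFin \o F) by apply/measurable_EFinP.
congr (_ - _)%E.
  rewrite -(@periodic_integral_shift R s (EFin \o F)^\+%E)//.
  - by apply: eq_integral => x _; rewrite !(funeposE, funenegE).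
  - by move=> x; rewrite !funeposE /= pF.
  - exact: measurable_funepos.
rewrite -(@periodic_integral_shift R s (EFin \o F)^\-%E)//.
- by apply: eq_integral => x _; rewrite !(funeposE, funenegE).
- by move=> x; rewrite !funenegE /= pF.
- exact: measurable_funeneg.
Qed.

Lemma pairing_suml (w : R -> R) (c : nat -> R) (u : nat -> R -> R) n : bmeas w ->
  (forall j, mu.-integrable torus (EFin \o u j)) ->
  pairing (fun x => \sum_(0 <= j < n) c j * u j x) w =
  \sum_(0 <= j < n) c j * pairing (u j) w.
Proof.
move=> bw iu; have mT : measurable (torus : set (measurableTypeR R)) by exact: measurable_torus.
have S1 k : (fun x => \sum_(0 <= j < k.+1) c j * u j x) =
    fun x => \sum_(0 <= j < k) c j * u j x + c k * u k x.
  by apply/funext => x; rewrite big_nat_recr.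
have S0 : (fun x => \sum_(0 <= j < 0) c j * u j x) = fun=> 0.
  by apply/funext => x; rewrite big_nil.
have iS k : mu.-integrable torus (EFin \o (fun x => \sum_(0 <= j < k) c j * u j x)).
  elim: k => [|k IH]; first by rewrite S0; exact: integrable0.
  by rewrite S1; have := integrableD mT IH (integrableZl mT (c k) (iu k)).
elim: n => [|n IH].
  by rewrite S0 big_nil /pairing -[RHS](mul0r (pairing (fun=> 1) w)) -RintegralZl//;
    [apply: eq_Rintegral => x _; rewrite !mul0r|
     apply: integrable_pairing => //; exact: (bmeas_integrable (bmeas_cst 1))].
have i1 := integrable_pairing (iS n) bw.
have i2 : mu.-integrable torus (EFin \o (fun x => c n * (u n x * w x))).
  by have := integrableZl mT (c n) (integrable_pairing (iu n) bw).
have e : \int[mu]_(x in torus) (c n * (u n x * w x)) = c n * pairing (u n) w.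
  by rewrite RintegralZl//; exact: integrable_pairing.
rewrite S1 big_nat_recr//= -IH -e -RintegralD//.
by apply: eq_Rintegral => x _; rewrite mulrDl mulrA.
Qed.

Section OneFunction.
Variables (f : R -> R) (a b : nat -> R).
Hypothesis L1f : in_L1_torus f.
Hypothesis fS : has_fourier_series f a b.

Let perf x : f (x + T2) = f x. Proof. by have [h _] := L1f; exact: h. Qed.
Let intf : mu.-integrable torus (EFin \o f). Proof. by have [] := L1f. Qed.
Let mf : measurable_fun setT f.
Proof.
apply: (@periodic_measurable R) => //.
by have /integrableP[/measurable_EFinP] := intf.
Qed.

Lemma pairing_shift (s e : R) nu : (0 < nu)%N ->
  pairing (fun x => f (x + s)) (fun x => cos (nu%:R * x + e)) =
  pi * (a nu * cos (nu%:R * s - e) + b nu * cos (nu%:R * s + (- e - pi / 2))).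
Proof.
move=> nu0; pose F x := f x * cos (nu%:R * x + (e - nu%:R * s)).
have -> : pairing (fun x => f (x + s)) (fun x => cos (nu%:R * x + e)) =
    \int[mu]_(x in torus) F (x + s).
  by apply: eq_Rintegral => x _; rewrite /F; congr (_ * cos _); ring.
rewrite periodic_Rintegral_shift; last 2 first.
- by move=> x; rewrite /F perf cos_per_nat.
- by apply: measurable_funM => //; have [] := bmeas_cos nu%:R (e - nu%:R * s).
rewrite [LHS](pairing_fourier nu (e - nu%:R * s) intf fS) nu0.
rewrite addrA cosBpihalf; congr (_ * _).
by rewrite -[nu%:R * s - e]opprB cosN sinN; ring.
Qed.

(** [g] is the difference with its values replaced by zero where the majorant is
    infinite.  It is dominated by the integrable majorant, so that its Fourier
    coefficients are computed term by term: they are those of [f] times the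
    multiplier. *)
Lemma diff_pairing (h : R) : 0 < h -> exists g : R -> R,
  [/\ measurable_fun setT g, mu.-integrable torus (EFin \o g),
      (forall x, `|g x| <= `|frac_diff alpha h f x|) &
      forall nu e, (0 < nu)%N -> nu%:R * h <= pi ->
      pairing g (fun x => cos (nu%:R * x + e)) =
      pi * mult_abs alpha (nu%:R * h) *
      (a nu * cos (mult_arg alpha (nu%:R * h) - e) +
       b nu * cos (mult_arg alpha (nu%:R * h) - e - pi / 2))].
Proof.
move=> h0; pose M := diff_majorant alpha h f.
have mM : measurable_fun setT M by exact: measurable_diff_majorant.
pose E := [set x | (M x < +oo)%E].
have mE : measurable E.
  rewrite (_ : E = setT `&` M @^-1` [set` `]-oo, +oo%E[ ]); last first.
    by apply/seteqP; split=> x; rewrite /E/= in_itv/= ?setTI => // -[].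
  by apply: mM => //; exact: emeasurable_itv.
pose s n x := series (fun j => bcoef alpha j * f (x + (alpha - j%:R) * h)) n.
have ms n : measurable_fun setT (s n).
  rewrite /s /series /=; apply: measurable_sum => j.
  apply: measurable_funM => //; apply: (measurableT_comp mf); exact: measurable_shift.
have sM n x : (`|s n x|%:E <= M x)%E.
  rewrite /s /series/=; apply: (@le_trans _ _ (\sum_(0 <= j < n)
    (`|bcoef alpha j| * `|f (x + (alpha - j%:R) * h)|)%:E)%E).
    rewrite sumEFin lee_fin (le_trans (ler_norm_sum _ _ _))//.
    by apply: ler_sum => j _; rewrite normrM.
  by apply: nneseries_lim_ge => j _ _; rewrite lee_fin mulr_ge0.
have sF x : (M x < +oo)%E -> s n x @[n --> \oo] --> frac_diff alpha h f x.
  by move=> /(diff_majorant_cvg) /(@normed_cvg R R) h1; exact: h1.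
pose g x := \1_E x * frac_diff alpha h f x.
have mI : measurable_fun setT (\1_E : R -> R) by exact: measurable_indic.
have mg : measurable_fun setT g.
  apply: (@measurable_fun_cvg _ _ R setT (fun n x => \1_E x * s n x)).
    by move=> n; exact: measurable_funM.
  move=> x _; rewrite /g indicE; have [|xE] := boolP (x \in E).
    by rewrite inE => Mx; apply: cvgMr; exact: sF.
  rewrite mul0r (_ : (fun n => _) = cst 0); first exact: cvg_cst.
  by apply/funext => n; rewrite mul0r.
have iM : mu.-integrable torus M.
  apply: (@integrable_of_Lp _ 1) => //.
  - exact: measurable_funTS.
  - exact: diff_majorant_ge0.
  have [K K0 HK] := @diff_majorant_Lp R alpha alpha0 1 (lexx _).
  apply: le_lt_trans (HK h f perf mf) _.
  rewrite lte_mul_pinfty ?lee_fin ?(ltW K0)//.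
  have /integrableP[_] := intf; apply: le_lt_trans.
  by apply: ge0_le_integral_any => x _; rewrite powRr1//= lee_fin.
have mT : measurable (torus : set (measurableTypeR R)) by exact: measurable_torus.
have sg : {ae mu, forall x, torus x -> s n x @[n --> \oo] --> g x}.
  have := integrable_ae mT iM.
  apply: filterS => x hx Dx; have Mx : (M x < +oo)%E by rewrite ltey_eq hx.
  by rewrite /g indicE mem_set// mul1r; exact: sF.
have [ig pg] := pairing_cvg_dominated ms mg sg iM sM.
exists g; split => // [x|nu e nu0 nuh].
  by rewrite /g normrM indicE; case: (x \in E); rewrite ?normr1 ?mul1r ?normr0 ?mul0r.
have bc := bmeas_cos nu%:R (e : R).
have ic : mu.-integrable torus (EFin \o (fun x : R => cos (nu%:R * x + e))).
  exact: bmeas_integrable.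
apply: (cvg_unique _ (pg _ bc)) => //.
have habs : `|h| = h by rewrite gtr0_norm.
have hneg : (h < 0)%R = false by rewrite ltNge ltW.
have c1 := @cvg_frac_diff_cos _ alpha alpha0 h nu%:R (- e) 0 (ler0n _ _).
have c2 := @cvg_frac_diff_cos _ alpha alpha0 h nu%:R (- e - pi / 2) 0 (ler0n _ _).
rewrite habs hneg/= expr0 mul1r mulr0 in c1 c2; rewrite add0r in c1; rewrite add0r in c2.
have {c1}c1 := c1 nuh; have {c2}c2 := c2 nuh.
set ma := mult_abs _ _ in c1 c2 *; set mg' := mult_arg _ _ in c1 c2 *.
have -> : pi * ma * (a nu * cos (mg' - e) + b nu * cos (mg' - e - pi / 2)) =
  pi * a nu * (ma * cos (- e + mg')) + pi * b nu * (ma * cos (- e - pi / 2 + mg')).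
  rewrite [- e + mg']addrC (_ : - e - pi / 2 + mg' = mg' - e - pi / 2); last by ring.
  by ring.
rewrite (_ : (fun n => pairing (s n) _) =
  (pi * a nu) \*: series (fun j => bcoef alpha j * cos (nu%:R * (0 + (alpha - j%:R) * h) + - e)) +
  (pi * b nu) \*: series (fun j => bcoef alpha j * cos (nu%:R * (0 + (alpha - j%:R) * h) + (- e - pi / 2)))).
  by apply: cvgD; apply: cvgZr.
apply/funext => n; rewrite !fctE /series/= /GRing.scale/= !mulr_sumr -big_split/=.
have isf t : mu.-integrable torus (EFin \o (fun x => f (x + t))).
  apply/integrableP; split.
    apply/measurable_EFinP; apply: measurable_funTS; apply: (measurableT_comp mf).
    exact: measurable_shift.
  rewrite (periodic_integral_shift t (f := fun x => `|f x|%:E))//.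
  - by have /integrableP[] := intf.
  - by move=> x; rewrite perf.
  - by apply/measurable_EFinP; exact: measurableT_comp.
rewrite [LHS](pairing_suml (bcoef alpha) n bc (fun j => isf ((alpha - j%:R) * h))).
apply: eq_bigr => j _; rewrite pairing_shift// add0r; ring.
Qed.

End OneFunction.
End DiffPairing.

Section Kernel.
Context {R : realType}.
Local Notation mu := (@lebesgue_measure R).

Definition band_freq (n k k' : nat) : nat := (n - (n %/ 4).*2 + k + k')%N.

(** A Fejér-type kernel: the square of a block of about [n / 4] exponentials,
    modulated so that all its frequencies lie between [n / 2] and [n]. *)
Definition band_kernel (n : nat) (phi x : R) : R :=
  \sum_(0 <= k < (n %/ 4).+1) \sum_(0 <= k' < (n %/ 4).+1)
    cos ((band_freq n k k')%:R * x + phi).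

Lemma quarter_lt n : (0 < n)%N -> (n %/ 4 < n)%N.
Proof. by move=> n0; rewrite ltn_Pdiv. Qed.

Lemma band_freq_bounds n k k' : (0 < n)%N -> (k < (n %/ 4).+1)%N -> (k' < (n %/ 4).+1)%N ->
  [/\ (0 < band_freq n k k')%N, (n <= (band_freq n k k').*2)%N & (band_freq n k k' <= n)%N].
Proof. by rewrite /band_freq => n0 hk hk'; split; lia. Qed.

Lemma bmeas_band_kernel n phi : bmeas (band_kernel n phi).
Proof. by apply: bmeas_sum => k; apply: bmeas_sum => k'; exact: bmeas_cos. Qed.

Lemma band_kernel_le n phi x : (0 < n)%N -> `|band_kernel n phi x| <= n%:R ^+ 2.
Proof.
move=> n0; have l_le : (n %/ 4).+1%:R <= n%:R :> R by rewrite ler_nat quarter_lt.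
rewrite /band_kernel (le_trans (ler_norm_sum _ _ _))//.
apply: (@le_trans _ _ (\sum_(0 <= k < (n %/ 4).+1) n%:R)).
  apply: ler_sum => k _; rewrite (le_trans (ler_norm_sum _ _ _))//.
  apply: (@le_trans _ _ (\sum_(0 <= k' < (n %/ 4).+1) 1)).
    by apply: ler_sum => k' _; exact: cos_max.
  by rewrite sumr_const_nat subn0.
by rewrite sumr_const_nat subn0 -[leLHS]mulr_natr expr2 ler_wpM2l.
Qed.

(** Up to the modulation the kernel is the square of a Dirichlet kernel: one of
    the two sums telescopes, the other one is estimated again. *)
Lemma band_kernel_shell n phi j x : shell j x ->
  `|band_kernel n phi x| <= (16 * 16) * (2 ^+ j) ^+ 2.
Proof.
move=> sx; set l := (n %/ 4).+1; set c := (n - (n %/ 4).*2)%N.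
have e : 2 * sin (x / 2) * band_kernel n phi x =
  \sum_(0 <= k < l) cos (k%:R * x + (l%:R * x + c%:R * x + phi - x / 2 - pi / 2)) -
  \sum_(0 <= k < l) cos (k%:R * x + (c%:R * x + phi - x / 2 - pi / 2)).
  rewrite -sumrB mulr_sumr; apply: eq_bigr => k _.
  rewrite (eq_bigr (fun k' => cos (k'%:R * x + ((c + k)%:R * x + phi)))); last first.
    by move=> k' _; rewrite /band_freq -/c [in LHS]natrD; congr cos; ring.
  rewrite sum_cos_telescope// natrD !addrA !cosBpihalf.
  by rewrite -/l; congr (sin _ - sin _); ring.
have h := sin_half_shell sx.
have e2 : (0 : R) < 2 ^+ j by rewrite exprn_gt0.
have s0 : 0 < `|sin (x / 2)|.
  by apply: lt_le_trans h; rewrite invr_gt0 mulr_gt0.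
have : `|2 * sin (x / 2) * band_kernel n phi x| <= 32 * 2 ^+ j.
  rewrite e (le_trans (ler_normB _ _))//.
  have h1 := @sum_cos_shell R j x (l%:R * x + c%:R * x + phi - x / 2 - pi / 2) 0 l sx (leq0n _).
  have h2 := @sum_cos_shell R j x (c%:R * x + phi - x / 2 - pi / 2) 0 l sx (leq0n _).
  by lra.
rewrite !normrM ger0_norm// -mulrA.
set S := `|sin (x / 2)| in h s0 *; set K := `|band_kernel _ _ _|.
set t := (2 : R) ^+ j in h e2 * => h3.
have h4 : K <= 16 * t * (S * K).
  rewrite mulrA ler_peMl ?normr_ge0//.
  by rewrite -(ler_pM2l (_ : 0 < (16 * t)^-1)) ?invr_gt0 ?mulr_gt0// mulrA mulVf ?mulr1 ?mul1r// gt_eqF// mulr_gt0.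
have : 16 * t * (S * K) <= 16 * t * (16 * t).
  by rewrite ler_wpM2l ?mulr_ge0 ?(ltW e2)//; lra.
by move=> h5; apply: le_trans h4 (le_trans h5 _); rewrite le_eqVlt; apply/orP; left; apply/eqP; ring.
Qed.

Lemma band_kernel_dyadic i j phi x : shell j x ->
  `|band_kernel (2 ^ i) phi x| <= (16 * 16) * (2 ^+ minn i j) ^+ 2.
Proof.
move=> sx; have [ij|ji] := leqP i j; last exact: band_kernel_shell.
rewrite (le_trans (band_kernel_le _ _ _)) ?expn_gt0// natrX.
by rewrite ler_peMl ?exprn_ge0//; lra.
Qed.

Lemma pairing_band_kernel_ge (g : R -> R) n phi t : (0 < n)%N -> 0 <= t ->
  mu.-integrable torus (EFin \o g) ->
  (forall nu, (0 < nu)%N -> (n <= nu.*2)%N -> (nu <= n)%N ->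
     t <= pairing g (fun x => cos (nu%:R * x + phi))) ->
  n%:R ^+ 2 / 16 * t <= pairing g (band_kernel n phi).
Proof.
move=> n0 t0 ig h.
have l_ge : n%:R / 4 <= (n %/ 4).+1%:R :> R.
  rewrite ler_pdivrMr// -natrM ler_nat; lia.
rewrite (pairing_sum ig); last by move=> k; apply: bmeas_sum => k'; exact: bmeas_cos.
apply: (@le_trans _ _ (\sum_(0 <= k < (n %/ 4).+1) \sum_(0 <= k' < (n %/ 4).+1) t)).
  rewrite !sumr_const_nat !subn0 -[leRHS]mulr_natl -[t *+ _]mulr_natl mulrA ler_wpM2r//.
  rewrite (_ : n%:R ^+ 2 / 16 = (n%:R / 4) * (n%:R / 4)); last by field.
  by apply: ler_pM; rewrite ?divr_ge0.
rewrite !big_nat; apply: ler_sum => k /andP[_ hk].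
rewrite (pairing_sum ig); last by move=> k'; exact: bmeas_cos.
rewrite !big_nat; apply: ler_sum => k' /andP[_ hk'].
by have [v0 v1 v2] := band_freq_bounds n0 hk hk'; exact: h.
Qed.

End Kernel.

Section LowerEstimate.
Context {R : realType}.
Local Notation mu := (@lebesgue_measure R).
Variables (p C alpha : R).
Hypothesis p1 : 1 < p.
Hypothesis C0 : 0 < C.
Hypothesis alpha0 : 0 < alpha.

Lemma cos_ge_half (x : R) : `|x| <= 1 / 2 -> 1 / 2 <= cos x.
Proof.
move=> hx; have := cos_lip x 0; rewrite cos0 subr0 => h.
by have := ler_norm (- (cos x - 1)); rewrite normrN; lra.
Qed.

Section Coefficients.
Variables (a b : nat -> R).
Hypothesis a0 : forall n, (0 < n)%N -> 0 <= a n.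
Hypothesis b0 : forall n, (0 < n)%N -> 0 <= b n.
Hypothesis gma : gm_with C a.
Hypothesis gmb : gm_with C b.

(** Testing against the kernel with frequencies between [2 ^ i / 2] and [2 ^ i]
    collects about [4 ^ i] coefficients, all comparable to that of index [2 ^ i].
    Two phases are used.  With the first one the multiplier turns the cosines of
    [f] into cosines of nearly zero phase and the sines into nonnegative terms;
    with the second one the roles are exchanged. *)
Lemma coef_le_shells (h : R) (g : R -> R) i : 0 < h ->
  (2 ^ i)%:R * h <= 1 -> alpha * ((2 ^ i)%:R * h) <= 1 ->
  measurable_fun setT g -> mu.-integrable torus (EFin \o g) ->
  (forall nu e, (0 < nu)%N -> nu%:R * h <= pi ->
      pairing g (fun x => cos (nu%:R * x + e)) =
      pi * mult_abs alpha (nu%:R * h) *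
      (a nu * cos (mult_arg alpha (nu%:R * h) - e) +
       b nu * cos (mult_arg alpha (nu%:R * h) - e - pi / 2))) ->
  (((16 * (1 + C) * 4 `^ alpha)^-1 * ((2 ^+ i) ^+ 2 * ((2 ^ i)%:R * h) `^ alpha * coef a b i))%:E <=
   (2 * (16 * 16))%:E * \sum_(j <oo) ((2 ^+ minn i j) ^+ 2)%:E * \int[mu]_(x in shell j) (`|g x|)%:E)%E.
Proof.
move=> h0 ih aih mg ig pg; set n := (2 ^ i)%N in ih aih *.
have n0 : (0 < n)%N by rewrite expn_gt0.
have nh0 : 0 < n%:R * h by rewrite mulr_gt0// ltr0n.
have p2 : 2 <= pi :> R := pi_ge2 R.
have c10 : 0 < 1 + C by rewrite addr_gt0.
have anu (c : nat -> R) nu : (forall n, (0 < n)%N -> 0 <= c n) -> gm_with C c ->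
    (0 < nu)%N -> (n <= nu.*2)%N -> (nu <= n)%N -> c n / (1 + C) <= c nu.
  move=> c0 gc nu0 nn nun; rewrite ler_pdivrMr// mulrC.
  by apply: gm_le => //; rewrite nun nn.
pose ta (c : nat -> R) := pi * (n%:R * h / 4) `^ alpha * (c n / (1 + C) * 2^-1).
have ta0 c : (forall n, (0 < n)%N -> 0 <= c n) -> 0 <= ta c.
  by move=> c0; rewrite /ta !mulr_ge0 ?powR_ge0 ?pi_ge0 ?c0 ?invr_ge0// ltW.
have mnu nu : (n <= nu.*2)%N -> (nu <= n)%N ->
    [/\ nu%:R * h <= pi, 0 <= alpha * (nu%:R * h) <= 1 &
        (n%:R * h / 4) `^ alpha <= mult_abs alpha (nu%:R * h)].
  move=> nn nun; have nuh : nu%:R * h <= n%:R * h by rewrite ler_wpM2r ?ler_nat// ltW.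
  have nuh0 : 0 <= nu%:R * h by rewrite mulr_ge0// ltW.
  split; first by lra.
    by rewrite mulr_ge0 ?(ltW alpha0)//= (le_trans _ aih)// ler_wpM2l// ltW.
  apply: le_trans (mult_abs_ge alpha0 _); last by rewrite nuh0; lra.
  apply: ge0_ler_powR; rewrite ?nnegrE ?divr_ge0 ?(ltW alpha0)//; first by rewrite ltW.
  have : n%:R * h <= nu.*2%:R * h by rewrite ler_wpM2r ?ler_nat// ltW.
  by rewrite -muln2 natrM; lra.
have lowa : n%:R ^+ 2 / 16 * ta a <= pairing g (band_kernel n (alpha * pi / 2)).
  apply: pairing_band_kernel_ge => //; first exact: ta0.
  move=> nu nu0 nn nun; have [h1 /andP[h2 h2'] h3] := mnu nu nn nun.
  rewrite pg// /ta /mult_arg.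
  have -> : alpha * (pi + nu%:R * h) / 2 - alpha * pi / 2 = alpha * (nu%:R * h) / 2 by field.
  rewrite cosBpihalf; apply: ler_pM; first by rewrite mulr_ge0 ?pi_ge0 ?powR_ge0.
  - by rewrite mulr_ge0 ?invr_ge0// divr_ge0 ?a0// ltW.
  - by rewrite ler_wpM2l// pi_ge0.
  apply: (@le_trans _ _ (a nu * cos (alpha * (nu%:R * h) / 2))).
    apply: ler_pM; rewrite ?invr_ge0 ?divr_ge0 ?a0 ?(ltW c10)//; first exact: anu.
    rewrite -[2^-1]mul1r; apply: cos_ge_half.
    by rewrite ger0_norm; lra.
  rewrite lerDl mulr_ge0 ?b0//; apply: sin_half01_ge0; lra.
(* The additional phase [1 / 2] makes the cosine terms nonnegative and leaves the
   phase of the sine terms within [1 / 2] of zero. *)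
have lowb : n%:R ^+ 2 / 16 * ta b <=
    pairing g (band_kernel n (alpha * pi / 2 - pi / 2 + 1 / 2)).
  apply: pairing_band_kernel_ge => //; first exact: ta0.
  move=> nu nu0 nn nun; have [h1 /andP[h2 h2'] h3] := mnu nu nn nun.
  rewrite pg// /ta /mult_arg.
  set th := alpha * (nu%:R * h) in h2 h2'.
  have -> : alpha * (pi + nu%:R * h) / 2 - (alpha * pi / 2 - pi / 2 + 1 / 2) =
    (th / 2 - 1 / 2) + pi / 2 by rewrite /th; field.
  rewrite addrK cosDpihalf; apply: ler_pM; first by rewrite mulr_ge0 ?pi_ge0 ?powR_ge0.
  - by rewrite mulr_ge0 ?invr_ge0// divr_ge0 ?b0// ltW.
  - by rewrite ler_wpM2l// pi_ge0.
  apply: (@le_trans _ _ (b nu * cos (th / 2 - 1 / 2))).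
    apply: ler_pM; rewrite ?invr_ge0 ?divr_ge0 ?b0 ?(ltW c10)//; first exact: anu.
    rewrite -[2^-1]mul1r; apply: cos_ge_half.
    by rewrite ler_norml; apply/andP; split; lra.
  rewrite lerDr mulr_ge0 ?a0// -sinN (_ : - _ = (1 - th) / 2); last by field.
  by apply: sin_half01_ge0; apply/andP; split; lra.
have up phi : ((pairing g (band_kernel n phi))%:E <=
   (16 * 16)%:E * \sum_(j <oo) ((2 ^+ minn i j) ^+ 2)%:E * \int[mu]_(x in shell j) (`|g x|)%:E)%E.
  have [mk _] := bmeas_band_kernel n phi.
  have mT : measurable (torus : set (measurableTypeR R)) by exact: measurable_torus.
  have igk := integrable_pairing ig (bmeas_band_kernel n phi).
  have -> : (pairing g (band_kernel n phi))%:E =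
      (\int[mu]_(x in torus) (g x * band_kernel n phi x)%:E)%E.
    by rewrite /pairing /Rintegral fineK//; exact: integrable_fin_num.
  have mgk : measurable_fun setT (fun x => g x * band_kernel n phi x).
    exact: measurable_funM.
  apply: le_trans (lee_abs _) _.
  apply: (le_trans (le_abse_integral _ mT _)).
    by apply: measurable_funTS; apply/measurable_EFinP.
  rewrite integral_torus_shells; last 2 first.
  - by apply: measurable_funTS; apply: measurableT_comp => //; apply/measurable_EFinP.
  - by move=> x; exact: abse_ge0.
  rewrite -nneseriesZl; last first.
    by move=> j _; rewrite mule_ge0 ?lee_fin ?exprn_ge0// integral_ge0.
  apply: lee_nneseries => [j _ _|j _]; first by apply: integral_ge0.
  apply: (@le_trans _ _ (\int[mu]_(x in shell j)
    (((16 * 16) * (2 ^+ minn i j) ^+ 2)%:E * (`|g x|)%:E))%E).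
    apply: ge0_le_integral_any => // x sx.
    rewrite /= normrM EFinM muleC -!EFinM lee_fin ler_wpM2r//.
    exact: band_kernel_dyadic.
  rewrite ge0_integralZl; last 4 first.
  - exact: measurable_shell.
  - by apply: measurable_funTS; apply/measurable_EFinP; exact: measurableT_comp.
  - by move=> x _; rewrite lee_fin.
  - by rewrite lee_fin; apply: mulr_ge0; [rewrite mulr_ge0|rewrite exprn_ge0 ?exprn_ge0].
  by rewrite EFinM muleA.
set S := (\sum_(j <oo) _)%E in up *.
have S0 : (0 <= S)%E.
  by apply: nneseries_ge0 => j _ _; rewrite mule_ge0 ?lee_fin ?exprn_ge0// integral_ge0.
apply: (@le_trans _ _ (pairing g (band_kernel n (alpha * pi / 2)) +
   pairing g (band_kernel n (alpha * pi / 2 - pi / 2 + 1 / 2)))%:E).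
  rewrite lee_fin; apply: le_trans (lerD lowa lowb).
  rewrite -mulrDr /ta -mulrDr -mulrDl -mulrDl natrX.
  rewrite natrX in nh0.
  have -> : (2 ^+ i * h / 4) `^ alpha = (2 ^+ i * h) `^ alpha / 4 `^ alpha.
    by rewrite powRM ?invr_ge0 ?(ltW nh0)// -powR_inv1// -powRrM mulN1r powRN.
  rewrite (_ : a n + b n = coef a b i)// !invfM.
  set P := (2 ^+ i * h) `^ alpha; set Q := (4 `^ alpha)^-1; set X := (2 ^+ i) ^+ 2.
  have X0 : 0 <= X by rewrite exprn_ge0// exprn_ge0.
  have P0 : 0 <= P by exact: powR_ge0.
  have Q0 : 0 <= Q by rewrite invr_ge0 powR_ge0.
  have cf := coef_ge0 a0 b0 i.
  have Z0 : 0 <= X * P * Q * coef a b i * (1 + C)^-1.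
    by rewrite !mulr_ge0// invr_ge0 ltW.
  rewrite (_ : X / 16 * _ = (pi / 2) / 16 * (X * P * Q * coef a b i * (1 + C)^-1)); last by ring.
  rewrite (_ : 16^-1 * _ * Q * _ = 1 / 16 * (X * P * Q * coef a b i * (1 + C)^-1)); last by ring.
  by rewrite ler_wpM2r//; lra.
rewrite EFinD (_ : (2 * (16 * 16))%:E = (16 * 16)%:E + (16 * 16)%:E)%E; last first.
  by rewrite -EFinD; congr (_%:E); ring.
by rewrite ge0_muleDl ?lee_fin//; apply: leeD; exact: up.
Qed.

End Coefficients.

(** With [d = 2 ^ (1 - 1 / p)], the factors [d ^ i] of the block size and
    [d ^ (- j)] of Hoelder's inequality on the shell of index [j] turn the bound of
    the kernel into a geometric weight. *)
Lemma kernel_weight (d : R) i j : 1 <= d <= 2 ->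
  d ^+ i * (2 ^+ minn i j) ^+ 2 * (d^-1) ^+ j <= (d^-1) ^+ dist i j * (2 ^+ i) ^+ 2.
Proof.
move=> /andP[d1 d2]; have d0 : 0 < d by lra.
have dn k : d ^+ k != 0 by rewrite expf_neq0 ?gt_eqF.
have [ij|ji] := leqP i j.
  have -> : d^-1 ^+ j = d^-1 ^+ (j - i) * d^-1 ^+ i by rewrite -exprD subnK.
  rewrite /dist (eqP ij) add0n le_eqVlt; apply/orP; left; apply/eqP.
  by rewrite !exprVn; field; rewrite !dn.
rewrite /dist (eqP (ltnW ji)) addn0.
have -> : d ^+ i = d ^+ (i - j) * d ^+ j by rewrite -exprD subnK// ltnW.
have -> : (2 : R) ^+ i = 2 ^+ (i - j) * 2 ^+ j by rewrite -exprD subnK// ltnW.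
rewrite !exprVn.
rewrite (_ : d ^+ (i - j) * d ^+ j * (2 ^+ j) ^+ 2 / d ^+ j = d ^+ (i - j) * (2 ^+ j) ^+ 2);
  last by field; rewrite dn.
rewrite [(2 ^+ (i - j) * 2 ^+ j) ^+ 2]exprMn [leRHS]mulrA.
apply: ler_wpM2r; first by rewrite exprn_ge0 ?exprn_ge0.
rewrite mulrC ler_pdivlMr ?exprn_gt0// -expr2.
by rewrite lerXn2r ?nnegrE ?exprn_ge0 ?(ltW d0)// lerXn2r ?nnegrE// ltW.
Qed.

(** On each shell Hoelder's inequality replaces the integral of the difference by
    its [L_p] norm; the block sizes are then bounded by a geometric convolution
    of these local norms. *)
Lemma frac_diff_lower : exists2 K : R, 0 < K &
  forall (f : R -> R) (a b : nat -> R), in_L1_torus f -> has_fourier_series f a b ->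
  (forall n, (0 < n)%N -> 0 <= a n) -> (forall n, (0 < n)%N -> 0 <= b n) ->
  gm_with C a -> gm_with C b -> forall m h, 0 < h ->
  (2 ^ m)%:R * h <= 1 -> alpha * ((2 ^ m)%:R * h) <= 1 ->
  (\sum_(i <oo) (((i <= m)%:R * ((2 ^ i)%:R * h) `^ alpha * block_size p a b i) `^ p)%:E <=
   K%:E * \int[mu]_(x in torus) (`|frac_diff alpha h f x|%:E `^ p))%E.
Proof.
have p0 : 0 < p by rewrite (lt_trans ltr01).
have s0 : 0 < 1 - p^-1 by rewrite subr_gt0 invf_lt1.
set d := pow2 (1 - p^-1).
have d1 : 1 < d := pow2_gt1 s0.
have d0 : 0 < d by rewrite (lt_trans ltr01).
have d2 : d <= 2.
  rewrite -[leRHS]powRr1//; apply: ler_powR; first by lra.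
  by rewrite gerBl invr_ge0 ltW.
have lam01 : 0 <= d^-1 < 1 by rewrite invr_ge0 (ltW d0) invf_lt1.
have [K K0 HK] := @geom_conv R d^-1 p lam01 p0.
pose c1 : R := (16 * (1 + C) * 4 `^ alpha)^-1.
have c10 : 0 < c1 by rewrite invr_gt0 !mulr_gt0 ?powR_gt0 ?addr_gt0.
pose c2 : R := (2 * (16 * 16)) * c1^-1 * (pi *+ 2) `^ (1 - p^-1).
have pi20 : 0 < pi *+ 2 :> R by rewrite pmulrn_lgt0// pi_gt0.
have c20 : 0 < c2.
  apply: mulr_gt0; last exact: powR_gt0.
  by apply: mulr_gt0; [rewrite !mulr_gt0|rewrite invr_gt0].
exists (c2 `^ p * K); first by rewrite mulr_gt0// powR_gt0.
move=> f a b L1f fS a0 b0 ga gb m h h0 mh amh.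
have [g [mg ig gF pg]] := diff_pairing alpha0 L1f fS h0.
pose G j := (\int[mu]_(x in shell j) (`|g x|%:E `^ p))%E.
have G0 j : (0 <= G j)%E by apply: integral_ge0 => x _; exact: poweR_ge0.
pose u j := (G j `^ p^-1)%E.
have u0 j : (0 <= u j)%E by exact: poweR_ge0.
have mgp : measurable_fun setT (fun x => `|g x|%:E `^ p)%E.
  by apply: measurable_abs_poweR.
have GF : (\sum_(j <oo) G j <= \int[mu]_(x in torus) (`|frac_diff alpha h f x|%:E `^ p))%E.
  rewrite -integral_torus_shells; last 2 first.
  - exact: measurable_funTS.
  - by move=> x; exact: poweR_ge0.
  apply: ge0_le_integral_any => x _; first exact: poweR_ge0.
  by apply: le_poweR; rewrite ?lee_fin ?(ltW p0)//; exact: gF.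
have ptw i : (i <= m)%N -> ((((2 ^ i)%:R * h) `^ alpha * block_size p a b i)%:E <=
    c2%:E * \sum_(j <oo) (d^-1 ^+ dist i j)%:E * u j)%E.
  move=> im.
  have ile : (2 ^ i)%:R * h <= (2 ^ m)%:R * h.
    by rewrite ler_wpM2r ?(ltW h0)// ler_nat leq_exp2l.
  have ih : (2 ^ i)%:R * h <= 1 by lra.
  have aih : alpha * ((2 ^ i)%:R * h) <= 1.
    by apply: le_trans amh; rewrite ler_wpM2l// ltW.
  have := coef_le_shells a0 b0 ga gb h0 ih aih mg ig pg.
  rewrite -/c1; set X := (2 ^+ i) ^+ 2; set P := _ `^ alpha; set w := coef a b i.
  have X0 : 0 < X by rewrite exprn_gt0// exprn_gt0.
  move=> H.
  have di0 : 0 <= d ^+ i by rewrite exprn_ge0// ltW.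
  have -> : (P * block_size p a b i)%:E =
     ((c1^-1 * d ^+ i / X)%:E * (c1 * (X * P * w))%:E)%E.
    rewrite -EFinM /block_size -/d -/w; congr (_%:E); field.
    by rewrite !gt_eqF.
  have k0 : 0 <= c1^-1 * d ^+ i / X.
    apply: mulr_ge0; last by rewrite invr_ge0 ltW.
    by apply: mulr_ge0 => //; rewrite invr_ge0 ltW.
  apply: le_trans (lee_wpmul2l _ H) _; first by rewrite lee_fin.
  rewrite muleA -EFinM -!nneseriesZl; last 2 first.
  - by move=> j _; rewrite mule_ge0// lee_fin exprn_ge0// invr_ge0 ltW.
  - by move=> j _; rewrite mule_ge0 ?lee_fin ?exprn_ge0// integral_ge0.
  apply: lee_nneseries => [j _ _|j _].
    apply: mule_ge0; first by rewrite lee_fin; apply: mulr_ge0 => //; rewrite !mulr_ge0.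
    apply: mule_ge0; first by rewrite lee_fin exprn_ge0 ?exprn_ge0.
    by apply: integral_ge0 => x _; rewrite lee_fin.
  have cj0 : 0 <= pi *+ 2 / 2 ^+ j :> R by rewrite divr_ge0 ?(ltW pi20) ?exprn_ge0.
  have Hj := hoelder_set p1 cj0 (measurable_shell j) (shell_measure_le j) mg.
  have -> : (c2%:E * ((d^-1 ^+ dist i j)%:E * u j))%E =
    ((c2 * d^-1 ^+ dist i j)%:E * u j)%E by rewrite EFinM muleA.
  rewrite muleA -EFinM.
  have q0 : 0 <= c1^-1 * d ^+ i / X * (2 * (16 * 16)) * (2 ^+ minn i j) ^+ 2.
    apply: mulr_ge0; last by rewrite exprn_ge0 ?exprn_ge0.
    by apply: mulr_ge0; last rewrite !mulr_ge0.
  apply: le_trans (lee_wpmul2l _ Hj) _; first by rewrite lee_fin.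
  rewrite -/(G j) -/(u j) muleA -EFinM lee_wpmul2r// lee_fin.
  have -> : (pi *+ 2 / 2 ^+ j) `^ (1 - p^-1) = (pi *+ 2) `^ (1 - p^-1) * d^-1 ^+ j.
    rewrite powRM ?(ltW pi20) ?invr_ge0 ?exprn_ge0//; congr (_ * _).
    rewrite -exprVn powRX ?invr_ge0//; congr (_ ^+ _).
    by rewrite -[2^-1]powR_inv1// -powRrM mulN1r powRN.
  rewrite /c2.
  have kw := @kernel_weight d i j (ltac:(by rewrite (ltW d1) d2)).
  have Y0 : 0 <= (2 * (16 * 16)) * c1^-1 * (pi *+ 2) `^ (1 - p^-1) / X.
    apply: mulr_ge0; last by rewrite invr_ge0 ltW.
    apply: mulr_ge0; last exact: powR_ge0.
    by apply: mulr_ge0; [rewrite !mulr_ge0|rewrite invr_ge0 ltW].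
  have := ler_wpM2l Y0 kw; rewrite -/X.
  set A := (pi *+ 2) `^ _; set D := d^-1 ^+ dist i j; set Dj := d^-1 ^+ j.
  set M2 := (2 ^+ minn i j) ^+ 2.
  rewrite (_ : (2 * (16 * 16)) / c1 * A / X * (d ^+ i * M2 * Dj) = d ^+ i / c1 / X * (2 * (16 * 16)) * M2 * (A * Dj)); last by ring.
  rewrite (_ : (2 * (16 * 16)) / c1 * A / X * (D * X) = (2 * (16 * 16)) / c1 * A * D); last by field; rewrite !gt_eqF.
  by rewrite [d ^+ i / c1]mulrC.
apply: (@le_trans _ _ (\sum_(i <oo) (c2 `^ p)%:E *
   (\sum_(j <oo) (d^-1 ^+ dist i j)%:E * u j) `^ p)%E).
  apply: lee_nneseries => [i _ _|i _]; first by rewrite lee_fin powR_ge0.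
  have V0 : (0 <= \sum_(j <oo) (d^-1 ^+ dist i j)%:E * u j)%E.
    by apply: nneseries_ge0 => j _ _; rewrite mule_ge0// lee_fin exprn_ge0// invr_ge0 ltW.
  case: leqP => im; last first.
    by rewrite !mul0r powR0 ?gt_eqF// mule_ge0 ?poweR_ge0// lee_fin powR_ge0.
  rewrite mul1r -[X in (X * _)%E]poweR_EFin -poweRM ?lee_fin ?(ltW c20)//.
  rewrite -poweR_EFin; apply: le_poweR; rewrite ?(ltW p0)//; last exact: ptw.
  rewrite lee_fin; apply: mulr_ge0; first exact: powR_ge0.
  by rewrite /block_size mulr_ge0 ?exprn_ge0 ?powR_ge0 ?coef_ge0.
rewrite nneseriesZl; last by move=> i _; exact: poweR_ge0.
rewrite EFinM -muleA lee_wpmul2l ?lee_fin ?powR_ge0//.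
apply: le_trans (HK u u0) _; rewrite lee_wpmul2l ?lee_fin ?(ltW K0)//.
apply: le_trans GF; rewrite le_eqVlt; apply/orP; left; apply/eqP.
apply: eq_eseriesr => j _; rewrite /u -poweRrM mulVf ?gt_eqF// poweRe1//.
Qed.

End LowerEstimate.

(** * Weighted sequence norms *)

Section SequenceNorm.
Context {R : realType}.

Definition lqnorm (q : \bar R) (u : nat -> \bar R) : \bar R :=
  match q with
  | r%:E => ((\sum_(m <oo) (u m `^ r)) `^ r^-1)%E
  | +oo%E => ereal_sup (range u)
  | -oo%E => 0%E
  end.

Variable q : \bar R.
Hypothesis q0 : (0 < q)%E.

Lemma lqnorm_term (u : nat -> \bar R) m : (forall i, 0 <= u i)%E ->
  (u m <= lqnorm q u)%E.
Proof.
move=> u0; case: q q0 => [r r0|_|//] /=; last by apply: ereal_sup_ubound; exists m.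
apply: poweR_inv_le => //; first by apply: nneseries_ge0 => i _ _; exact: poweR_ge0.
by apply: (nneseries_term_le (u := fun i => (u i `^ r)%E)) => i; exact: poweR_ge0.
Qed.

Lemma lqnorm_ge0 (u : nat -> \bar R) : (forall i, 0 <= u i)%E -> (0 <= lqnorm q u)%E.
Proof. by move=> u0; exact: le_trans (u0 0%N) (lqnorm_term 0 u0). Qed.

Lemma le_lqnorm (u v : nat -> \bar R) : (forall i, 0 <= u i)%E ->
  (forall i, u i <= v i)%E -> (lqnorm q u <= lqnorm q v)%E.
Proof.
move=> u0 uv; case: q q0 => [r r0|_|//] /=; last first.
  apply: ge_ereal_sup => _ [m _ <-]; apply: (le_trans (uv m)).
  by apply: ereal_sup_ubound; exists m.
have r0' : 0 <= r by rewrite ltW.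
apply: le_poweR; first by rewrite invr_ge0.
  by apply: nneseries_ge0 => i _ _; exact: poweR_ge0.
apply: lee_nneseries => [i _ _|i _]; first exact: poweR_ge0.
exact: le_poweR.
Qed.

Lemma lqnormZ_le (c : R) (u : nat -> \bar R) : 0 <= c -> (forall i, 0 <= u i)%E ->
  (lqnorm q (fun i => c%:E * u i) <= c%:E * lqnorm q u)%E.
Proof.
move=> c0 u0; have N0 := lqnorm_ge0 u0; case: q q0 N0 => [r r0|_|//] /= N0; last first.
  apply: ge_ereal_sup => _ [m _ <-]; apply: lee_wpmul2l; first by rewrite lee_fin.
  by apply: ereal_sup_ubound; exists m.
have r0' : 0 <= r by rewrite ltW.
under eq_eseriesr do rewrite poweRM ?lee_fin// poweR_EFin.
rewrite nneseriesZl; last by move=> i _; exact: poweR_ge0.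
rewrite poweRM ?lee_fin ?powR_ge0//; last first.
  by apply: nneseries_ge0 => i _ _; exact: poweR_ge0.
by rewrite poweR_EFin -powRrM mulfV ?gt_eqF// powRr1.
Qed.

Lemma lqnorm_shift (u : nat -> \bar R) k : (forall i, 0 <= u i)%E ->
  (lqnorm q (fun i => u (i + k)%N) <= lqnorm q u)%E.
Proof.
move=> u0; case: q q0 => [r r0|_|//] /=; last first.
  apply: ge_ereal_sup => _ [m _ <-].
  by apply: ereal_sup_ubound; exists (m + k)%N.
apply: le_poweR; first by rewrite invr_ge0 ltW.
  by apply: nneseries_ge0 => i _ _; exact: poweR_ge0.
by apply: (nneseries_shift_le (u := fun i => (u i `^ r)%E)) => i; exact: poweR_ge0.
Qed.

(** For finite [q] this is [geom_conv]; for the supremum it is enough to sum the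
    kernel. *)
Lemma lqnorm_conv (lam : R) : 0 <= lam < 1 -> exists2 K : R, 0 < K &
  forall u : nat -> \bar R, (forall i, 0 <= u i)%E ->
  (lqnorm q (fun m => \sum_(i <oo) (lam ^+ dist m i)%:E * u i) <= K%:E * lqnorm q u)%E.
Proof.
move=> lam01; have /andP[l0 l1] := lam01; case: q q0 => [r r0|_|//] /=.
  have [K K0 HK] := geom_conv lam01 r0; exists (K `^ r^-1); first exact: powR_gt0.
  move=> u u0; have s0 : (0 <= \sum_(i <oo) u i `^ r)%E.
    by apply: nneseries_ge0 => i _ _; exact: poweR_ge0.
  rewrite -poweR_EFin -poweRM ?lee_fin ?(ltW K0)//.
  apply: le_poweR; first by rewrite invr_ge0 ltW.
    by apply: nneseries_ge0 => i _ _; exact: poweR_ge0.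
  exact: HK.
exists (2 / (1 - lam)) => [|u u0]; first by rewrite divr_gt0// subr_gt0.
set N := ereal_sup (range u); have uN i : (u i <= N)%E by apply: ereal_sup_ubound; exists i.
have N0 : (0 <= N)%E by exact: le_trans (u0 0%N) (uN 0%N).
apply: ge_ereal_sup => _ [m _ <-].
apply: nneseries_le => [i|n]; first by rewrite mule_ge0// lee_fin exprn_ge0.
apply: (@le_trans _ _ (\sum_(0 <= i < n) ((lam ^+ dist m i)%:E * N))%E).
  by apply: lee_sum => i _; rewrite lee_wpmul2l// lee_fin exprn_ge0.
rewrite -ge0_sume_distrl; last by move=> i _; rewrite lee_fin exprn_ge0.
rewrite sumEFin lee_wpmul2r// lee_fin.
under eq_bigr do rewrite distC.
exact: sum_expr_dist_le.
Qed.

End SequenceNorm.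

(** * Dyadic form of the Lipschitz seminorm *)

Section LipDyadic.
Context {R : realType}.
Local Notation mu := (@lebesgue_measure R).
Variables (alpha b p : R) (q : \bar R).
Hypothesis alpha0 : 0 < alpha.
Hypothesis b0 : 0 <= b.
Hypothesis q0 : (0 < q)%E.

Definition dyadic_weight (m : nat) : R := pow2 alpha ^+ m * (1 + m%:R) `^ (- b).

Definition dyadic_modulus (f : R -> R) (m : nat) : \bar R :=
  modulus alpha p f (2^-1 ^+ m).

Lemma Lp_norm_ge0 (f : R -> R) : (0 <= Lp_norm_torus p f)%E.
Proof. exact: Lnorm_ge0. Qed.

Lemma modulus_ge0 f (t : R) : 0 <= t -> (0 <= modulus alpha p f t)%E.
Proof.
move=> t0; apply: le_trans (Lp_norm_ge0 (frac_diff alpha 0 f)) _.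
by apply: ereal_sup_ubound; exists 0 => //=; rewrite normr0.
Qed.

Lemma le_modulus f (s t : R) : s <= t -> (modulus alpha p f s <= modulus alpha p f t)%E.
Proof.
move=> st; apply: ge_ereal_sup => _ [h /= hs <-]; apply: ereal_sup_ubound.
by exists h => //=; exact: le_trans hs st.
Qed.

Definition dyadic_itv (m : nat) : set R := `[2^-1 ^+ m.+1, 2^-1 ^+ m[%classic.

Lemma dyadic_itv_sub m : dyadic_itv m `<=` `]0%R, 1%R[%classic.
Proof.
rewrite /dyadic_itv => t /=; rewrite !in_itv/= => /andP[h1 h2].
rewrite (lt_le_trans _ h1) ?exprn_gt0 ?invr_gt0//= (lt_le_trans h2)//.
by rewrite exprn_ile1 ?invr_ge0// invf_le1 ?ler1n.
Qed.

Lemma dyadic_itv_cover (t : R) : 0 < t < 1 -> exists m, dyadic_itv m t.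
Proof.
move=> /andP[t0 t1].
have ex : exists n : nat, (2^-1 ^+ n <= t)%R.
  exists (Num.bound t^-1); rewrite exprVn -[leRHS]invrK lef_pV2 ?posrE ?exprn_gt0 ?invr_gt0//.
  apply: le_trans (ltW (archi_boundP _)) _; first by rewrite invr_ge0 ltW.
  by rewrite -natrX ler_nat ltnW// ltn_expl.
have := ex_minnP ex => -[[|n] hn mn].
  by move: hn; rewrite expr0 leNgt t1.
exists n; rewrite /dyadic_itv/= in_itv/= hn/= ltNge.
by apply/negP => /mn; rewrite ltnn.
Qed.

Lemma dyadic_itv_triv : trivIset setT dyadic_itv.
Proof.
apply: ltn_trivIset => n m mn; apply/seteqP; split => // t [].
rewrite /dyadic_itv/= !in_itv/= => /andP[h2 _] /andP[_ h1].
have h3 : 2^-1 ^+ n <= 2^-1 ^+ m.+1 :> R.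
  by rewrite ler_wiXn2l ?invr_ge0// invf_le1 ?ler1n.
have := lt_le_trans h1 h3; rewrite ltNge => /negP; apply; exact: h2.
Qed.

Lemma dyadic_itv_measure m : mu (dyadic_itv m) = (2^-1 ^+ m.+1)%:E.
Proof.
have h : (2^-1 ^+ m.+1 < 2^-1 ^+ m :> R)%R.
  by rewrite exprS gtr_pMl ?exprn_gt0 ?invr_gt0// invf_lt1 ?ltr1n.
have := @lebesgue_measure_itv R `[2^-1 ^+ m.+1, 2^-1 ^+ m[.
rewrite /= lte_fin h => ->; rewrite -EFinD; congr (_%:E).
by rewrite exprS; field.
Qed.

Lemma ln2_bounds : 1 / 2 <= ln (2 : R) <= 1.
Proof.
apply/andP; split; last first.
  have := @le_ln1Dx R 1; rewrite (_ : 1 + 1 = 2)//; apply; lra.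
have := @le_ln1Dx R (- (1 / 2)); rewrite (_ : 1 + - (1 / 2) = 2^-1); last by field.
by rewrite lnV ?posrE// => h; have := h (ltac:(lra)); lra.
Qed.

Lemma le_powRN (x y e : R) : 0 < x -> x <= y -> 0 <= e -> y `^ (- e) <= x `^ (- e).
Proof.
move=> x0 xy e0; rewrite !powRN lef_pV2 ?posrE ?powR_gt0 ?(lt_le_trans x0)//.
by apply: ge0_ler_powR; rewrite ?nnegrE ?(ltW x0)// (le_trans (ltW x0)).
Qed.

Lemma weight_bounds m (t : R) : dyadic_itv m t ->
  t `^ (- alpha) * (1 - ln t) `^ (- b) <= pow2 alpha * 2 `^ b * dyadic_weight m /\
  (pow2 alpha)^-1 * dyadic_weight m.+1 <= t `^ (- alpha) * (1 - ln t) `^ (- b).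
Proof.
move=> tI; have := dyadic_itv_sub tI; rewrite /= in_itv/= => /andP[t0 t1].
move: tI; rewrite /dyadic_itv/= in_itv/= => /andP[h1 h2].
have hx (n : nat) : (0 : R) < 2^-1 ^+ n by rewrite exprn_gt0 ?invr_gt0.
have /andP[l2h l2'] := ln2_bounds.
have lnE n : ln (2^-1 ^+ n : R) = - (n%:R * ln 2).
  by rewrite lnXn ?invr_gt0// lnV ?posrE// mulNrn mulr_natl.
have lt1 : - ln t <= m.+1%:R * ln 2.
  by rewrite lerNl -lnE ler_ln ?posrE.
have lt2 : m%:R * ln 2 <= - ln t.
  by rewrite lerNr -lnE ler_ln ?posrE// ltW.
have dE n : (2^-1 ^+ n : R) `^ (- alpha) = pow2 alpha ^+ n.
  rewrite powRX ?invr_ge0//; congr (_ ^+ _).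
  by rewrite -[2^-1]powR_inv1// -powRrM mulrNN mul1r.
have m0 : 0 <= m%:R :> R by rewrite ler0n.
have mS : m.+1%:R = 1 + m%:R :> R by rewrite -natr1 addrC.
(* As [1 / 2 <= ln 2 <= 1], the quantities [1 - ln t] and [1 + m] are comparable
   up to a factor two. *)
have lm : m%:R / 2 <= - ln t.
  by apply: le_trans lt2; rewrite ler_wpM2l//; lra.
have lM : - ln t <= 1 + m%:R.
  by apply: le_trans lt1 _; rewrite mS -[leRHS]mulr1 ler_wpM2l//; lra.
have npow := @le_powRN.
split.
  rewrite /dyadic_weight [leRHS](_ : _ = (pow2 alpha * pow2 alpha ^+ m) *
    (2 `^ b * (1 + m%:R) `^ (- b))); last by ring.
  apply: ler_pM; rewrite ?powR_ge0//.
    by rewrite -exprS -dE; apply: npow => //; rewrite ltW.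
  have -> : 2 `^ b = (2^-1) `^ (- b) :> R.
    by rewrite -[2^-1]powR_inv1// -powRrM mulrNN mul1r.
  rewrite -powRM ?invr_ge0 ?addr_ge0//.
  by apply: npow => //; lra.
rewrite /dyadic_weight exprS !mulrA mulVf ?gt_eqF ?powR_gt0// mul1r.
apply: ler_pM; rewrite ?powR_ge0 ?exprn_ge0 ?powR_ge0//.
  by rewrite -dE; apply: npow => //; rewrite ltW.
by apply: npow => //; rewrite ?mS; lra.
Qed.

Lemma integral_dyadic_step (c : nat -> \bar R) : (forall m, 0 <= c m)%E ->
  (\int[mu]_(t in `]0%R, 1%R[) (\sum_(m <oo) c m * (\1_(dyadic_itv m) t)%:E) =
   \sum_(m <oo) c m * (2^-1 ^+ m.+1)%:E)%E.
Proof.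
move=> c0; have mD : measurable (`]0%R, 1%R[%classic : set (measurableTypeR R)).
  exact: measurable_itv.
have mI m : measurable (dyadic_itv m : set (measurableTypeR R)) by exact: measurable_itv.
have mf m : measurable_fun (`]0%R, 1%R[%classic : set (measurableTypeR R))
    (fun t : measurableTypeR R => (\1_(dyadic_itv m : set (measurableTypeR R)) t : R)%:E).
  apply: measurable_funTS; apply/measurable_EFinP.
  by apply: (@measurable_indic _ (measurableTypeR R)); exact: mI.
rewrite integral_nneseries//; last 2 first.
- by move=> m; exact: measurable_funeM.
- by move=> m t _; apply: mule_ge0; rewrite ?lee_fin.
apply: eq_eseriesr => m _; rewrite ge0_integralZl//.
have e : dyadic_itv m `&` `]0%R, 1%R[%classic = dyadic_itv m.
  by apply/setIidl; exact: dyadic_itv_sub.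
by rewrite integral_indic// e; congr (_ * _)%E; exact: dyadic_itv_measure.
Qed.

Lemma dyadic_step_le (c : nat -> \bar R) m t : (forall m, 0 <= c m)%E -> dyadic_itv m t ->
  (\sum_(k <oo) c k * (\1_(dyadic_itv k) t)%:E <= c m)%E.
Proof.
move=> c0 tm; apply: nneseries_le => [k|n]; first by rewrite mule_ge0// lee_fin.
rewrite (eq_bigr (fun k => if k == m then c m else 0%E)); last first.
  move=> k _; rewrite indicE; case: eqP => [->|km]; first by rewrite mem_set// mule1.
  rewrite memNset ?mule0// => tk; apply: km.
  by apply: (dyadic_itv_triv I I); exists t.
rewrite -big_mkcond big_nat1_eq; case: ifP => _ //.
Qed.

Lemma le_dyadic_step (c : nat -> \bar R) m t : (forall m, 0 <= c m)%E -> dyadic_itv m t ->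
  (c m <= \sum_(k <oo) c k * (\1_(dyadic_itv k) t)%:E)%E.
Proof.
move=> c0 tm; rewrite -[leLHS]mule1.
have -> : (1 = (\1_(dyadic_itv m) t : R)%:E)%E by rewrite indicE mem_set.
by apply: (nneseries_term_le (u := fun k => (c k * (\1_(dyadic_itv k) t : R)%:E)%E)) => k;
  rewrite mule_ge0// lee_fin.
Qed.

Section Function.
Variable f : R -> R.

Definition dyadic_lip (m : nat) : \bar R := ((dyadic_weight m)%:E * dyadic_modulus f m)%E.

Lemma dyadic_weight_ge0 m : 0 <= dyadic_weight m.
Proof. by rewrite mulr_ge0 ?exprn_ge0 ?powR_ge0. Qed.

Lemma dyadic_modulus_ge0 m : (0 <= dyadic_modulus f m)%E.
Proof. by apply: modulus_ge0; rewrite exprn_ge0 ?invr_ge0. Qed.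

Lemma dyadic_lip_ge0 m : (0 <= dyadic_lip m)%E.
Proof. by rewrite mule_ge0 ?lee_fin ?dyadic_weight_ge0 ?dyadic_modulus_ge0. Qed.

Let w (t : R) : \bar R :=
  ((t `^ (- alpha) * (1 - ln t) `^ (- b))%:E * modulus alpha p f t)%E.

Let w_le m t : dyadic_itv m t -> (w t <= (pow2 alpha * 2 `^ b)%:E * dyadic_lip m)%E.
Proof.
move=> tm; have [h _] := weight_bounds tm.
have /andP[t0 _] : 0 < t < 1 by have := dyadic_itv_sub tm; rewrite /= in_itv.
rewrite /dyadic_lip muleA -EFinM; apply: lee_pmul.
- by rewrite lee_fin mulr_ge0 ?powR_ge0.
- by apply: modulus_ge0; exact: ltW.
- by rewrite lee_fin.
apply: le_modulus; apply: ltW; move: tm; rewrite /dyadic_itv /= in_itv/=.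
by case/andP.
Qed.

Let le_w m t : dyadic_itv m t -> (((pow2 alpha)^-1)%:E * dyadic_lip m.+1 <= w t)%E.
Proof.
move=> tm; have [_ h] := weight_bounds tm.
have d0 : 0 <= (pow2 alpha)^-1 by rewrite invr_ge0 powR_ge0.
rewrite /dyadic_lip muleA -EFinM; apply: lee_pmul.
- by rewrite lee_fin mulr_ge0 ?dyadic_weight_ge0.
- exact: dyadic_modulus_ge0.
- by rewrite lee_fin.
apply: le_modulus; move: tm; rewrite /dyadic_itv /= in_itv/=.
by case/andP.
Qed.

Let w_ge0 t : 0 < t -> (0 <= w t)%E.
Proof.
by move=> t0; rewrite mule_ge0 ?lee_fin ?mulr_ge0 ?powR_ge0// modulus_ge0// ltW.
Qed.

Let itv_inv m t : dyadic_itv m t -> 2 ^+ m <= t^-1 <= 2 ^+ m.+1.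
Proof.
move=> tm; have /andP[t0 _] : 0 < t < 1 by have := dyadic_itv_sub tm; rewrite /= in_itv.
move: tm; rewrite /dyadic_itv /= in_itv/= !exprVn => /andP[h1 h2].
have e (n : nat) : (2 : R) ^+ n = (2 ^- n)^-1 by rewrite invrK.
by rewrite (e m) (e m.+1) !lef_pV2 ?posrE ?invr_gt0 ?exprn_gt0// h1 ltW.
Qed.

Lemma Lip_seminorm_upper :
  (Lip_seminorm alpha b p q f <= (pow2 alpha * 2 `^ b)%:E * lqnorm q dyadic_lip)%E.
Proof.
have c0 : 0 <= pow2 alpha * 2 `^ b by rewrite mulr_ge0 ?powR_ge0.
apply: le_trans (lqnormZ_le q0 c0 dyadic_lip_ge0).
set u := fun m => _.
have u0 m : (0 <= u m)%E by rewrite mule_ge0 ?lee_fin ?dyadic_lip_ge0.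
rewrite /Lip_seminorm; case: q q0 => [r r0|_|//] /=; last first.
  apply: ge_ereal_sup => _ [t /= t01 <-].
  have [m tm] := dyadic_itv_cover (t := t) (ltac:(by move: t01; rewrite in_itv)).
  apply: le_trans (w_le tm) _; by apply: ereal_sup_ubound; exists m.
have r0' : 0 <= r by rewrite ltW.
have tpos (t : R) : (t \in `]0%R, 1%R[) -> 0 < t by rewrite in_itv/= => /andP[].
apply: le_poweR; first by rewrite invr_ge0.
  apply: integral_ge0 => t /tpos t0; rewrite mule_ge0 ?poweR_ge0// lee_fin invr_ge0 ltW//.
pose c m := ((2 ^+ m.+1)%:E * u m `^ r)%E.
have cc0 m : (0 <= c m)%E by rewrite mule_ge0 ?poweR_ge0// lee_fin exprn_ge0.
apply: (@le_trans _ _ (\int[mu]_(t in `]0%R, 1%R[)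
    (\sum_(m <oo) c m * (\1_(dyadic_itv m) t)%:E))%E).
  apply: ge0_le_integral_any => t /= t01; have t0 := tpos t t01.
    by rewrite mule_ge0 ?poweR_ge0// lee_fin invr_ge0 ltW.
  have [m tm] := dyadic_itv_cover (t := t) (ltac:(by move: t01; rewrite in_itv)).
  apply: le_trans (le_dyadic_step cc0 tm).
  rewrite /c muleC; apply: lee_pmul; rewrite ?poweR_ge0 ?lee_fin ?invr_ge0 ?(ltW t0)//.
    by have /andP[] := itv_inv tm.
  by apply: le_poweR => //; [exact: w_ge0|exact: w_le].
rewrite integral_dyadic_step//; apply: lee_nneseries => [m _ _|m _].
  by rewrite mule_ge0// lee_fin exprn_ge0 ?invr_ge0.
rewrite /c muleAC -EFinM exprVn mulfV ?mul1e// expf_neq0//.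
Qed.

Lemma Lip_seminorm_lower : (lqnorm q (fun m => dyadic_lip m.+1) <=
  (pow2 alpha * (if q is r%:E then 2 `^ r^-1 else 1))%:E * Lip_seminorm alpha b p q f)%E.
Proof.
have d0 : 0 < pow2 alpha by exact: powR_gt0.
pose u m := (((pow2 alpha)^-1)%:E * dyadic_lip m.+1)%E.
have u0 m : (0 <= u m)%E by rewrite mule_ge0 ?lee_fin ?invr_ge0 ?(ltW d0) ?dyadic_lip_ge0.
have -> : (fun m => dyadic_lip m.+1) = fun m => ((pow2 alpha)%:E * u m)%E.
  by apply/funext => m; rewrite /u muleA -EFinM mulfV ?mul1e// gt_eqF.
apply: le_trans (lqnormZ_le q0 (ltW d0) u0) _.
rewrite EFinM -muleA lee_wpmul2l ?lee_fin ?(ltW d0)//.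
rewrite /Lip_seminorm; case: q q0 => [r r0|_|//] /=; last first.
  rewrite mul1e; apply: ge_ereal_sup => _ [m _ <-].
  have tm : dyadic_itv m (2^-1 ^+ m.+1).
    rewrite /dyadic_itv/= in_itv/= lexx/= exprS gtr_pMl ?exprn_gt0 ?invr_gt0//.
    by rewrite invf_lt1 ?ltr1n.
  apply: le_trans (le_w tm) _; apply: ereal_sup_ubound.
  by exists (2^-1 ^+ m.+1) => //; have := dyadic_itv_sub tm.
have r0' : 0 <= r by rewrite ltW.
have tpos (t : R) : (t \in `]0%R, 1%R[) -> 0 < t by rewrite in_itv/= => /andP[].
set I := (\int[mu]_(t in _) _)%E.
have I0 : (0 <= I)%E.
  by apply: integral_ge0 => t /tpos t0; rewrite mule_ge0 ?poweR_ge0// lee_fin invr_ge0 ltW.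
rewrite -poweR_EFin -poweRM ?lee_fin//.
apply: le_poweR; first by rewrite invr_ge0.
  by apply: nneseries_ge0 => m _ _; exact: poweR_ge0.
pose c m := ((2 ^+ m)%:E * u m `^ r)%E.
have cc0 m : (0 <= c m)%E by rewrite mule_ge0 ?poweR_ge0// lee_fin exprn_ge0.
apply: (@le_trans _ _ (2%:E * \int[mu]_(t in `]0%R, 1%R[)
    (\sum_(m <oo) c m * (\1_(dyadic_itv m) t)%:E))%E).
  rewrite integral_dyadic_step// -nneseriesZl; last first.
    by move=> m _; rewrite mule_ge0// lee_fin exprn_ge0 ?invr_ge0.
  apply: lee_nneseries => [m _ _|m _]; first exact: poweR_ge0.
  rewrite /c muleAC muleA -!EFinM le_eqVlt; apply/orP; left; apply/eqP.
  rewrite (_ : 2 * (2 ^+ m * 2^-1 ^+ m.+1) = 1) ?mul1e// exprS exprVn.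
  by field; rewrite expf_neq0.
apply: lee_wpmul2l; first by rewrite lee_fin.
apply: ge0_le_integral_any => t /= t01; have t0 := tpos t t01.
  by apply: nneseries_ge0 => m _ _; rewrite mule_ge0// lee_fin.
have [m tm] := dyadic_itv_cover (t := t) (ltac:(by move: t01; rewrite in_itv)).
apply: le_trans (dyadic_step_le cc0 tm) _.
rewrite /c muleC; apply: lee_pmul; rewrite ?poweR_ge0 ?lee_fin ?exprn_ge0//.
  by apply: le_poweR => //; exact: le_w.
by have /andP[] := itv_inv tm.
Qed.

End Function.
End LipDyadic.

(** * Dyadic form of the coefficient sums *)

Section CoefDyadic.
Context {R : realType}.
Variables (p C alpha : R).
Hypothesis p1 : 1 < p.
Hypothesis C0 : 0 < C.
Hypothesis alpha0 : 0 < alpha.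

Let p0 : 0 < p. Proof. by rewrite (lt_trans ltr01). Qed.

Lemma le_powR_add (x y : R) : 0 <= x -> 0 <= y ->
  (x + y) `^ p <= 2 `^ p * (x `^ p + y `^ p).
Proof.
move=> x0 y0; have := @poweRD_le R p x%:E y%:E (ltW p0) x0 y0.
by rewrite -EFinD !poweR_EFin -EFinD -EFinM lee_fin.
Qed.

Lemma powR_dyadic (e : R) n k : (0 < n)%N -> (n <= k <= n.*2)%N ->
  2 `^ (- `|e|) * n%:R `^ e <= k%:R `^ e /\ k%:R `^ e <= 2 `^ `|e| * n%:R `^ e :> R.
Proof.
move=> n0 /andP[nk kn]; have k0 := leq_trans n0 nk.
have nR : 0 < n%:R :> R by rewrite ltr0n.
have nk' : n%:R <= k%:R :> R by rewrite ler_nat.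
have kn' : k%:R <= 2 * n%:R :> R by rewrite -natrM ler_nat mul2n.
have kR : 0 < k%:R :> R by rewrite ltr0n.
have [e0|/ltW e0] := leP 0 e.
  rewrite ger0_norm//; split.
    rewrite (@le_trans _ _ (n%:R `^ e))//.
      rewrite ler_piMl ?powR_ge0// powRN invf_le1 ?powR_gt0//.
      by rewrite -[leLHS](powRr0 (2 : R)) ler_powR// ler1n.
    by apply: ge0_ler_powR; rewrite ?nnegrE.
  by rewrite -powRM//; apply: ge0_ler_powR; rewrite ?nnegrE ?mulr_ge0.
have [e' ee] : exists e', e = - e' by exists (- e); rewrite opprK.
move: e0; rewrite ee oppr_le0 => e'0; rewrite normrN ger0_norm//; split.
  rewrite -powRM//; apply: le_powRN => //.
rewrite (@le_trans _ _ (n%:R `^ (- e')))//; first exact: le_powRN.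
by rewrite ler_peMl ?powR_ge0// -[leLHS](powRr0 (2 : R)) ler_powR// ler1n.
Qed.

Local Notation e := (alpha * p + p - 2).

Definition coef_term (a b : nat -> R) (k : nat) : R :=
  k%:R `^ e * (a k `^ p + b k `^ p).

(** The block sizes of the derivative of order [alpha]. *)
Definition smooth_size (a b : nat -> R) (i : nat) : R :=
  pow2 alpha ^+ i * block_size p a b i.

Lemma smooth_size_powR (a b : nat -> R) i : 0 <= coef a b i ->
  smooth_size a b i `^ p = (2 ^ i)%:R * ((2 ^ i)%:R `^ e * coef a b i `^ p).
Proof.
move=> c0; have n0 : (0 : R) <= 2 ^+ i by rewrite exprn_ge0.
rewrite natrX /smooth_size /block_size /pow2 -!powRX// mulrA.
rewrite powRM ?mulr_ge0 ?powR_ge0// powRM ?powR_ge0// -!powRrM.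
rewrite [RHS]mulrA; congr (_ * _).
rewrite -[X in _ = X * _](powRr1 n0) -!powRD; last 2 first.
- by rewrite expf_neq0// implybT.
- by rewrite expf_neq0// implybT.
by congr (_ `^ _); field; rewrite gt_eqF.
Qed.

Lemma coef_sum_mono (a b : nat -> R) n m : (n <= m)%N ->
  Defs.coef_sum alpha p a b n <= Defs.coef_sum alpha p a b m.
Proof.
move=> nm; rewrite /Defs.coef_sum (@big_cat_nat _ _ _ n.+1 1 m.+1)//= lerDl.
by apply: sumr_ge0 => k _; rewrite mulr_ge0 ?addr_ge0 ?powR_ge0.
Qed.

Lemma coef_sum_ge0 (a b : nat -> R) n : 0 <= Defs.coef_sum alpha p a b n.
Proof. by apply: sumr_ge0 => k _; rewrite mulr_ge0 ?addr_ge0 ?powR_ge0. Qed.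

(** Each block is compared with both of its ends: the terms of index between
    [2 ^ i] and [2 ^ i.+1] are at most of the order of the first one and at least
    of the order of the last one. *)
Lemma coef_sum_dyadic : exists2 K : R, 0 < K & forall a b : nat -> R,
  (forall n, (0 < n)%N -> 0 <= a n) -> (forall n, (0 < n)%N -> 0 <= b n) ->
  gm_with C a -> gm_with C b -> forall m,
  Defs.coef_sum alpha p a b (2 ^ m) <= K * \sum_(0 <= i < m.+1) smooth_size a b i `^ p /\
  \sum_(0 <= i < m.+1) smooth_size a b i `^ p <= K * Defs.coef_sum alpha p a b (2 ^ m).
Proof.
have c10 : 0 < 1 + C by rewrite addr_gt0.
pose K1 := 2 `^ `|e| * ((1 + C) `^ p * 2).
pose K2 := 2 `^ p * (1 + C) `^ p * 2 `^ `|e| * 2 `^ (e + 1) + 2 `^ p.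
have K10 : 0 < K1 by rewrite !mulr_gt0 ?powR_gt0.
have K20 : 0 < K2 by rewrite addr_gt0 ?mulr_gt0 ?powR_gt0.
exists (K1 + K2); first by rewrite addr_gt0.
move=> a b a0 b0 ga gb m.
have cf i := coef_ge0 a0 b0 i.
have ab_le i k (c : nat -> R) : (forall n, (0 < n)%N -> 0 <= c n) -> gm_with C c ->
    (2 ^ i <= k <= (2 ^ i).*2)%N -> c k `^ p <= (1 + C) `^ p * c (2 ^ i)%N `^ p.
  move=> c0 gc ik; have n0 : (0 < 2 ^ i)%N by rewrite expn_gt0.
  have k0 : (0 < k)%N by have /andP[h _] := ik; exact: leq_trans h.
  rewrite -powRM ?c0// ?(ltW c10)//; apply: ge0_ler_powR; rewrite ?nnegrE ?c0 ?(ltW p0)//.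
    by rewrite mulr_ge0 ?c0 ?(ltW c10).
  exact: gm_le.
have ab_ge i k (c : nat -> R) : (forall n, (0 < n)%N -> 0 <= c n) -> gm_with C c ->
    (2 ^ i <= k < (2 ^ i).*2)%N -> c (2 ^ i.+1)%N `^ p <= (1 + C) `^ p * c k `^ p.
  move=> c0 gc /andP[ik ki]; have n0 : (0 < 2 ^ i)%N by rewrite expn_gt0.
  have k0 : (0 < k)%N by exact: leq_trans ik.
  have cn : 0 <= c (2 ^ i.+1)%N by rewrite c0// expn_gt0.
  rewrite -powRM ?c0// ?(ltW c10)//; apply: ge0_ler_powR; rewrite ?nnegrE ?(ltW p0)//.
    by rewrite mulr_ge0 ?c0 ?(ltW c10).
  by apply: gm_le => //; rewrite expnS mul2n (ltnW ki)/= leq_double.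
have c_le i (c : nat -> R) : 0 <= c (2 ^ i)%N -> c (2 ^ i)%N <= coef a b i ->
    c (2 ^ i)%N `^ p <= coef a b i `^ p.
  by move=> c0 cc; apply: ge0_ler_powR; rewrite ?nnegrE ?(ltW p0).
have ai i : 0 <= a (2 ^ i)%N by rewrite a0// expn_gt0.
have bi i : 0 <= b (2 ^ i)%N by rewrite b0// expn_gt0.
have term0 k : 0 <= coef_term a b k by rewrite mulr_ge0 ?addr_ge0 ?powR_ge0.
have ss0 i : 0 <= smooth_size a b i `^ p by exact: powR_ge0.
have up i : \sum_(2 ^ i <= k < (2 ^ i).*2) coef_term a b k <= K1 * smooth_size a b i `^ p.
  rewrite smooth_size_powR// mulrCA.
  apply: (@le_trans _ _ (\sum_(2 ^ i <= k < (2 ^ i).*2)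
      (K1 * ((2 ^ i)%:R `^ e * coef a b i `^ p)))).
    rewrite !big_nat; apply: ler_sum => k /andP[ik ki].
    have ik' : (2 ^ i <= k <= (2 ^ i).*2)%N by rewrite ik ltnW.
    have n0 : (0 < 2 ^ i)%N by rewrite expn_gt0.
    have [_ h] := powR_dyadic e n0 ik'.
    rewrite /coef_term /K1.
    rewrite [leRHS](_ : _ = (2 `^ `|e| * (2 ^ i)%:R `^ e) * ((1 + C) `^ p * (2 * coef a b i `^ p))); last by ring.
    apply: ler_pM => //; rewrite ?addr_ge0 ?powR_ge0//.
    have h1 := ab_le i k a a0 ga ik'; have h2 := ab_le i k b b0 gb ik'.
    have h3 := c_le i a (ai i) (ltac:(by rewrite lerDl)).
    have h4 := c_le i b (bi i) (ltac:(by rewrite lerDr)).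
    apply: le_trans (lerD h1 h2) _; rewrite -mulrDr ler_wpM2l ?powR_ge0//; lra.
  by rewrite sumr_const_nat -addnn addnK -[leLHS]mulr_natl.
have low i : smooth_size a b i.+1 `^ p <=
    2 `^ p * (1 + C) `^ p * 2 `^ `|e| * 2 `^ (e + 1) *
    \sum_(2 ^ i <= k < (2 ^ i).*2) coef_term a b k.
  rewrite smooth_size_powR//.
  have n0 : (0 < 2 ^ i)%N by rewrite expn_gt0.
  have nR : 0 < (2 ^ i)%:R :> R by rewrite ltr0n.
  have -> : (2 ^ i.+1)%:R * ((2 ^ i.+1)%:R `^ e * coef a b i.+1 `^ p) =
     2 `^ (e + 1) * ((2 ^ i)%:R * ((2 ^ i)%:R `^ e * coef a b i.+1 `^ p)).
    have -> : 2 `^ (e + 1) = 2 `^ e * 2 `^ 1 :> R.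
      by apply: (@powRD R 2 e 1); rewrite pnatr_eq0 implybT.
    by rewrite expnS natrM powRM// powRr1//; ring.
  rewrite [leRHS](_ : _ = 2 `^ (e + 1) * (2 `^ p * (1 + C) `^ p * 2 `^ `|e| *
    \sum_(2 ^ i <= k < (2 ^ i).*2) coef_term a b k)); last by ring.
  rewrite ler_wpM2l ?powR_ge0//.
  have -> : (2 ^ i)%:R * ((2 ^ i)%:R `^ e * coef a b i.+1 `^ p) =
     \sum_(2 ^ i <= k < (2 ^ i).*2) ((2 ^ i)%:R `^ e * coef a b i.+1 `^ p).
    by rewrite sumr_const_nat -addnn addnK mulr_natl.
  rewrite mulr_sumr !big_nat; apply: ler_sum => k /andP[ik ki].
  have ik' : (2 ^ i <= k <= (2 ^ i).*2)%N by rewrite ik ltnW.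
  have [h _] := powR_dyadic e n0 ik'.
  have h' : (2 ^ i)%:R `^ e <= 2 `^ `|e| * k%:R `^ e.
    have := ler_wpM2l (powR_ge0 2 `|e|) h.
    by rewrite mulrA powRN mulfV ?mul1r// gt_eqF// powR_gt0.
  rewrite /coef_term [leRHS](_ : _ = (2 `^ `|e| * k%:R `^ e) *
     (2 `^ p * ((1 + C) `^ p * a k `^ p + (1 + C) `^ p * b k `^ p))); last by ring.
  apply: ler_pM => //; rewrite ?powR_ge0//.
  have kk : (2 ^ i <= k < (2 ^ i).*2)%N by rewrite ik.
  have h1 := ab_ge i k a a0 ga kk; have h2 := ab_ge i k b b0 gb kk.
  apply: (@le_trans _ _ (2 `^ p * (a (2 ^ i.+1)%N `^ p + b (2 ^ i.+1)%N `^ p))).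
    by apply: le_powR_add; rewrite ?ai ?bi.
  by rewrite ler_wpM2l ?powR_ge0// lerD.
have S0 n := coef_sum_ge0 a b n.
have Sm k : (0 < k)%N -> \sum_(1 <= n < k) coef_term a b n <= Defs.coef_sum alpha p a b k.
  by move=> k0; rewrite /Defs.coef_sum big_nat_recr//= lerDl term0.
split.
  have h1 : Defs.coef_sum alpha p a b (2 ^ m) <= \sum_(1 <= k < 2 ^ m.+1) coef_term a b k.
    rewrite /Defs.coef_sum (@big_cat_nat _ _ _ (2 ^ m).+1 1 (2 ^ m.+1))//=.
      by rewrite lerDl sumr_ge0.
    by rewrite ltn_exp2l.
  apply: le_trans h1 _; rewrite -dyadic_blocks mulr_sumr.
  apply: ler_sum => i _; apply: le_trans (up i) _.
  by rewrite ler_wpM2r// lerDl ltW.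
rewrite big_nat_recl//=.
have h0 : smooth_size a b 0 `^ p <= 2 `^ p * Defs.coef_sum alpha p a b (2 ^ m).
  apply: (@le_trans _ _ (2 `^ p * coef_term a b 1)).
    rewrite smooth_size_powR// expn0 powR1 !mul1r /coef_term powR1 mul1r.
    by apply: le_powR_add; [exact: a0|exact: b0].
  rewrite ler_wpM2l ?powR_ge0//.
  apply: le_trans (_ : Defs.coef_sum alpha p a b 1 <= _).
    by rewrite /Defs.coef_sum big_nat1.
  by apply: coef_sum_mono; rewrite expn_gt0.
have h1 : \sum_(0 <= i < m) smooth_size a b i.+1 `^ p <=
    2 `^ p * (1 + C) `^ p * 2 `^ `|e| * 2 `^ (e + 1) * Defs.coef_sum alpha p a b (2 ^ m).
  apply: le_trans (_ : 2 `^ p * (1 + C) `^ p * 2 `^ `|e| * 2 `^ (e + 1) *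
     \sum_(1 <= k < 2 ^ m) coef_term a b k <= _).
    by rewrite -dyadic_blocks mulr_sumr; apply: ler_sum => i _; exact: low.
  by rewrite ler_wpM2l ?mulr_ge0 ?powR_ge0// Sm// expn_gt0.
have h2 : 0 <= K1 * Defs.coef_sum alpha p a b (2 ^ m) by rewrite mulr_ge0 ?(ltW K10).
apply: le_trans (lerD h0 h1) _; rewrite -mulrDl [leRHS]mulrDl -/K2.
by rewrite [X in X * _]addrC -/K2 lerDr.
Qed.

End CoefDyadic.

Section CoefNorm.
Context {R : realType}.
Variables (p alpha b : R) (q : \bar R).
Hypothesis p1 : 1 < p.
Hypothesis b0 : 0 <= b.
Hypothesis q0 : (0 < q)%E.

Let p0 : 0 < p. Proof. by rewrite (lt_trans ltr01). Qed.

Definition coef_size (u v : nat -> R) (m : nat) : R :=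
  Defs.coef_sum alpha p u v (2 ^ m) `^ p^-1.

Definition weighted_coef (u v : nat -> R) (m : nat) : R :=
  (1 + m%:R) `^ (- b) * coef_size u v m.

Lemma weighted_coef_ge0 u v m : 0 <= weighted_coef u v m.
Proof. by rewrite mulr_ge0 ?powR_ge0. Qed.

Variables (u v : nat -> R).
Local Notation S := (Defs.coef_sum alpha p u v).

Definition log_coef (n : nat) : R := (1 + ln n%:R) `^ (- b) * S n `^ p^-1.

Lemma log_coef_dyadic m n : (2 ^ m <= n < (2 ^ m).*2)%N ->
  log_coef n <= 4 `^ b * weighted_coef u v m.+1 /\
  2 `^ (- b) * weighted_coef u v m <= log_coef n.
Proof.
move=> /andP[mn nm]; have /andP[l1 l2] := @ln2_bounds R.
have n0 : (0 < n)%N by rewrite (leq_trans _ mn)// expn_gt0.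
have m0 : 0 <= m%:R :> R by [].
have lm : m%:R / 2 <= ln n%:R :> R.
  apply: (@le_trans _ _ (ln (2 ^ m)%:R)).
    by rewrite natrX lnXn// -[ln 2 *+ m]mulr_natl ler_wpM2l//; lra.
  by rewrite ler_ln ?posrE ?ltr0n ?expn_gt0// ler_nat.
have lM : ln n%:R <= 1 + m%:R :> R.
  apply: (@le_trans _ _ (ln (2 ^ m.+1)%:R)).
    by rewrite ler_ln ?posrE ?ltr0n ?expn_gt0// ler_nat expnS mul2n ltnW.
  by rewrite natrX lnXn// -[ln 2 *+ m.+1]mulr_natl -natr1 addrC -[leRHS]mulr1 ler_wpM2l//; lra.
have S_ge0 k : 0 <= S k by exact: coef_sum_ge0.
have Smono k l : (k <= l)%N -> S k `^ p^-1 <= S l `^ p^-1.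
  move=> kl; apply: ge0_ler_powR; rewrite ?nnegrE ?invr_ge0 ?(ltW p0)//.
  exact: coef_sum_mono.
have mS : m.+1%:R = 1 + m%:R :> R by rewrite -natr1 addrC.
rewrite /log_coef /weighted_coef /coef_size !mulrA; split.
  apply: ler_pM; rewrite ?powR_ge0//; last first.
    by apply: Smono; rewrite expnS mul2n ltnW.
  have -> : 4 `^ b = (4^-1) `^ (- b) :> R.
    by rewrite -[4^-1]powR_inv1// -powRrM mulrNN mul1r.
  rewrite -powRM ?invr_ge0 ?addr_ge0//; apply: le_powRN => //; rewrite ?mS; lra.
apply: ler_pM; rewrite ?mulr_ge0 ?powR_ge0//; last exact: Smono.
by rewrite -powRM ?addr_ge0//; apply: le_powRN => //; lra.
Qed.

Lemma coef_norm_upper :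
  (coef_norm alpha b p q u v <= (4 `^ b)%:E *
   lqnorm q (fun m => (weighted_coef u v m)%:E))%E.
Proof.
have w0 m : (0 <= (weighted_coef u v m)%:E)%E by rewrite lee_fin weighted_coef_ge0.
apply: le_trans (_ : ((4 `^ b)%:E * lqnorm q (fun m => (weighted_coef u v (m + 1))%:E) <= _)%E);
  last first.
  rewrite lee_wpmul2l ?lee_fin ?powR_ge0//.
  exact: (lqnorm_shift q0 1 w0).
apply: le_trans (lqnormZ_le q0 (powR_ge0 _ _) (fun m => w0 (m + 1)%N)).
rewrite /coef_norm; case: q q0 => [r r0|_|//] /=; last first.
  apply: ge_ereal_sup => _ [n n0 <-].
  have [h _] := @log_coef_dyadic (trunc_log 2 n) n (ltac:(by rewrite trunc_logP//= -mul2n -expnS trunc_log_ltn)).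
  apply: le_trans (_ : ((4 `^ b * weighted_coef u v (trunc_log 2 n).+1)%:E <= _)%E).
    by rewrite lee_fin.
  by apply: ereal_sup_ubound; exists (trunc_log 2 n) => //; rewrite addn1 EFinM.
have r0' : 0 <= r by rewrite ltW.
pose t n := log_coef n `^ r / n%:R.
have tE n : (1 + ln n%:R) `^ (- (b * r)) * S n `^ (r / p) / n%:R = t n.
  by rewrite /t /log_coef powRM ?powR_ge0// -!powRrM mulNr [r / p]mulrC.
have t0 n : 0 <= t n by rewrite divr_ge0 ?powR_ge0.
under eq_eseriesr do rewrite tE.
apply: le_poweR; first by rewrite invr_ge0.
  by apply: nneseries_ge0 => n _ _; rewrite lee_fin.
set V := (\sum_(m <oo) _)%E.
apply: lime_le; first by apply: is_cvg_nneseries => n _ _; rewrite lee_fin.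
apply: nearW => N; apply: (@le_trans _ _ (\sum_(1 <= n < 2 ^ N) (t n)%:E)%E).
  rewrite !sumEFin lee_fin; have [N1|N1] := leqP N 1.
    by rewrite big_geq// sumr_ge0.
  rewrite (@big_cat_nat _ _ _ N 1 (2 ^ N))//=; [|exact: ltnW|by rewrite ltnW// ltn_expl].
  by rewrite lerDl sumr_ge0.
rewrite sumEFin -dyadic_blocks -sumEFin.
apply: (@le_trans _ _ (\sum_(0 <= m < N) ((4 `^ b * weighted_coef u v (m + 1)) `^ r)%:E)%E).
  apply: lee_sum => m _; rewrite lee_fin.
  set B := (_ * _) `^ r.
  apply: (@le_trans _ _ (\sum_(2 ^ m <= n < (2 ^ m).*2) (B / (2 ^ m)%:R))).
    rewrite !big_nat; apply: ler_sum => n hn; have [h _] := log_coef_dyadic hn.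
    have /andP[mn _] := hn.
    apply: ler_pM; rewrite ?powR_ge0 ?invr_ge0//.
      apply: ge0_ler_powR; rewrite ?nnegrE ?addn1 ?mulr_ge0 ?powR_ge0//.
    by rewrite lef_pV2 ?posrE ?ltr0n ?expn_gt0 ?ler_nat// (leq_trans _ mn)// expn_gt0.
  rewrite sumr_const_nat -addnn addnK -[leLHS]mulr_natr divfK//.
by apply: nneseries_lim_ge => m _ _; rewrite lee_fin powR_ge0.
Qed.

Lemma coef_norm_lower :
  (lqnorm q (fun m => (weighted_coef u v m)%:E) <=
   (2 `^ b * (if q is r%:E then 2 `^ r^-1 else 1))%:E * coef_norm alpha b p q u v)%E.
Proof.
have B0 : 0 < 2 `^ b :> R by rewrite powR_gt0.
pose y m := (2 `^ (- b) * weighted_coef u v m)%:E.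
have y0 m : (0 <= y m)%E by rewrite lee_fin mulr_ge0 ?powR_ge0 ?weighted_coef_ge0.
have -> : (fun m => (weighted_coef u v m)%:E) = fun m => ((2 `^ b)%:E * y m)%E.
  by apply/funext => m; rewrite /y -EFinM mulrA powRN mulfV ?mul1r// gt_eqF.
apply: le_trans (lqnormZ_le q0 (ltW B0) y0) _.
rewrite EFinM -muleA lee_wpmul2l ?lee_fin ?(ltW B0)//.
have dyad m : (2 ^ m <= 2 ^ m < (2 ^ m).*2)%N.
  by rewrite leqnn/= -addnn -[ltnLHS]addn0 ltn_add2l expn_gt0.
rewrite /coef_norm; case: q q0 => [r r0|_|//] /=; last first.
  rewrite mul1e; apply: ge_ereal_sup => _ [m _ <-].
  have [_ h] := log_coef_dyadic (dyad m).
  apply: le_trans (_ : ((log_coef (2 ^ m))%:E <= _)%E); first by rewrite lee_fin.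
  by apply: ereal_sup_ubound; exists (2 ^ m)%N => //=; rewrite expn_gt0.
have r0' : 0 <= r by rewrite ltW.
pose t n := log_coef n `^ r / n%:R.
have tE n : (1 + ln n%:R) `^ (- (b * r)) * S n `^ (r / p) / n%:R = t n.
  by rewrite /t /log_coef powRM ?powR_ge0// -!powRrM mulNr [r / p]mulrC.
have t0 n : 0 <= t n by rewrite divr_ge0 ?powR_ge0.
under [X in (_ <= _ * X `^ _)%E]eq_eseriesr do rewrite tE.
set T := (\sum_(1 <= n <oo) _)%E.
have T0 : (0 <= T)%E by apply: nneseries_ge0 => n _ _; rewrite lee_fin.
rewrite -poweR_EFin -poweRM ?lee_fin//.
apply: le_poweR; first by rewrite invr_ge0.
  by apply: nneseries_ge0 => m _ _; rewrite lee_fin powR_ge0.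
apply: nneseries_le => [m|M]; first by rewrite lee_fin powR_ge0.
apply: (@le_trans _ _ (2%:E * (\sum_(1 <= n < 2 ^ M) t n)%:E)%E); last first.
  rewrite lee_wpmul2l ?lee_fin// -sumEFin.
  by apply: nneseries_lim_ge => n _ _; rewrite lee_fin.
rewrite -dyadic_blocks -EFinM mulr_sumr -sumEFin.
apply: lee_sum => m _; rewrite lee_fin.
set B := (_ * _) `^ r.
apply: (@le_trans _ _ (2 * \sum_(2 ^ m <= n < (2 ^ m).*2) (B / (2 ^ m.+1)%:R))).
  rewrite sumr_const_nat -addnn addnK -[X in 2 * X]mulr_natr expnS natrM.
  rewrite le_eqVlt; apply/orP; left; apply/eqP; field.
  by rewrite pnatr_eq0 -lt0n expn_gt0.
rewrite ler_wpM2l// !big_nat; apply: ler_sum => n hn; have [_ h] := log_coef_dyadic hn.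
have /andP[mn nm] := hn.
apply: ler_pM; rewrite ?powR_ge0 ?invr_ge0//.
  apply: ge0_ler_powR; rewrite ?nnegrE ?mulr_ge0 ?powR_ge0//.
rewrite lef_pV2 ?posrE ?ltr0n ?expn_gt0 ?ler_nat//.
  by rewrite expnS mul2n ltnW.
by rewrite (leq_trans _ mn)// expn_gt0.
Qed.

End CoefNorm.

(** * Norm equivalence *)

Section NormEquivalence.
Context {R : realType}.
Local Notation mu := (@lebesgue_measure R).
Variables (p C alpha b : R) (q : \bar R).
Hypothesis p1 : 1 < p.
Hypothesis C0 : 0 < C.
Hypothesis alpha0 : 0 < alpha.
Hypothesis b0 : 0 <= b.
Hypothesis q0 : (0 < q)%E.

Let p0 : 0 < p. Proof. by rewrite (lt_trans ltr01). Qed.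
Let ip0 : 0 <= p^-1. Proof. by rewrite invr_ge0 ltW. Qed.

(** Bernoulli's inequality for [2 ^ (beta * k)], raised to the power [b], where
    [beta] is so small that [beta * b <= alpha / 2]. *)
Lemma polynomial_le_exponential : exists2 K : R, 0 < K &
  forall k : nat, (1 + k%:R) `^ b <= K * pow2 (alpha / 2) ^+ k.
Proof.
have bp : 0 < b + 1 by rewrite ltr_wpDl.
pose beta := alpha / 2 / (b + 1).
have be0 : 0 < beta by rewrite !divr_gt0.
have d1 : 1 < pow2 beta := pow2_gt1 be0.
pose delta := pow2 beta - 1; have de0 : 0 < delta by rewrite subr_gt0.
have bern k : 1 + k%:R * delta <= pow2 beta ^+ k.
  rewrite (_ : pow2 beta = 1 + delta); last by rewrite /delta addrC subrK.
  by apply: bernoulli_le; rewrite ltW// (lt_trans _ de0)// oppr_lt0.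
pose c := Num.min 1 delta.
have c0 : 0 < c by rewrite lt_min ltr01.
exists ((c^-1) `^ b); first by rewrite powR_gt0// invr_gt0.
move=> k; have k0 : 0 <= k%:R :> R by [].
have db0 : 0 <= pow2 beta ^+ k by rewrite exprn_ge0// powR_ge0.
have h : 1 + k%:R <= c^-1 * pow2 beta ^+ k.
  rewrite mulrC ler_pdivlMr// mulrDl mul1r.
  apply: le_trans (bern k); apply: lerD; first by rewrite ge_min lexx.
  by rewrite ler_wpM2l// ge_min lexx orbT.
apply: (@le_trans _ _ ((c^-1 * pow2 beta ^+ k) `^ b)).
  by apply: ge0_ler_powR; rewrite ?nnegrE ?addr_ge0 ?mulr_ge0 ?invr_ge0 ?(ltW c0).
rewrite powRM ?invr_ge0 ?(ltW c0)// ler_wpM2l ?powR_ge0//.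
rewrite powRX ?powR_ge0// lerXn2r ?nnegrE ?powR_ge0//.
rewrite /pow2 -powRrM ler_powR ?ler1n//.
rewrite /beta -mulrA ler_piMr ?divr_ge0 ?(ltW alpha0)// mulrC ler_pdivrMr// mul1r lerDl//.
Qed.

Lemma sum_powR_le (y : nat -> R) n : (forall i, 0 <= y i) ->
  \sum_(0 <= i < n) y i `^ p <= (\sum_(0 <= i < n) y i) `^ p.
Proof.
move=> y0; set T := \sum_(0 <= i < n) y i.
have T0 : 0 <= T by apply: sumr_ge0.
have pm : 0 <= p - 1 by rewrite subr_ge0 ltW.
have yT i : (i < n)%N -> y i <= T.
  move=> im; rewrite /T (bigD1_seq i) ?mem_index_iota ?iota_uniq//= lerDl.
  by apply: sumr_ge0.
rewrite -(mulr_powRB1 T0 p0) {1}/T mulr_suml [leLHS]big_nat [leRHS]big_nat.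
apply: ler_sum => i /andP[_ im].
rewrite -(mulr_powRB1 (y0 i) p0) ler_wpM2l//.
by apply: ge0_ler_powR; rewrite ?nnegrE ?yT.
Qed.

Definition decay : R := (pow2 (alpha / 2))^-1.

Lemma decay01 : 0 <= decay < 1.
Proof.
have d1 : 1 < pow2 (alpha / 2) by rewrite pow2_gt1// divr_gt0.
by rewrite invr_ge0 ltW ?(lt_trans ltr01)//= invf_lt1// (lt_trans ltr01).
Qed.

Local Notation Z a c := (coef_size p alpha a c).
Local Notation Q a c := (weighted_coef p alpha b a c).

(** The blocks up to the index [m] add up to the coefficient sum of length
    [2 ^ m], that is to the diagonal term; each block beyond [m] is bounded by the
    coefficient sum of its own index, and half of the decay
    [2 ^ (- alpha * (i - m))] absorbs the ratio of the logarithmic weights. *)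
Lemma weighted_blocks_le : exists2 K : R, 0 < K & forall u v : nat -> R,
  (forall n, (0 < n)%N -> 0 <= u n) -> (forall n, (0 < n)%N -> 0 <= v n) ->
  gm_with C u -> gm_with C v -> forall m,
  ((dyadic_weight alpha b m)%:E *
    (\sum_(i <oo) (((pow2 alpha)^-1 ^+ (m - i) * block_size p u v i) `^ p)%:E) `^ p^-1 <=
   K%:E * \sum_(i <oo) (decay ^+ dist m i)%:E * (Q u v i)%:E)%E.
Proof.
have [K1 K10 HK1] := coef_sum_dyadic alpha p1 C0.
have [K2 K20 HK2] := polynomial_le_exponential.
exists ((2 * K1) `^ p^-1 * K2); first by rewrite mulr_gt0 ?powR_gt0 ?mulr_gt0.
move=> u v u0 v0 gu gv m.
have d0 : 0 < pow2 alpha by exact: powR_gt0.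
have dm0 k : 0 <= pow2 alpha ^+ k by rewrite exprn_ge0 ?powR_ge0.
have di0 k : 0 <= (pow2 alpha)^-1 ^+ k by rewrite exprn_ge0 ?invr_ge0 ?powR_ge0.
have X0 i : 0 <= block_size p u v i.
  by apply: mulr_ge0; [rewrite exprn_ge0 ?powR_ge0|exact: coef_ge0].
have Z0 i : 0 <= Z u v i by exact: powR_ge0.
have ZE i : Z u v i `^ p = Defs.coef_sum alpha p u v (2 ^ i).
  by rewrite -powRrM mulVf ?gt_eqF// powRr1// coef_sum_ge0.
pose y i := (pow2 alpha)^-1 ^+ (m - i) * block_size p u v i.
pose t i := (m <= i)%:R * ((pow2 alpha)^-1 ^+ (i - m) * Z u v i).
have y0 i : 0 <= y i by apply: mulr_ge0.
have t0 i : 0 <= t i by apply: mulr_ge0 => //; apply: mulr_ge0.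
have s0 i : 0 <= smooth_size p alpha u v i by apply: mulr_ge0.
have low i : (i <= m)%N -> pow2 alpha ^+ m * y i = smooth_size p alpha u v i.
  move=> im; rewrite /y /smooth_size mulrA; congr (_ * _).
  by rewrite -{1}(subnK im) exprD exprVn mulrAC mulfV ?mul1r// expf_neq0 ?gt_eqF.
have high i : (m <= i)%N -> (pow2 alpha ^+ m * y i) `^ p <= K1 * t i `^ p.
  move=> mi; have -> : pow2 alpha ^+ m * y i = (pow2 alpha)^-1 ^+ (i - m) * smooth_size p alpha u v i.
    rewrite /y /smooth_size; set X := block_size _ _ _ _.
    rewrite (eqP mi) expr0 mul1r [RHS]mulrA; congr (_ * X).
    by rewrite -{2}(subnK mi) exprD mulrA exprVn mulVf ?mul1r// expf_neq0 ?gt_eqF.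
  rewrite /t mi mul1r (powRM _ (di0 _) (s0 _)) (powRM _ (di0 _) (Z0 _)).
  rewrite [leRHS]mulrCA ler_wpM2l ?powR_ge0// ZE.
  have [_ h] := HK1 u v u0 v0 gu gv i; apply: le_trans h.
  by rewrite big_nat_recr//= lerDr; apply: sumr_ge0 => k _; exact: powR_ge0.
pose T := (\sum_(i <oo) (t i)%:E)%E.
have T0 : (0 <= T)%E by apply: nneseries_ge0 => i _ _; rewrite lee_fin.
have ZT : ((Z u v m)%:E <= T)%E.
  have -> : Z u v m = t m by rewrite /t leqnn subnn expr0 !mul1r.
  by apply: (nneseries_term_le (u := fun i => (t i)%:E)) => i; rewrite lee_fin.
have main : (\sum_(i <oo) ((pow2 alpha ^+ m * y i) `^ p)%:E <= (2 * K1)%:E * T `^ p)%E.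
  apply: nneseries_le => [i|n]; first by rewrite lee_fin powR_ge0.
  apply: (@le_trans _ _ (\sum_(0 <= i < m.+1 + n) ((pow2 alpha ^+ m * y i) `^ p)%:E)%E).
    rewrite (@big_cat_nat _ _ _ n 0 (m.+1 + n))//= ?leq_addl//.
    by rewrite leeDl// sume_ge0// => i _; rewrite lee_fin powR_ge0.
  rewrite (@big_cat_nat _ _ _ m.+1 0 (m.+1 + n))//= ?leq_addr//.
  have -> : ((2 * K1)%:E * T `^ p = K1%:E * T `^ p + K1%:E * T `^ p)%E.
    rewrite mulr_natl mulr2n EFinD ge0_muleDl// lee_fin ltW//.
  apply: leeD.
    apply: (@le_trans _ _ (K1%:E * (Z u v m)%:E `^ p)%E); last first.
      rewrite lee_wpmul2l ?lee_fin ?(ltW K10)//.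
      by apply: le_poweR => //; rewrite ?lee_fin ?(ltW p0).
    rewrite poweR_EFin -EFinM ZE sumEFin lee_fin.
    have [_ h] := HK1 u v u0 v0 gu gv m; apply: le_trans h.
    by rewrite !big_nat; apply: ler_sum => i /andP[_ im]; rewrite low.
  apply: (@le_trans _ _ (K1 * (\sum_(0 <= i < m.+1 + n) t i `^ p))%:E).
    rewrite sumEFin lee_fin mulr_sumr.
    rewrite [leRHS](@big_cat_nat _ _ _ m.+1 0 (m.+1 + n))//= ?leq_addr//.
    rewrite -[leLHS]add0r lerD//.
      by apply: sumr_ge0 => i _; rewrite mulr_ge0 ?powR_ge0 ?(ltW K10).
    by rewrite !big_nat; apply: ler_sum => i /andP[mi _]; apply: high; exact: ltnW.
  rewrite EFinM lee_wpmul2l ?lee_fin ?(ltW K10)//.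
  apply: (@le_trans _ _ ((\sum_(0 <= i < m.+1 + n) t i)%:E `^ p)%E).
    by rewrite poweR_EFin lee_fin sum_powR_le.
  apply: le_poweR; rewrite ?(ltW p0)// ?lee_fin ?sumr_ge0//.
  by rewrite -sumEFin; apply: nneseries_lim_ge => i _ _; rewrite lee_fin.
pose w := (1 + m%:R) `^ (- b) : R; have w0 : 0 <= w by exact: powR_ge0.
have -> : dyadic_weight alpha b m = w * pow2 alpha ^+ m by rewrite mulrC.
have -> : ((w * pow2 alpha ^+ m)%:E *
  (\sum_(i <oo) (((pow2 alpha)^-1 ^+ (m - i) * block_size p u v i) `^ p)%:E) `^ p^-1 =
  w%:E * (\sum_(i <oo) ((pow2 alpha ^+ m * y i) `^ p)%:E) `^ p^-1)%E.
  rewrite EFinM -muleA; congr (_ * _)%E.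
  under [in RHS]eq_eseriesr do rewrite powRM// EFinM.
  rewrite nneseriesZl; last by move=> i _; rewrite lee_fin powR_ge0.
  rewrite poweRM ?lee_fin ?powR_ge0//; last first.
    by apply: nneseries_ge0 => i _ _; rewrite lee_fin powR_ge0.
  by rewrite poweR_EFin -powRrM mulfV ?gt_eqF// powRr1.
apply: (@le_trans _ _ (w%:E * (((2 * K1) `^ p^-1)%:E * T))%E).
  rewrite lee_wpmul2l ?lee_fin//.
  have -> : (((2 * K1) `^ p^-1)%:E * T = ((2 * K1)%:E * T `^ p) `^ p^-1)%E.
    rewrite poweRM ?poweR_ge0 ?lee_fin ?mulr_ge0 ?(ltW K10)//.
    by rewrite poweR_EFin -poweRrM mulfV ?gt_eqF// poweRe1.
  apply: le_poweR => //.
  by apply: nneseries_ge0 => i _ _; rewrite lee_fin powR_ge0.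
rewrite muleCA [X in (_ <= X * _)%E]EFinM -muleA lee_wpmul2l ?lee_fin ?powR_ge0//.
have /andP[l0 l1] := decay01.
rewrite /T -!nneseriesZl; last 2 first.
- by move=> i _; rewrite mule_ge0 ?lee_fin ?exprn_ge0 ?weighted_coef_ge0.
- by move=> i _; rewrite lee_fin.
apply: lee_nneseries => [i _ _|i _]; first by rewrite mule_ge0 ?lee_fin.
rewrite -!EFinM lee_fin /t; case: leqP => mi; last first.
  by rewrite mul0r mulr0 !mulr_ge0 ?exprn_ge0 ?weighted_coef_ge0 ?(ltW K20).
rewrite mul1r /dist (eqP mi) add0n /weighted_coef.
set k := (i - m)%N; have ik : i = (k + m)%N by rewrite subnK.
have m1 : 0 < 1 + m%:R :> R by rewrite ltr_pwDl.
have k1 : 0 < 1 + k%:R :> R by rewrite ltr_pwDl.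
have i1 : 0 < 1 + i%:R :> R by rewrite ltr_pwDl.
have wle : w <= (1 + k%:R) `^ b * (1 + i%:R) `^ (- b).
  have -> : (1 + k%:R) `^ b = (1 + k%:R)^-1 `^ (- b) :> R.
    by rewrite -[_^-1]powR_inv1 ?(ltW k1)// -powRrM mulrNN mul1r.
  rewrite -powRM ?invr_ge0 ?(ltW k1) ?(ltW i1)//; apply: le_powRN => //.
  rewrite mulrC ler_pdivrMr// ik natrD.
  have : 0 <= m%:R * k%:R :> R by rewrite mulr_ge0.
  by lra.
have hk := HK2 k.
have dk : (pow2 alpha)^-1 ^+ k * pow2 (alpha / 2) ^+ k = decay ^+ k.
  have da : pow2 alpha = pow2 (alpha / 2) * pow2 (alpha / 2).
    rewrite /pow2 -powRD; last by rewrite pnatr_eq0 implybT.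
    by congr (_ `^ _); field.
  have dh : pow2 (alpha / 2) != 0 :> R by rewrite gt_eqF// powR_gt0.
  by rewrite /decay -exprMn da invfM -mulrA mulVf ?mulr1.
apply: (@le_trans _ _ ((K2 * pow2 (alpha / 2) ^+ k * (1 + i%:R) `^ (- b)) *
    ((pow2 alpha)^-1 ^+ k * Z u v i))).
  rewrite ler_wpM2r ?mulr_ge0//; apply: (le_trans wle).
  by rewrite ler_wpM2r ?powR_ge0.
by rewrite -dk le_eqVlt; apply/orP; left; apply/eqP; ring.
Qed.

Lemma Lp_norm_torusE (F : R -> R) :
  Lp_norm_torus p F = ((\int[mu]_(x in torus) (`|F x|%:E `^ p)) `^ p^-1)%E.
Proof. by apply: Lnorm_restrict; [exact: measurable_torus|rewrite gt_eqF]. Qed.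

(** At every scale the difference is bounded by a geometric convolution of the
    weighted coefficient sums, which is bounded on [l_q]; the norm of [f] itself
    is the term of scale one. *)
Lemma Lip_norm_upper : exists2 K : R, 0 < K &
  forall (f : R -> R) (u v : nat -> R), in_L1_torus f -> has_fourier_series f u v ->
  (forall n, (0 < n)%N -> 0 <= u n) -> (forall n, (0 < n)%N -> 0 <= v n) ->
  gm_with C u -> gm_with C v ->
  (Lip_norm alpha b p q f <= K%:E * coef_norm alpha b p q u v)%E.
Proof.
have [K1 K10 HK1] := frac_diff_upper p1 C0 alpha0.
have [K2 K20 HK2] := function_upper p1 C0.
have [K3 K30 HK3] := weighted_blocks_le.
have [K4 K40 HK4] := lqnorm_conv q0 decay01.
pose L := 2 `^ b * (if q is r%:E then 2 `^ r^-1 else 1) : R.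
have L0 : 0 < L by rewrite /L; case: (q) => [r||]; rewrite mulr_gt0 ?powR_gt0.
pose M := pow2 alpha * 2 `^ b : R.
have M0 : 0 < M by rewrite mulr_gt0 ?powR_gt0.
pose k1 := K1 `^ p^-1 * K3; have k10 : 0 < k1 by rewrite mulr_gt0 ?powR_gt0.
pose k2 := K2 `^ p^-1 * K3; have k20 : 0 < k2 by rewrite mulr_gt0 ?powR_gt0.
exists ((k2 + M * k1) * K4 * L).
  by do 2 apply: mulr_gt0 => //; apply: addr_gt0 => //; exact: mulr_gt0.
move=> f u v L1f fS u0 v0 gu gv.
pose cv m := (\sum_(i <oo) (decay ^+ dist m i)%:E * (Q u v i)%:E)%E.
have /andP[l0 l1] := decay01.
have Q0 i : (0 <= (Q u v i)%:E)%E by rewrite lee_fin weighted_coef_ge0.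
have cv0 m : (0 <= cv m)%E.
  by apply: nneseries_ge0 => i _ _; rewrite mule_ge0// lee_fin exprn_ge0.
have sum0 m : (0 <= \sum_(i <oo)
    (((pow2 alpha)^-1 ^+ (m - i) * block_size p u v i) `^ p)%:E)%E.
  by apply: nneseries_ge0 => i _ _; rewrite lee_fin powR_ge0.
have lip m : (dyadic_lip alpha b p f m <= k1%:E * cv m)%E.
  apply: (@le_trans _ _ ((dyadic_weight alpha b m)%:E * ((K1 `^ p^-1)%:E *
    (\sum_(i <oo) (((pow2 alpha)^-1 ^+ (m - i) * block_size p u v i) `^ p)%:E) `^ p^-1))%E).
    rewrite lee_wpmul2l ?lee_fin ?dyadic_weight_ge0//.
    apply: ge_ereal_sup => _ [h /= hm <-]; rewrite Lp_norm_torusE.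
    rewrite -[X in (_ <= X * _)%E]poweR_EFin -poweRM ?lee_fin ?(ltW K10)//.
    apply: le_poweR => //; first by apply: integral_ge0 => x _; exact: poweR_ge0.
    apply: HK1 => //.
    by move: hm; rewrite exprVn -[leRHS]mul1r ler_pdivlMr ?exprn_gt0// natrX mulrC.
  have -> : (k1%:E * cv m = (K1 `^ p^-1)%:E * (K3%:E * cv m))%E by rewrite muleA -EFinM.
  rewrite muleCA lee_wpmul2l ?lee_fin ?powR_ge0//.
  exact: HK3.
have fn : (Lp_norm_torus p f <= k2%:E * cv 0%N)%E.
  rewrite Lp_norm_torusE.
  apply: (@le_trans _ _ ((K2 `^ p^-1)%:E * ((dyadic_weight alpha b 0)%:E *
    (\sum_(i <oo) (((pow2 alpha)^-1 ^+ (0 - i) * block_size p u v i) `^ p)%:E) `^ p^-1))%E).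
    have -> : dyadic_weight alpha b 0 = 1 by rewrite /dyadic_weight expr0 addr0 powR1 mulr1.
    rewrite mul1e -[X in (_ <= X * _)%E]poweR_EFin -poweRM ?lee_fin ?(ltW K20)//.
    apply: le_poweR => //; first by apply: integral_ge0 => x _; exact: poweR_ge0.
    by under [X in (_ <= _ * X)%E]eq_eseriesr do rewrite sub0n expr0 mul1r; exact: HK2.
  have -> : (k2%:E * cv 0%N = (K2 `^ p^-1)%:E * (K3%:E * cv 0%N))%E by rewrite muleA -EFinM.
  rewrite lee_wpmul2l ?lee_fin ?powR_ge0//.
  exact: HK3.
have Mk1 : 0 <= M * k1 := mulr_ge0 (ltW M0) (ltW k10).
have N0 : (0 <= lqnorm q cv)%E by exact: lqnorm_ge0.
apply: (@le_trans _ _ ((k2 + M * k1)%:E * lqnorm q cv)%E).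
  rewrite EFinD ge0_muleDl ?lee_fin ?Mk1 ?(ltW k20)//.
  apply: leeD.
    apply: (le_trans fn); rewrite lee_wpmul2l ?lee_fin ?(ltW k20)//.
    exact: lqnorm_term.
  apply: le_trans (Lip_seminorm_upper p alpha0 b0 q0 f) _ => //.
  have -> : ((M * k1)%:E * lqnorm q cv = M%:E * (k1%:E * lqnorm q cv))%E.
    by rewrite muleA -EFinM.
  rewrite -/M lee_wpmul2l ?lee_fin ?(ltW M0)//.
  apply: le_trans (lqnormZ_le q0 (ltW k10) cv0).
  by apply: le_lqnorm => //; exact: dyadic_lip_ge0.
set kk := k2 + M * k1; have kk0 : 0 <= kk by exact: addr_ge0 (ltW k20) Mk1.
have -> : ((kk * K4 * L)%:E * coef_norm alpha b p q u v =
    kk%:E * (K4%:E * (L%:E * coef_norm alpha b p q u v)))%E by rewrite !muleA -!EFinM.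
rewrite lee_wpmul2l ?lee_fin//.
apply: le_trans (HK4 _ Q0) _; rewrite lee_wpmul2l ?lee_fin ?(ltW K40)//.
exact: coef_norm_lower.
Qed.

(** The step [h = 2 ^ (- m - kap - 1)] is so small that [alpha * 2 ^ m * h <= 1],
    as [frac_diff_lower] requires; the fixed shift [kap] costs only a constant. *)
Lemma weighted_coef_lower : exists K : R, exists kap : nat, 0 < K /\
  forall (f : R -> R) (u v : nat -> R), in_L1_torus f -> has_fourier_series f u v ->
  (forall n, (0 < n)%N -> 0 <= u n) -> (forall n, (0 < n)%N -> 0 <= v n) ->
  gm_with C u -> gm_with C v -> forall m,
  ((Q u v m)%:E <= K%:E * dyadic_lip alpha b p f (m + kap).+1)%E.
Proof.
have [K1 K10 HK1] := frac_diff_lower p1 C0 alpha0.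
have [K2 K20 HK2] := coef_sum_dyadic alpha p1 C0.
pose kap := Num.bound alpha.
pose B := (1 + kap.+1%:R) `^ b : R; have B0 : 0 < B by rewrite powR_gt0// ltr_pwDl.
exists ((K2 * K1) `^ p^-1 * B), kap.
split=> [|f u v L1f fS u0 v0 gu gv m]; first by rewrite mulr_gt0 ?powR_gt0 ?mulr_gt0.
set M := (m + kap).+1; pose h : R := 2^-1 ^+ M.
have h0 : 0 < h by rewrite exprn_gt0 ?invr_gt0.
have mhE : (2 ^ m)%:R * h = 2^-1 ^+ kap.+1.
  rewrite /h /M -addnS exprD natrX exprVn mulrA mulfV ?mul1r// expf_neq0//.
have mh : (2 ^ m)%:R * h <= 1.
  by rewrite mhE exprn_ile1 ?invr_ge0// invf_le1 ?ler1n.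
have amh : alpha * ((2 ^ m)%:R * h) <= 1.
  rewrite mhE exprVn ler_pdivrMr ?exprn_gt0// mul1r.
  have ak : alpha <= kap%:R by rewrite ltW// archi_boundP// ltW.
  apply: (le_trans ak); rewrite -natrX ler_nat ltnW// (leq_trans (ltn_expl kap (ltnSn 1)))//.
  by rewrite leq_exp2l.
pose D := pow2 alpha ^+ M; have D0 : 0 < D by rewrite exprn_gt0 ?powR_gt0.
have hD : h `^ alpha = D^-1.
  rewrite /h powRX ?invr_ge0// /D -exprVn; congr (_ ^+ _).
  by rewrite /pow2 -[2^-1]powR_inv1// -powRrM mulN1r powRN.
have sE i : smooth_size p alpha u v i = D * (((2 ^ i)%:R * h) `^ alpha * block_size p u v i).
  rewrite powRM ?(ltW h0)// hD natrX powRX// /smooth_size -/(pow2 alpha).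
  by field; rewrite gt_eqF.
set I := (\int[mu]_(x in torus) (`|frac_diff alpha h f x|%:E `^ p))%E in HK1 *.
have I0 : (0 <= I)%E by apply: integral_ge0 => x _; exact: poweR_ge0.
have X0 i : 0 <= block_size p u v i.
  by apply: mulr_ge0; [rewrite exprn_ge0 ?powR_ge0|exact: coef_ge0].
have S_le : ((Defs.coef_sum alpha p u v (2 ^ m))%:E <= (K2 * K1 * D `^ p)%:E * I)%E.
  have [hS _] := HK2 u v u0 v0 gu gv m.
  apply: (@le_trans _ _ ((K2 * \sum_(0 <= i < m.+1) smooth_size p alpha u v i `^ p)%:E)).
    by rewrite lee_fin.
  rewrite -mulrA EFinM [X in (_ <= X * _)%E]EFinM -muleA lee_wpmul2l ?lee_fin ?(ltW K20)//.
  rewrite mulrC EFinM -muleA.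
  apply: (@le_trans _ _ ((D `^ p)%:E * \sum_(i <oo) (((i <= m)%:R *
     ((2 ^ i)%:R * h) `^ alpha * block_size p u v i) `^ p)%:E)%E); last first.
    by rewrite lee_wpmul2l ?lee_fin ?powR_ge0//; exact: HK1.
  rewrite -nneseriesZl; last by move=> i _; rewrite lee_fin powR_ge0.
  rewrite -sumEFin; apply: (@le_trans _ _ (\sum_(0 <= i < m.+1) ((D `^ p)%:E *
    (((i <= m)%:R * ((2 ^ i)%:R * h) `^ alpha * block_size p u v i) `^ p)%:E))%E).
    rewrite !big_nat; apply: lee_sum => i /andP[_ im].
    rewrite sE -EFinM lee_fin -ltnS im mul1r powRM ?(ltW D0)//.
    by rewrite mulr_ge0 ?powR_ge0.
  by apply: nneseries_lim_ge => i _ _; rewrite mule_ge0// lee_fin powR_ge0.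
have Z_le : ((Z u v m)%:E <= ((K2 * K1) `^ p^-1 * D)%:E * Lp_norm_torus p (frac_diff alpha h f))%E.
  rewrite Lp_norm_torusE -/I /coef_size -poweR_EFin.
  have -> : (((K2 * K1) `^ p^-1 * D)%:E * I `^ p^-1 = ((K2 * K1 * D `^ p)%:E * I) `^ p^-1)%E.
    rewrite poweRM ?lee_fin ?mulr_ge0 ?powR_ge0 ?(ltW K20) ?(ltW K10)//.
    rewrite poweR_EFin [(K2 * K1 * D `^ p) `^ _]powRM ?mulr_ge0 ?powR_ge0 ?(ltW K20) ?(ltW K10)//.
    by rewrite -[in RHS]powRrM mulfV ?gt_eqF// powRr1// ltW.
  by apply: le_poweR => //; rewrite lee_fin coef_sum_ge0.
have v_le : (Lp_norm_torus p (frac_diff alpha h f) <= dyadic_modulus alpha p f M)%E.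
  by apply: ereal_sup_ubound; exists h => //=; rewrite gtr0_norm.
have w0 : 0 <= (1 + m%:R) `^ (- b) :> R by exact: powR_ge0.
have wle : (1 + m%:R) `^ (- b) <= B * (1 + M%:R) `^ (- b) :> R.
  have k1 : 0 < 1 + kap.+1%:R :> R by rewrite ltr_pwDl.
  have -> : B = (1 + kap.+1%:R)^-1 `^ (- b) :> R.
    by rewrite -[_^-1]powR_inv1 ?(ltW k1)// -powRrM mulrNN mul1r.
  rewrite -powRM ?invr_ge0 ?(ltW k1) ?addr_ge0//; apply: le_powRN => //.
  rewrite mulrC ler_pdivrMr// /M -addnS natrD.
  have : 0 <= m%:R * kap.+1%:R :> R by rewrite mulr_ge0.
  by lra.
rewrite /weighted_coef EFinM; apply: le_trans (lee_wpmul2l _ Z_le) _; first by rewrite lee_fin.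
rewrite /dyadic_lip /dyadic_weight -/D !muleA -!EFinM; apply: lee_pmul => //.
- by rewrite lee_fin !mulr_ge0 ?powR_ge0 ?(ltW D0).
- exact: Lp_norm_ge0.
rewrite lee_fin mulrC -!mulrA ler_wpM2l ?powR_ge0//.
by rewrite [leRHS]mulrCA ler_wpM2l// ltW.
Qed.

Lemma Lip_norm_ge0 (f : R -> R) : (0 <= Lip_norm alpha b p q f)%E.
Proof.
rewrite adde_ge0 ?Lp_norm_ge0//.
have y0 m : (0 <= dyadic_lip alpha b p f m.+1)%E by exact: dyadic_lip_ge0.
have := le_trans (lqnorm_ge0 q0 y0) (Lip_seminorm_lower p alpha0 b0 q0 f).
rewrite pmule_rge0 ?lte_fin//.
by case: (q) => [r||]; rewrite mulr_gt0 ?powR_gt0.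
Qed.

Lemma coef_norm_ge0 (u v : nat -> R) : (0 <= coef_norm alpha b p q u v)%E.
Proof.
have y0 m : (0 <= (Q u v m)%:E)%E by rewrite lee_fin weighted_coef_ge0.
have := le_trans (lqnorm_ge0 q0 y0) (coef_norm_lower alpha p1 b0 q0 u v).
rewrite pmule_rge0 ?lte_fin//.
by case: (q) => [r||]; rewrite mulr_gt0 ?powR_gt0.
Qed.

Lemma Lip_norm_lower : exists2 K : R, 0 < K &
  forall (f : R -> R) (u v : nat -> R), in_L1_torus f -> has_fourier_series f u v ->
  (forall n, (0 < n)%N -> 0 <= u n) -> (forall n, (0 < n)%N -> 0 <= v n) ->
  gm_with C u -> gm_with C v ->
  (coef_norm alpha b p q u v <= K%:E * Lip_norm alpha b p q f)%E.
Proof.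
have [K1 [kap [K10 HK1]]] := weighted_coef_lower.
pose L := pow2 alpha * (if q is r%:E then 2 `^ r^-1 else 1) : R.
have L0 : 0 < L by rewrite /L; case: (q) => [r||]; rewrite mulr_gt0 ?powR_gt0.
exists (4 `^ b * K1 * L).
  by apply: mulr_gt0 => //; apply: mulr_gt0 => //; exact: powR_gt0.
move=> f u v L1f fS u0 v0 gu gv.
apply: le_trans (coef_norm_upper alpha p1 b0 q0 u v) _ => //.
rewrite -mulrA EFinM -muleA lee_wpmul2l ?lee_fin ?powR_ge0//.
pose y m := dyadic_lip alpha b p f m.+1.
have y0 m : (0 <= y m)%E by exact: dyadic_lip_ge0.
apply: (@le_trans _ _ (lqnorm q (fun m => K1%:E * y (m + kap)%N)%E)).
  apply: le_lqnorm => // [i|i]; first by rewrite lee_fin weighted_coef_ge0.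
  exact: (HK1 f).
apply: le_trans (lqnormZ_le q0 (ltW K10) _) _ => //.
rewrite EFinM -muleA lee_wpmul2l ?lee_fin ?(ltW K10)//.
apply: le_trans (lqnorm_shift q0 kap y0) _.
apply: le_trans (Lip_seminorm_lower p alpha0 b0 q0 f) _ => //.
rewrite -/L lee_wpmul2l ?lee_fin ?(ltW L0)// /Lip_norm leeDr//.
exact: Lp_norm_ge0.
Qed.

End NormEquivalence.

Theorem theorem8p12 (R : realType) (p : R) (q : \bar R) (alpha b : R)
    (hp : 1 < p) (hq : (0 < q)%E) (halpha : 0 < alpha)
    (hb : forall r : R, q = r%:E -> r^-1 < b)
    (hb_oo : q = +oo%E -> 0 <= b) :
  forall C : R, 0 < C ->
  exists2 c : R, 0 < c &
    forall (f : R -> R) (a_ b_ : nat -> R),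
      in_L1_torus f ->
      has_fourier_series f a_ b_ ->
      (forall n, (0 < n)%N -> 0 <= a_ n) ->
      (forall n, (0 < n)%N -> 0 <= b_ n) ->
      gm_with C a_ -> gm_with C b_ ->
      equiv_with c (Lip_norm alpha b p q f) (coef_norm alpha b p q a_ b_).
Proof.
move=> C C0.
have b0 : 0 <= b.
  case: q hq hb hb_oo => [r r0 h _|_ _ h|//]; last exact: h.
  by apply/ltW/(lt_trans _ (h r erefl)); rewrite invr_gt0.
have [K1 K10 HK1] := Lip_norm_upper hp C0 halpha b0 hq.
have [K2 K20 HK2] := Lip_norm_lower hp C0 halpha b0 hq.
have c0 : 0 < K1 + K2 by rewrite addr_gt0.
exists (K1 + K2) => // f a_ b_ L1f fS a0 b0' ga gb.
have Lip0 : (0 <= Lip_norm alpha b p q f)%E.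
  exact: Lip_norm_ge0.
have coef0 : (0 <= coef_norm alpha b p q a_ b_)%E by exact: coef_norm_ge0.
split.
  apply: (@le_trans _ _ (((K1 + K2)^-1)%:E * ((K1 + K2)%:E * coef_norm alpha b p q a_ b_))%E).
    rewrite lee_wpmul2l ?lee_fin ?invr_ge0 ?(ltW c0)//.
    apply: le_trans (HK1 f a_ b_ L1f fS a0 b0' ga gb) _.
    by rewrite lee_wpmul2r// lee_fin lerDl ltW.
  by rewrite muleA -EFinM mulVf ?mul1e// gt_eqF.
apply: le_trans (HK2 f a_ b_ L1f fS a0 b0' ga gb) _.
by rewrite lee_wpmul2r// lee_fin lerDr ltW.
Qed.
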